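(* Let $\varphi$ be a well-formed PLDL formula over $P'$ with $\mathrm{var}(\varphi)=\{z\}$, possibly containing changepoint-bounded operators, and let $\alpha$ be a variable valuation. Then there exists a natural number $n\in(3\cdot(\alpha(z)+1))^{\mathcal{O}(|\varphi|)}$ and there exist (1) a non-deterministic Büchi automaton with $n$ states and (2) a deterministic parity automaton with $(n!)^2$ states and $2n$ colors, both effectively constructible, that recognize the language $L(\varphi,\alpha)=\{w\in(2^{P'})^\omega\mid(w,\alpha)\models\varphi\}$.
   Context: Let $P$ be a finite set of propositions, $p\notin P$, $P'=P\cup\{p\}$, $\mathcal{V}$ a set of variables. Formulas: $\varphi ::= a \mid \neg a \mid \varphi\wedge\varphi \mid \varphi\vee\varphi \mid \langle r\rangle\varphi \mid [r]\varphi \mid \langle r\rangle_{\le z}\varphi \mid [r]_{\le z}\varphi \mid \langle r\rangle_{cp}\varphi\mid[r]_{cp}\varphi$ ($a\in P'$, $z\in\mathcal{V}$), regular expressions $r ::= \phi \mid \varphi? \mid r+r \mid r\,;r \mid r^*$ ($\phi$ propositional over $P'$). For $w\in(2^{P'})^\omega$, position $n$, valuation $\alpha:\mathcal{V}\to\mathbb{N}$: literals at $w_n$; $\langle r\rangle\varphi$ iff some $j\in\mathbb{N}$ has $(n,n+j)\in\mathcal{R}(r,w,\alpha)$ and $\varphi$ holds at $n+j$; $[r]\varphi$ iff all such $j$ do; $\langle r\rangle_{\le z},[r]_{\le z}$ likewise with $j\le\alpha(z)$; $\langle r\rangle_{cp},[r]_{cp}$ likewise restricted to $j$ such that at most one of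 positions $n,\dots,n+j-1$ is a changepoint, where $m$ is a changepoint if $m=0$ or the truth value of $p$ differs at $m-1$ and $m$. $\mathcal{R}(\phi)=\{(n,n+1)\mid w_n\models\phi\}$, $\mathcal{R}(\theta?)=\{(n,n)\mid\theta$ holds at $n\}$, $+$ union, $;$ composition, $^*$ reflexive-transitive closure; $(w,\alpha)\models\varphi$ is satisfaction at position 0. $\mathrm{var}(\varphi)$ is the set of variables occurring as bounds of parameterized operators in $\varphi$; well-formed means no variable bounds both a diamond- and a box-operator. $|\varphi|$ = number of subformulas (including those in tests) plus total length of regular expressions. A deterministic parity automaton has a coloring $\Omega:Q\to\mathbb{N}$ and accepts $w$ if on its run the maximal color seen infinitely often is even. *)

(* Defs.v *)
From HB Require Import structures.
From Stdlib Require Import Relation_Operators.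
From mathcomp Require Import all_boot.

Set Implicit Arguments.
Unset Strict Implicit.
Unset Printing Implicit Defensive.

Section Syntax.

(* The propositions P' = P ∪ {p} are [option P]: [Some a] is a ∈ P and [None]
   is the fresh proposition p.  A letter, i.e. an element of 2^P', is a
   [{set option P}]. *)
Variables (P : finType) (V : eqType).

Inductive pform :=
| PAtom of option P
| PNot of pform
| PAnd of pform & pform
| POr of pform & pform.

Inductive form :=
| Pos of option P
| Neg of option P
| And of form & form
| Or of form & form
| Dia of regex & form
| Box of regex & form
| DiaLe of regex & V & form
| BoxLe of regex & V & form
| DiaCp of regex & form
| BoxCp of regex & form
with regex :=
| RProp of pform
| RTest of form
| RPlus of regex & regex
| RSeq of regex & regex
| RStar of regex.

Definition pform_dec (f g : pform) : {f = g} + {f <> g}.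
Proof. by decide equality; apply: eq_comparable. Defined.

Fixpoint form_dec (f g : form) : {f = g} + {f <> g}
with regex_dec (r s : regex) : {r = s} + {r <> s}.
Proof.
- decide equality; exact: eq_comparable.
- decide equality; exact: pform_dec.
Defined.

HB.instance Definition _ := hasDecEq.Build form (compareP form_dec).

(* All subformulas of [f], itself included, also those inside tests (possibly
   with repetitions). *)
Fixpoint subforms (f : form) : seq form :=
  f :: match f with
       | Pos _ | Neg _ => [::]
       | And g h | Or g h => subforms g ++ subforms h
       | Dia r g | Box r g | DiaLe r _ g | BoxLe r _ g
       | DiaCp r g | BoxCp r g => test_subforms r ++ subforms g
       end
with test_subforms (r : regex) : seq form :=
  match r with
  | RProp _ => [::]
  | RTest f => subforms f
  | RPlus r1 r2 | RSeq r1 r2 => test_subforms r1 ++ test_subforms r2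
  | RStar r1 => test_subforms r1
  end.

Definition dia_vars (f : form) : seq V :=
  pmap (fun g => if g is DiaLe _ z _ then Some z else None) (subforms f).

Definition box_vars (f : form) : seq V :=
  pmap (fun g => if g is BoxLe _ z _ then Some z else None) (subforms f).

Definition vars (f : form) : seq V := dia_vars f ++ box_vars f.

Definition well_formed (f : form) : Prop :=
  forall z, z \in dia_vars f -> z \notin box_vars f.

Fixpoint pform_length (f : pform) : nat :=
  match f with
  | PAtom _ => 1
  | PNot g => (pform_length g).+1
  | PAnd g h | POr g h => (pform_length g + pform_length h).+1
  end.

(* A test counts as one symbol here: the tested formula is a subformula and
   is accounted for as such in [fsize]. *)
Fixpoint regex_length (r : regex) : nat :=
  match r with
  | RProp f => pform_length f
  | RTest _ => 1
  | RPlus r1 r2 | RSeq r1 r2 => (regex_length r1 + regex_length r2).+1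
  | RStar r1 => (regex_length r1).+1
  end.

Definition own_regex_length (f : form) : nat :=
  match f with
  | Pos _ | Neg _ | And _ _ | Or _ _ => 0
  | Dia r _ | Box r _ | DiaLe r _ _ | BoxLe r _ _
  | DiaCp r _ | BoxCp r _ => regex_length r
  end.

(* Subformulas form a set, so they are counted without repetitions; a regular
   expression is counted once for each subformula it guards. *)
Definition fsize (f : form) : nat :=
  size (undup (subforms f))
  + \sum_(g <- undup (subforms f)) own_regex_length g.

End Syntax.

Section Semantics.
Variables (P : finType) (V : eqType).
Variables (w : nat -> {set option P}) (alpha : V -> nat).

Fixpoint psat (A : {set option P}) (f : pform P) : bool :=
  match f with
  | PAtom a => a \in A
  | PNot g => ~~ psat A g
  | PAnd g h => psat A g && psat A h
  | POr g h => psat A g || psat A h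
  end.

Definition changepoint (m : nat) : bool :=
  (m == 0) || ((None \in w m.-1) != (None \in w m)).

Definition cp_bounded (n j : nat) : Prop :=
  count changepoint (iota n j) <= 1.

Fixpoint sat (f : form P V) (n : nat) : Prop :=
  match f with
  | Pos a => a \in w n
  | Neg a => a \notin w n
  | And g h => sat g n /\ sat h n
  | Or g h => sat g n \/ sat h n
  | Dia r g => exists j, rel r n (n + j) /\ sat g (n + j)
  | Box r g => forall j, rel r n (n + j) -> sat g (n + j)
  | DiaLe r z g =>
      exists j, [/\ j <= alpha z, rel r n (n + j) & sat g (n + j)]
  | BoxLe r z g =>
      forall j, j <= alpha z -> rel r n (n + j) -> sat g (n + j)
  | DiaCp r g =>
      exists j, [/\ cp_bounded n j, rel r n (n + j) & sat g (n + j)]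
  | BoxCp r g =>
      forall j, cp_bounded n j -> rel r n (n + j) -> sat g (n + j)
  end
with rel (r : regex P V) (m n : nat) : Prop :=
  match r with
  | RProp f => n = m.+1 /\ psat (w m) f
  | RTest f => n = m /\ sat f m
  | RPlus r1 r2 => rel r1 m n \/ rel r2 m n
  | RSeq r1 r2 => exists k, rel r1 m k /\ rel r2 k n
  | RStar r1 => clos_refl_trans nat (rel r1) m n
  end.

End Semantics.

Definition infinitely_often (u : pred nat) : Prop :=
  forall i, exists2 j, i <= j & u j.

Record nba (S : finType) := NBA {
  nba_state : finType;
  nba_init : nba_state;
  nba_trans : nba_state -> S -> {set nba_state};
  nba_final : {set nba_state} }.

Definition nba_accepts (S : finType) (A : nba S) (w : nat -> S) : Prop :=
  exists rho : nat -> nba_state A,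
    [/\ rho 0 = nba_init A,
        forall i, rho i.+1 \in nba_trans (rho i) (w i)
      & infinitely_often (fun i => rho i \in nba_final A)].

Record dpa (S : finType) := DPA {
  dpa_state : finType;
  dpa_init : dpa_state;
  dpa_trans : dpa_state -> S -> dpa_state;
  dpa_color : dpa_state -> nat }.

Fixpoint dpa_run (S : finType) (D : dpa S) (w : nat -> S) (i : nat) :
    dpa_state D :=
  if i is i'.+1 then dpa_trans (dpa_run D w i') (w i') else dpa_init D.

Definition dpa_accepts (S : finType) (D : dpa S) (w : nat -> S) : Prop :=
  let occurs_inf c :=
    infinitely_often (fun i => dpa_color (dpa_run D w i) == c) in
  exists c, [/\ ~~ odd c, occurs_inf c & forall d, occurs_inf d -> d <= c].

Definition dpa_num_colors (S : finType) (D : dpa S) : nat :=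
  size (undup (codom (@dpa_color S D))).

(* Effectiveness is expressed with programs over binary trees, in the style of
   the WHILE language of N. D. Jones; [DNil] plays the role of false.  A
   program denotes a partial function, given by the big-step relation [eval].
   [PRec b s] is structural recursion on the second component of a pair whose
   first component is a parameter; with [PWhile] it is redundant but
   convenient. *)
Inductive data := DNil | DCons of data & data.

Inductive prog :=
| PId
| PNil
| PHd
| PTl
| PCons of prog & prog
| PSeq of prog & prog
| PIf of prog & prog & prog
| PRec of prog & prog
| PWhile of prog & prog.

Inductive eval : prog -> data -> data -> Prop :=
| EId x : eval PId x x
| ENil x : eval PNil x DNil
| EHd0 : eval PHd DNil DNil
| EHd x y : eval PHd (DCons x y) x
| ETl0 : eval PTl DNil DNil
| ETl x y : eval PTl (DCons x y) y
| ECons p q x y z : eval p x y -> eval q x z -> eval (PCons p q) x (DCons y z)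
| ESeq p q x y z : eval p x y -> eval q y z -> eval (PSeq p q) x z
| EIfTrue c p q x u v y :
    eval c x (DCons u v) -> eval p x y -> eval (PIf c p q) x y
| EIfFalse c p q x y : eval c x DNil -> eval q x y -> eval (PIf c p q) x y
| ERecNil b s x y : eval b x y -> eval (PRec b s) (DCons x DNil) y
| ERecCons b s x l r yl yr y :
    eval (PRec b s) (DCons x l) yl -> eval (PRec b s) (DCons x r) yr ->
    eval s (DCons x (DCons (DCons l r) (DCons yl yr))) y ->
    eval (PRec b s) (DCons x (DCons l r)) y
| EWhileStop c b x : eval c x DNil -> eval (PWhile c b) x x
| EWhileStep c b x u v y z :
    eval c x (DCons u v) -> eval b x y -> eval (PWhile c b) y z ->
    eval (PWhile c b) x z.

Definition dnum (n : nat) : data := iter n (DCons DNil) DNil.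

Definition dbool (b : bool) : data := dnum b.

Definition dlist (s : seq data) : data := foldr DCons DNil s.

Definition dtag (k : nat) (s : seq data) : data := DCons (dnum k) (dlist s).

Definition dord (T : finType) (x : T) : data := dnum (enum_rank x).

Fixpoint dpform (P : finType) (f : pform P) : data :=
  match f with
  | PAtom a => dtag 0 [:: dord a]
  | PNot g => dtag 1 [:: dpform g]
  | PAnd g h => dtag 2 [:: dpform g; dpform h]
  | POr g h => dtag 3 [:: dpform g; dpform h]
  end.

(* Variables are coded by their position in the list [s]; the coding is
   faithful on formulas all of whose variables, except possibly one, are
   in [s]. *)
Fixpoint dform (P : finType) (V : eqType) (s : seq V) (f : form P V) : data :=
  match f with
  | Pos a => dtag 0 [:: dord a]
  | Neg a => dtag 1 [:: dord a]
  | And g h => dtag 2 [:: dform s g; dform s h]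
  | Or g h => dtag 3 [:: dform s g; dform s h]
  | Dia r g => dtag 4 [:: dregex s r; dform s g]
  | Box r g => dtag 5 [:: dregex s r; dform s g]
  | DiaLe r z g => dtag 6 [:: dregex s r; dnum (index z s); dform s g]
  | BoxLe r z g => dtag 7 [:: dregex s r; dnum (index z s); dform s g]
  | DiaCp r g => dtag 8 [:: dregex s r; dform s g]
  | BoxCp r g => dtag 9 [:: dregex s r; dform s g]
  end
with dregex (P : finType) (V : eqType) (s : seq V) (r : regex P V) : data :=
  match r with
  | RProp f => dtag 0 [:: dpform f]
  | RTest f => dtag 1 [:: dform s f]
  | RPlus r1 r2 => dtag 2 [:: dregex s r1; dregex s r2]
  | RSeq r1 r2 => dtag 3 [:: dregex s r1; dregex s r2]
  | RStar r1 => dtag 4 [:: dregex s r1]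
  end.

(* Automata are coded by their full tables, states and letters being listed in
   the order of [enum]. *)
Definition dset (T : finType) (X : {set T}) : data :=
  dlist [seq dbool (x \in X) | x <- enum T].

Definition dnba (S : finType) (A : nba S) : data :=
  dlist [:: dord (nba_init A);
            dlist [seq dlist [seq dset (nba_trans q a) | a <- enum S]
                  | q <- enum (nba_state A)];
            dset (nba_final A)].

Definition ddpa (S : finType) (D : dpa S) : data :=
  dlist [:: dord (dpa_init D);
            dlist [seq dlist [seq dord (dpa_trans q a) | a <- enum S]
                  | q <- enum (dpa_state D)];
            dlist [seq dnum (dpa_color q) | q <- enum (dpa_state D)]].

(* Main.v *)
From HB Require Import structures.
From Stdlib Require Import Relation_Operators ClassicalEpsilon.
Require Import Defs.
From mathcomp Require Import all_boot zify.

Set Implicit Arguments.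
Unset Strict Implicit.
Unset Printing Implicit Defensive.

(**
Every modal subformula is evaluated from right to left along the word.  For each
position [q] of the Glushkov automaton of its regular expression, a state
guesses the capped minimal cost d_q of completing a match after [q], where a
letter costs 0, 1 or the indicator of a changepoint, depending on the operator,
and the budget is 0, alpha z or 1.  These values, hence the truth of all
subformulas, are determined by the next letter and the next values, so each
reachable state has a unique reachable predecessor.  A second copy e of the
values, reset to infinity whenever it agrees with d, checks that finite values
are realized: the Büchi condition asks for infinitely many resets, and an
accepting e exists by König's lemma.

Because of the unique predecessors the runs form a forest of width at most m,
and Safra trees reduce to a list, ordered by age, of sets of states (trackers),
each being the set of descendants of one state.  Such sets are laminar, so at
most m^2 of them are alive.  A tracker fires when all its members have visited
a final state since it last fired.  After finitely many branchings an accepting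
run is the only infinite branch below one of its states, and the tracker started
there fires infinitely often.

Everything is computed on codes by structural recursion; the automata are padded
to n = m^4 and (n!)^2 states.
*)

(** * Programs *)

(** Truth at a position depends on the whole suffix of the word, so computing from right to left
    makes it a function of the next letter and the next state. A box is then the negated verdict on
    a search for a violating match, and no automaton has to be complemented. The obstacle is that
    the equations for d have spurious solutions: a star may postpone its end forever, for free when
    letters cost nothing, and a finite value is then realized by no match. The exponents arise as
    follows. The flag and the two tables of a state have together at most 2 |phi| entries, so m is
    at most (3 (alpha z + 1))^(2 |phi|). The tracker lists of the deterministic automaton are stored
    as words of length 1 + m^3 over 2 m^2 + 2 symbols, which are far more than (m!)^2. Passing to n
    = m^4 makes (n!)^2 large enough and costs only a factor 4 in the exponent. *)

Definition realizable (g : data -> data) := exists p, forall x, eval p x (g x).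

Definition dhd (x : data) := if x is DCons y _ then y else DNil.
Definition dtl (x : data) := if x is DCons _ y then y else DNil.

Lemma realizable_id : realizable id.
Proof. by exists PId => x; constructor. Qed.

Lemma realizable_const c : realizable (fun=> c).
Proof.
elim: c => [|l [p Hp] r [q Hq]]; first by exists PNil => x; constructor.
by exists (PCons p q) => x; constructor.
Qed.

Lemma realizable_comp f g :
  realizable f -> realizable g -> realizable (fun x => g (f x)).
Proof. by move=> [p Hp] [q Hq]; exists (PSeq p q) => x; econstructor. Qed.

Lemma realizable_cons f g : realizable f -> realizable g ->
  realizable (fun x => DCons (f x) (g x)).
Proof. by move=> [p Hp] [q Hq]; exists (PCons p q) => x; constructor. Qed.

Lemma realizable_hd f : realizable f -> realizable (fun x => dhd (f x)).
Proof.
move=> [p Hp]; exists (PSeq p PHd) => x; econstructor; first exact: Hp.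
by case: (f x) => [|l r]; constructor.
Qed.

Lemma realizable_tl f : realizable f -> realizable (fun x => dtl (f x)).
Proof.
move=> [p Hp]; exists (PSeq p PTl) => x; econstructor; first exact: Hp.
by case: (f x) => [|l r]; constructor.
Qed.

Definition dif (c x y : data) := if c is DCons _ _ then x else y.

Lemma realizable_if c f g : realizable c -> realizable f -> realizable g ->
  realizable (fun x => dif (c x) (f x) (g x)).
Proof.
move=> [p Hp] [q Hq] [r Hr]; exists (PIf p q r) => x; have := Hp x.
by case: (c x) => [|u v] H; [apply: EIfFalse | apply: EIfTrue; first exact: H].
Qed.

(** The total function denoted by [PRec]. All iterations and folds below are reduced to it, so the
    construction never has to argue that a loop terminates. *)
Fixpoint drec (b s : data -> data) (x t : data) : data :=
  match t with
  | DNil => b x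
  | DCons l r => s (DCons x (DCons t (DCons (drec b s x l) (drec b s x r))))
  end.

Lemma realizable_drec b s f g :
  realizable b -> realizable s -> realizable f -> realizable g ->
  realizable (fun x => drec b s (f x) (g x)).
Proof.
move=> [pb Hb] [ps Hs] [pf Hf] [pg Hg].
exists (PSeq (PCons pf pg) (PRec pb ps)) => x.
apply: (@ESeq _ _ _ (DCons (f x) (g x))); first by constructor.
elim: (g x) => [|l IHl r IHr] /=; first by apply: ERecNil.
exact: ERecCons IHl IHr (Hs _).
Qed.

(** * Computable functions between coded types *)

Class code (T : Type) := enc : T -> data.
#[global] Instance code_data : code data := id.
#[global] Instance code_nat : code nat := dnum.
#[global] Instance code_bool : code bool := dbool.
#[global] Instance code_prod A B (a : code A) (b : code B) : code (A * B) :=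
  fun x => DCons (a x.1) (b x.2).
#[global] Instance code_seq A (a : code A) : code (seq A) :=
  fun s => dlist (map a s).

(** The program has to halt on every tree, but its result is constrained on codes only. *)
Definition computable {A B} {a : code A} {b : code B} (f : A -> B) :=
  exists2 g, realizable g & forall x, g (enc x) = enc (f x).

Section Combinators.
Context {X A B C : Type} {x0 : code X} {a0 : code A} {b0 : code B} {c0 : code C}.

Lemma computable_ext (f g : X -> A) :
  (forall x, f x = g x) -> computable g -> computable f.
Proof. by move=> E [h rh Hh]; exists h => // x; rewrite E. Qed.

Lemma computable_id : computable (fun x : X => x).
Proof. by exists id => //; exact: realizable_id. Qed.

Lemma computable_const (c : A) : computable (fun _ : X => c).
Proof. by exists (fun=> enc c) => //; exact: realizable_const. Qed.

Lemma computable_comp (f : X -> A) (g : A -> B) :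
  computable g -> computable f -> computable (fun x => g (f x)).
Proof.
move=> [g' rg Hg] [f' rf Hf]; exists (fun x => g' (f' x)) => [|x].
  exact: realizable_comp.
by rewrite Hf Hg.
Qed.

Lemma computable_pair (f : X -> A) (g : X -> B) :
  computable f -> computable g -> computable (fun x => (f x, g x)).
Proof.
move=> [f' rf Hf] [g' rg Hg]; exists (fun x => DCons (f' x) (g' x)) => [|x].
  exact: realizable_cons.
by rewrite Hf Hg.
Qed.

Lemma computable_fst (f : X -> A * B) :
  computable f -> computable (fun x => (f x).1).
Proof.
move=> [f' rf Hf]; exists (fun x => dhd (f' x)) => [|x].
  exact: realizable_hd.
by rewrite Hf.
Qed.

Lemma computable_snd (f : X -> A * B) :
  computable f -> computable (fun x => (f x).2).
Proof.
move=> [f' rf Hf]; exists (fun x => dtl (f' x)) => [|x].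
  exact: realizable_tl.
by rewrite Hf.
Qed.

Lemma computable_if (c : X -> bool) (f g : X -> A) :
  computable c -> computable f -> computable g ->
  computable (fun x => if c x then f x else g x).
Proof.
move=> [c' rc Hc] [f' rf Hf] [g' rg Hg].
exists (fun x => dif (c' x) (f' x) (g' x)) => [|x]; first exact: realizable_if.
by rewrite Hc Hf Hg; case: (c x).
Qed.

Lemma computable_cons (f : X -> A) (g : X -> seq A) :
  computable f -> computable g -> computable (fun x => f x :: g x).
Proof.
move=> [f' rf Hf] [g' rg Hg]; exists (fun x => DCons (f' x) (g' x)) => [|x].
  exact: realizable_cons.
by rewrite Hf Hg.
Qed.

Lemma computable_behead (f : X -> seq A) :
  computable f -> computable (fun x => behead (f x)).
Proof.
move=> [f' rf Hf]; exists (fun x => dtl (f' x)) => [|x].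
  exact: realizable_tl.
by rewrite Hf; case: (f x).
Qed.

Lemma computable_head (c : X -> A) (f : X -> seq A) :
  computable c -> computable f -> computable (fun x => head (c x) (f x)).
Proof.
move=> [c' rc Hc] [f' rf Hf].
exists (fun x => dif (f' x) (dhd (f' x)) (c' x)) => [|x].
  by apply: realizable_if => //; apply: realizable_hd.
by rewrite Hf Hc; case: (f x).
Qed.

Lemma computable_S (f : X -> nat) :
  computable f -> computable (fun x => (f x).+1).
Proof.
move=> [f' rf Hf]; exists (fun x => DCons DNil (f' x)) => [|x].
  by apply: realizable_cons => //; exact: realizable_const.
by rewrite Hf.
Qed.

Lemma computable_predn (f : X -> nat) :
  computable f -> computable (fun x => (f x).-1).
Proof.
move=> [f' rf Hf]; exists (fun x => dtl (f' x)) => [|x].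
  exact: realizable_tl.
by rewrite Hf; case: (f x).
Qed.

Lemma computable_DCons (f g : X -> data) :
  computable f -> computable g -> computable (fun x => DCons (f x) (g x)).
Proof.
move=> [f' rf Hf] [g' rg Hg]; exists (fun x => DCons (f' x) (g' x)) => [|x].
  exact: realizable_cons.
by rewrite Hf Hg.
Qed.

Lemma computable_dhd (f : X -> data) :
  computable f -> computable (fun x => dhd (f x)).
Proof.
move=> [f' rf Hf]; exists (fun x => dhd (f' x)) => [|x].
  exact: realizable_hd.
by rewrite Hf.
Qed.

Lemma computable_dtl (f : X -> data) :
  computable f -> computable (fun x => dtl (f x)).
Proof.
move=> [f' rf Hf]; exists (fun x => dtl (f' x)) => [|x].
  exact: realizable_tl.
by rewrite Hf.
Qed.

Lemma computable_enc (f : X -> A) :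
  computable f -> computable (fun x => enc (f x) : data).
Proof. by move=> [f' rf Hf]; exists f'. Qed.

Lemma computable_foldr (F : X -> B -> C -> C) (z : X -> C) (l : X -> seq B) :
  computable (fun y : X * (B * C) => F y.1 y.2.1 y.2.2) -> computable z ->
  computable l -> computable (fun x => foldr (F x) (z x) (l x)).
Proof.
move=> [F' rF HF] [z' rz Hz] [l' rl Hl].
(* The argument is the parameter, the current cell, and the results on its head and on its tail; the
   result on the head is discarded. *)
pose s y := F' (DCons (dhd y) (DCons (dhd (dhd (dtl y))) (dtl (dtl (dtl y))))).
exists (fun x => drec z' s x (l' x)) => [|x].
  apply: realizable_drec => //; last exact: realizable_id.
  apply: realizable_comp rF; apply: realizable_cons.
    exact: realizable_hd realizable_id.
  apply: realizable_cons.
    exact: realizable_hd (realizable_hd (realizable_tl realizable_id)).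
  exact: realizable_tl (realizable_tl (realizable_tl realizable_id)).
rewrite Hl; elim: (l x) => [|h t IH] /=; first exact: Hz.
by rewrite IH /s /=; exact: (HF (x, (h, foldr (F x) (z x) t))).
Qed.

Lemma computable_iteri (F : X -> nat -> C -> C) (z : X -> C) (n : X -> nat) :
  computable (fun y : X * (nat * C) => F y.1 y.2.1 y.2.2) -> computable z ->
  computable n -> computable (fun x => iteri (n x) (F x) (z x)).
Proof.
move=> [F' rF HF] [z' rz Hz] [l' rl Hl].
pose s y := F' (DCons (dhd y) (DCons (dtl (dhd (dtl y))) (dtl (dtl (dtl y))))).
exists (fun x => drec z' s x (l' x)) => [|x].
  apply: realizable_drec => //; last exact: realizable_id.
  apply: realizable_comp rF; apply: realizable_cons.
    exact: realizable_hd realizable_id.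
  apply: realizable_cons.
    exact: realizable_tl (realizable_hd (realizable_tl realizable_id)).
  exact: realizable_tl (realizable_tl (realizable_tl realizable_id)).
rewrite Hl; elim: (n x) => [|k IH] /=; first exact: Hz.
by rewrite IH /s /=; exact: (HF (x, (k, iteri k (F x) (z x)))).
Qed.

Fixpoint dfold (T : Type) (b : T) (s : data -> T -> T -> T) (t : data) : T :=
  if t is DCons l r then s t (dfold b s l) (dfold b s r) else b.

Lemma computable_dfold (F : X -> data -> C -> C -> C) (z : X -> C)
    (t : X -> data) :
  computable (fun y : X * (data * (C * C)) => F y.1 y.2.1 y.2.2.1 y.2.2.2) ->
  computable z -> computable t ->
  computable (fun x => dfold (z x) (F x) (t x)).
Proof.
move=> [F' rF HF] [z' rz Hz] [l' rl Hl].
exists (fun x => drec z' F' x (l' x)) => [|x].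
  by apply: realizable_drec => //; exact: realizable_id.
rewrite Hl; elim: (t x) => [|l IHl r IHr] /=; first exact: Hz.
have E y : drec z' F' (enc x) (enc y) = drec z' F' (enc x) y by [].
move: IHl IHr; rewrite !E => -> ->.
exact: (HF (x, (DCons l r, (dfold (z x) (F x) l, dfold (z x) (F x) r)))).
Qed.

End Combinators.

(** Goals are taken apart along the head symbol of the function body. The body of an iteration lives
    over a larger domain such as [X * A], so a lemma serves there only once the section that fixes
    its [X] is closed. This dictates the layers of sections below; each layer of lemmas is added to
    the hook [computable_user]. *)
Ltac computable_step :=
  lazy beta;
  first [ assumption
        | simple apply computable_const
        | simple apply computable_id
        | match goal with
          | H : computable ?f |- computable (fun x => ?f (@?g x)) =>
              refine (computable_comp (f := g) H _)
          end
        | simple apply computable_fst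
        | simple apply computable_snd
        | simple apply computable_pair
        | simple apply computable_if
        | simple apply computable_cons
        | simple apply computable_behead
        | simple apply computable_head
        | simple apply computable_S
        | simple apply computable_predn
        | simple apply computable_DCons
        | simple apply computable_dhd
        | simple apply computable_dtl
        | simple apply computable_foldr
        | simple apply computable_iteri
        | simple apply computable_dfold ].
Ltac computable_user := fail.
Ltac computability := repeat first [ computable_step | computable_user ].

Section Arithmetic.
Context {X : Type} {x0 : code X}.
Implicit Types (f g : X -> nat) (b c : X -> bool).

Lemma computable_nat_of_bool b :
  computable b -> computable (fun x => nat_of_bool (b x)).
Proof. by move=> [h rh H]; exists h. Qed.

Lemma computable_dnum f : computable f -> computable (fun x => dnum (f x)).
Proof. by move=> [h rh H]; exists h. Qed.

Lemma computable_iter {A} {a : code A} (F : X -> A -> A) (z : X -> A) f :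
  computable (fun y : X * A => F y.1 y.2) -> computable z -> computable f ->
  computable (fun x => iter (f x) (F x) (z x)).
Proof.
move=> cF cz cf.
apply: (computable_ext (g := fun x => iteri (f x) (fun _ => F x) (z x))).
  by move=> x; elim: (f x) => //= n ->.
apply: computable_iteri => //.
by apply: (computable_comp (f := fun y => (y.1, y.2.2)) cF); computability.
Qed.

Lemma computable_negb b : computable b -> computable (fun x => ~~ b x).
Proof.
move=> cb; apply: (computable_ext (g := fun x => if b x then false else true)).
  by move=> x; case: (b x).
by computability.
Qed.

Lemma computable_andb b c :
  computable b -> computable c -> computable (fun x => b x && c x).
Proof.
move=> cb cc; apply: (computable_ext (g := fun x => if b x then c x else false)).
  by move=> x; case: (b x).
by computability.
Qed.

Lemma computable_orb b c :
  computable b -> computable c -> computable (fun x => b x || c x).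
Proof.
move=> cb cc; apply: (computable_ext (g := fun x => if b x then true else c x)).
  by move=> x; case: (b x).
by computability.
Qed.

Lemma computable_eqb b c :
  computable b -> computable c -> computable (fun x => b x == c x).
Proof.
move=> cb cc; apply: (computable_ext
  (g := fun x => if b x then c x else if c x then false else true)).
  by move=> x; case: (b x); case: (c x).
by computability.
Qed.

Lemma computable_addb b c :
  computable b -> computable c -> computable (fun x => b x (+) c x).
Proof.
move=> cb cc; apply: (computable_ext (g := fun x => ~~ (b x == c x))).
  by move=> x; case: (b x); case: (c x).
by apply: computable_negb; apply: computable_eqb.
Qed.

Lemma computable_addn f g :
  computable f -> computable g -> computable (fun x => f x + g x).
Proof.
move=> cf cg; apply: (computable_ext (g := fun x => iter (f x) succn (g x))).
  by move=> x; rewrite iter_succn addnC.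
by apply: computable_iter => //; computability.
Qed.

Lemma computable_subn f g :
  computable f -> computable g -> computable (fun x => f x - g x).
Proof.
move=> cf cg; apply: (computable_ext (g := fun x => iter (g x) predn (f x))).
  by move=> x; rewrite iter_predn.
by apply: computable_iter => //; computability.
Qed.

End Arithmetic.

Section Multiplication.
Context {X : Type} {x0 : code X}.
Implicit Types (f g : X -> nat) (b c : X -> bool).

Lemma computable_muln f g :
  computable f -> computable g -> computable (fun x => f x * g x).
Proof.
move=> cf cg; apply: (computable_ext (g := fun x => iter (f x) (addn (g x)) 0)).
  by move=> x; rewrite iter_addn_0 mulnC.
apply: computable_iter => //; last by computability.
by simple apply computable_addn; computability.
Qed.

End Multiplication.

Section Exponentiation.
Context {X : Type} {x0 : code X}.
Implicit Types (f g : X -> nat) (b c : X -> bool).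

Lemma computable_expn f g :
  computable f -> computable g -> computable (fun x => f x ^ g x).
Proof.
move=> cf cg; apply: (computable_ext (g := fun x => iter (g x) (muln (f x)) 1)).
  by move=> x; rewrite iter_muln_1.
apply: computable_iter => //; last by computability.
by simple apply computable_muln; computability.
Qed.

Lemma computable_factorial f : computable f -> computable (fun x => (f x)`!).
Proof.
move=> cf.
apply: (computable_ext (g := fun x => iteri (f x) (fun n r => n.+1 * r) 1)).
  by move=> x; elim: (f x) => // n IH; rewrite factS IH.
apply: computable_iteri => //; last by computability.
by simple apply computable_muln; computability.
Qed.

Lemma computable_eq0 f : computable f -> computable (fun x => f x == 0).
Proof.
move=> cf.
apply: (computable_ext (g := fun x => iteri (f x) (fun _ _ => false) true)).
  by move=> x; case: (f x).
by computability.
Qed.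

Lemma computable_leq f g :
  computable f -> computable g -> computable (fun x => f x <= g x).
Proof. by move=> cf cg; apply: computable_eq0; apply: computable_subn. Qed.

Lemma computable_eqn f g :
  computable f -> computable g -> computable (fun x => f x == g x).
Proof.
move=> cf cg.
apply: (computable_ext (g := fun x => (f x <= g x) && (g x <= f x))).
  by move=> x; rewrite eqn_leq.
by apply: computable_andb; apply: computable_leq.
Qed.

Lemma computable_minn f g :
  computable f -> computable g -> computable (fun x => minn (f x) (g x)).
Proof.
move=> cf cg; apply: computable_if => //.
by apply: computable_leq => //; apply: computable_S.
Qed.
End Exponentiation.

Ltac computable_arith :=
  first [ simple apply computable_nat_of_bool
        | simple apply computable_dnum
        | simple apply computable_negb
        | simple apply computable_andb
        | simple apply computable_orb
        | simple apply computable_eqb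
        | simple apply computable_addb
        | simple apply computable_addn
        | simple apply computable_subn
        | simple apply computable_muln
        | simple apply computable_expn
        | simple apply computable_factorial
        | simple apply computable_eqn
        | simple apply computable_leq
        | simple apply computable_minn
        | simple apply computable_iter ].
Ltac computable_user ::= computable_arith.

Section Sequences.
Context {X : Type} {x0 : code X} {A B : Type} {a0 : code A} {b0 : code B}.
Implicit Types (s t : X -> seq A) (n : X -> nat).

Lemma computable_map (F : X -> A -> B) s :
  computable (fun y : X * A => F y.1 y.2) -> computable s ->
  computable (fun x => map (F x) (s x)).
Proof.
move=> cF cs.
apply: (computable_ext (g := fun x => foldr (fun b c => F x b :: c) [::] (s x))).
  by move=> x; elim: (s x) => //= b r ->.
computability.
by apply: (computable_comp (f := fun y => (y.1, y.2.1)) cF); computability.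
Qed.

Lemma computable_filter (F : X -> A -> bool) s :
  computable (fun y : X * A => F y.1 y.2) -> computable s ->
  computable (fun x => filter (F x) (s x)).
Proof.
move=> cF cs.
apply: (computable_ext
  (g := fun x => foldr (fun b c => if F x b then b :: c else c) [::] (s x))).
  by move=> x; elim: (s x) => //= b r ->.
computability.
by apply: (computable_comp (f := fun y => (y.1, y.2.1)) cF); computability.
Qed.

Lemma computable_has (F : X -> A -> bool) s :
  computable (fun y : X * A => F y.1 y.2) -> computable s ->
  computable (fun x => has (F x) (s x)).
Proof.
move=> cF cs.
apply: (computable_ext (g := fun x => foldr (fun b c => F x b || c) false (s x))).
  by move=> x; elim: (s x) => //= b r ->.
computability.
by apply: (computable_comp (f := fun y => (y.1, y.2.1)) cF); computability.
Qed.

Lemma computable_all (F : X -> A -> bool) s :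
  computable (fun y : X * A => F y.1 y.2) -> computable s ->
  computable (fun x => all (F x) (s x)).
Proof.
move=> cF cs.
apply: (computable_ext (g := fun x => foldr (fun b c => F x b && c) true (s x))).
  by move=> x; elim: (s x) => //= b r ->.
computability.
by apply: (computable_comp (f := fun y => (y.1, y.2.1)) cF); computability.
Qed.

Lemma computable_size s : computable s -> computable (fun x => size (s x)).
Proof.
move=> cs.
apply: (computable_ext (g := fun x => foldr (fun _ => succn) 0 (s x))).
  by move=> x; elim: (s x) => //= b r ->.
by computability.
Qed.

Lemma computable_cat s t :
  computable s -> computable t -> computable (fun x => s x ++ t x).
Proof.
move=> cs ct.
apply: (computable_ext (g := fun x => foldr cons (t x) (s x))).
  by move=> x; elim: (s x) => //= b r ->.
by computability.
Qed.

Lemma computable_drop n s :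
  computable n -> computable s -> computable (fun x => drop (n x) (s x)).
Proof.
move=> cn cs.
apply: (computable_ext (g := fun x => iter (n x) behead (s x))).
  move=> x; elim: (n x) => [|k IH]; first by rewrite drop0.
  by rewrite -addn1 addnC -drop_drop IH /= drop1.
by computability.
Qed.

Lemma computable_nth (c : X -> A) s n :
  computable c -> computable s -> computable n ->
  computable (fun x => nth (c x) (s x) (n x)).
Proof.
move=> cc cs cn.
apply: (computable_ext (g := fun x => head (c x) (drop (n x) (s x)))).
  by move=> x; rewrite -nth0 nth_drop addn0.
by computability; exact: computable_drop.
Qed.

Lemma computable_nseq n (c : X -> A) :
  computable n -> computable c -> computable (fun x => nseq (n x) (c x)).
Proof.
move=> cn cc.
apply: (computable_ext (g := fun x => iter (n x) (cons (c x)) [::])) => //.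
by computability.
Qed.
End Sequences.

Ltac computable_seq :=
  first [ simple apply computable_map
        | simple apply computable_filter
        | simple apply computable_has
        | simple apply computable_all
        | simple apply computable_size
        | simple apply computable_cat
        | simple apply computable_drop
        | simple apply computable_nth
        | simple apply computable_nseq ].
Ltac computable_user ::= first [ computable_arith | computable_seq ].

Section MoreSequences.
Context {X : Type} {x0 : code X} {A : Type} {a0 : code A}.

Lemma computable_rcons (s : X -> seq A) (c : X -> A) :
  computable s -> computable c -> computable (fun x => rcons (s x) (c x)).
Proof.
move=> cs cc; apply: (computable_ext (g := fun x => s x ++ [:: c x])).
  by move=> x; rewrite cats1.
by computability.
Qed.

Lemma computable_iota n :
  computable n -> computable (fun x : X => iota 0 (n x)).
Proof.
move=> cn.
apply: (computable_ext (g := fun x => iteri (n x) (fun i s => s ++ [:: i]) [::])).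
  by move=> x; elim: (n x) => // k IH; rewrite -addn1 iotaD IH addn1 /= add0n.
by computability.
Qed.

(** No default element is at hand, so the prefix is assembled from segments of length at most one. A
    fold that ignores its recursive result acts as a case distinction on a list. *)
Lemma computable_take n (s : X -> seq A) :
  computable n -> computable s -> computable (fun x => take (n x) (s x)).
Proof.
move=> cn cs.
apply: (computable_ext (g := fun x => flatten
  [seq take 1 (drop i (s x)) | i <- iota 0 (n x)])).
  move=> x; elim: (n x) => [|k IH]; first by rewrite take0.
  by rewrite -addn1 takeD IH iotaD map_cat flatten_cat /= cats0 add0n.
apply: (computable_ext (g := fun x => foldr
  (fun i r => foldr (fun y _ => y :: r) r (drop i (s x))) [::] (iota 0 (n x)))).
  move=> x; elim: (iota _ _) => //= i r ->.
  by case: (drop i (s x)) => //= y t; rewrite take0.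
computability.
exact: computable_iota.
Qed.

Lemma computable_flatten (s : X -> seq (seq A)) :
  computable s -> computable (fun x => flatten (s x)).
Proof.
by move=> cs; rewrite /flatten; computability.
Qed.
End MoreSequences.

Ltac computable_seq2 :=
  first [ computable_seq
        | simple apply computable_rcons
        | simple apply computable_iota
        | simple apply computable_take
        | simple apply computable_flatten ].
Ltac computable_user ::= first [ computable_arith | computable_seq2 ].

Section Equality.
Context {X : Type} {x0 : code X} {A : eqType} {a0 : code A}.
Hypothesis eqA : computable (fun y : A * A => y.1 == y.2).

Lemma computable_eqop (f g : X -> A) :
  computable f -> computable g -> computable (fun x => f x == g x).
Proof.
by move=> cf cg; apply: (computable_comp (f := fun x => (f x, g x)) eqA); computability.
Qed.

End Equality.

Section Membership.
Context {X : Type} {x0 : code X} {A : eqType} {a0 : code A}.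
Hypothesis eqA : computable (fun y : A * A => y.1 == y.2).

(** A fold cannot descend into two lists at once; hence the comparison of lengths and then of the
    entries index by index, with folds as case distinctions to access the entries. *)
Lemma computable_eq_seq (s t : X -> seq A) :
  computable s -> computable t -> computable (fun x => s x == t x).
Proof.
move=> cs ct.
apply: (computable_ext (g := fun x => (size (s x) == size (t x)) &&
  all (fun i => take 1 (drop i (s x)) == take 1 (drop i (t x)))
    (iota 0 (size (s x))))).
  move=> x; apply/eqP/andP => [->|[/eqP E /allP H]].
    by split=> //; apply/allP.
  case: (s x) E H => [|a r] E H; first by move/esym/size0nil: E => ->.
  apply: (@eq_from_nth _ a) => // i Hi.
  have := H i; rewrite mem_iota add0n /= => /(_ Hi) /eqP.
  by rewrite (drop_nth a Hi) (@drop_nth _ a i) -?E //= !take0 => -[].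
apply: (computable_ext (g := fun x => (size (s x) == size (t x)) &&
  all (fun i => foldr (fun a _ => foldr (fun b _ => a == b) true (drop i (t x)))
     true (drop i (s x))) (iota 0 (size (s x))))).
  move=> x; case: eqP => //= E; apply: eq_in_all => i; rewrite mem_iota /= add0n => Hi.
  have Hi' : i < size (t x) by rewrite -E.
  case: (s x) Hi E => // a r Hi E.
  rewrite (drop_nth a Hi) (drop_nth a Hi') /= !take0.
  by rewrite eqseq_cons eqxx andbT.
computability.
by apply: (computable_eqop eqA); computability.
Qed.

Lemma computable_mem (c : X -> A) (s : X -> seq A) :
  computable c -> computable s -> computable (fun x => c x \in s x).
Proof.
move=> cc cs; apply: (computable_ext (g := fun x => has (fun b => c x == b) (s x))).
  move=> x; apply/idP/hasP => [H|[y H /eqP ->]] //; by exists (c x).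
by computability; apply: (computable_eqop eqA); computability.
Qed.

Lemma computable_index (c : X -> A) (s : X -> seq A) :
  computable c -> computable s -> computable (fun x => index (c x) (s x)).
Proof.
move=> cc cs; apply: (computable_ext (g := fun x =>
  foldr (fun b n => if b == c x then 0 else n.+1) 0 (s x))).
  by move=> x; elim: (s x) => //= b r ->.
by computability; apply: (computable_eqop eqA); computability.
Qed.

End Membership.

Section Undup.
Context {X : Type} {x0 : code X} {A : eqType} {a0 : code A}.
Hypothesis eqA : computable (fun y : A * A => y.1 == y.2).

Lemma computable_undup (s : X -> seq A) :
  computable s -> computable (fun x => undup (s x)).
Proof.
move=> cs; apply: (computable_ext (g := fun x =>
  foldr (fun b (r : seq A) => if b \in r then r else b :: r) [::] (s x))).
  by move=> x; elim: (s x) => //= b r <-; rewrite mem_undup.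
by computability; simple apply (computable_mem eqA); computability.
Qed.
End Undup.

Lemma computable_eqn_pair : computable (fun y : nat * nat => y.1 == y.2).
Proof. by computability. Qed.

Lemma computable_eqb_pair : computable (fun y : bool * bool => y.1 == y.2).
Proof. by computability. Qed.

Lemma computable_eqseqn_pair :
  computable (fun y : seq nat * seq nat => y.1 == y.2).
Proof. by apply: (computable_eq_seq computable_eqn_pair); computability. Qed.

(** * Codes of syntax trees *)

Lemma data_dec (x y : data) : {x = y} + {x <> y}.
Proof. by decide equality. Defined.
HB.instance Definition _ := hasDecEq.Build data (compareP data_dec).

(** Polish notation of a tree. It is a prefix code, so equality of trees, which would need recursion
    on two trees at once, becomes equality of words. *)
Definition serialize : data -> seq bool :=
  dfold [:: false] (fun _ a b => true :: a ++ b).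

Lemma serialize_cat_inj x y u v :
  serialize x ++ u = serialize y ++ v -> x = y /\ u = v.
Proof.
elim: x y u v => [|l IHl r IHr] [|l' r'] u v //=; first by case.
by rewrite -!catA => -[] /IHl [-> /IHr [-> ->]].
Qed.

Lemma computable_eq_data_pair :
  computable (fun y : data * data => y.1 == y.2).
Proof.
apply: (computable_ext (g := fun y => serialize y.1 == serialize y.2)).
  move=> y; apply/eqP/eqP => [-> //|E].
  by have [] : y.1 = y.2 /\ [::] = [::] :> seq bool
    by apply: serialize_cat_inj; rewrite !cats0.
by apply: (computable_eq_seq computable_eqb_pair); rewrite /serialize; computability.
Qed.

Definition dargs : data -> seq data :=
  fix loop t := if t is DCons l r then l :: loop r else [::].

Definition dtagof (t : data) : nat := size (dargs (dhd t)).

Section DataCombinators.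
Context {X : Type} {x0 : code X}.

(** Every tree is the code of the list of left subtrees along its right spine, so on codes this
    function is the identity. *)
Lemma computable_dargs (t : X -> data) :
  computable t -> computable (fun x => dargs (t x)).
Proof.
move=> [g rg H]; exists g => // x; rewrite H.
elim: (t x) => // l _ r IH.
change (DCons l (enc r) = DCons l (enc (dargs r))).
by rewrite IH.
Qed.

Lemma computable_dtagof (t : X -> data) :
  computable t -> computable (fun x => dtagof (t x)).
Proof.
move=> ct; rewrite /dtagof; computability; apply: computable_dargs.
by computability.
Qed.
End DataCombinators.

Ltac computable_data :=
  first [ simple apply computable_dargs
        | simple apply computable_dtagof
        | simple apply (computable_eq_seq computable_eqn_pair)
        | simple apply (computable_eq_seq computable_eqb_pair)
        | simple apply (computable_eqop computable_eq_data_pair)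
        | simple apply (computable_mem computable_eq_data_pair)
        | simple apply (computable_mem computable_eqseqn_pair)
        | simple apply (computable_index computable_eqseqn_pair)
        | simple apply (computable_undup computable_eq_data_pair) ].
Ltac computable_user ::= first [ computable_arith | computable_seq2 | computable_data ].

Lemma dargs_dlist s : dargs (dlist s) = s.
Proof. by elim: s => //= x s ->. Qed.

Lemma dtagof_dtag k s : dtagof (dtag k s) = k.
Proof. by rewrite /dtagof /=; elim: k => //= k ->. Qed.

(** Recursion on trees with arbitrary branching, inside a fold on binary trees. A cell can be a
    tagged node or a cell of an argument list, and a fold cannot tell which. Both readings are
    computed: the first component is the result for a node, the second the list of results for a
    list of arguments. *)
Definition trec (T : Type) (F : data -> seq T -> T) (t : data) : T :=
  (dfold (F DNil [::], [::]) (fun t yl yr => (F t yr.2, yl.1 :: yr.2)) t).1.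

Lemma trec_dtag T (F : data -> seq T -> T) k s :
  trec F (dtag k s) = F (dtag k s) (map (trec F) s).
Proof.
by rewrite /trec /=; congr (F _ _); elim: s => //= x s ->.
Qed.

Lemma computable_trec {X T : Type} {x0 : code X} {t0 : code T}
    (F : X -> data -> seq T -> T) (t : X -> data) :
  computable (fun y : X * (data * seq T) => F y.1 y.2.1 y.2.2) ->
  computable t -> computable (fun x => trec (F x) (t x)).
Proof.
move=> cF ct; rewrite /trec; computability.
  apply: (computable_comp (f := fun y => (y.1, (y.2.1, y.2.2.2.2))) cF).
  by computability.
by apply: (computable_comp (f := fun y => (y, (DNil, [::]))) cF); computability.
Qed.

(** * The transition relation of the Büchi automaton on codes *)

Definition darg (i : nat) (t : data) : data := nth DNil (dargs (dtl t)) i.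

Definition dnat (t : data) : nat := size (dargs t).

(* The components are the codes of the subformulas of a coded formula and of
   those in the tests of a coded regular expression; which of them is
   meaningful depends on what [t] is the code of. *)
Definition code_subs : data -> seq data * seq data :=
  trec (fun t v =>
    let: k := dtagof t in
    (t :: (if k <= 1 then [::] else
           if k <= 3 then (nth ([::], [::]) v 0).1 ++ (nth ([::], [::]) v 1).1
           else (nth ([::], [::]) v 0).2 ++
                (nth ([::], [::]) v (if (k == 6) || (k == 7) then 2 else 1)).1),
     if k == 0 then [::] else
     if k == 1 then (nth ([::], [::]) v 0).1 else
     (nth ([::], [::]) v 0).2 ++
     (if k <= 3 then (nth ([::], [::]) v 1).2 else [::]))).

Definition code_psat (a : seq bool) : data -> bool :=
  trec (fun t v =>
    let: k := dtagof t in
    if k == 0 then nth false a (dnat (darg 0 t)) else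
    if k == 1 then ~~ nth false v 0 else
    if k == 2 then nth false v 0 && nth false v 1
    else nth false v 0 || nth false v 1).

(* The Glushkov automaton of a regular expression, as seen when a letter is
   read under a given truth assignment to the tests: nullability, the positions
   that can read the letter first and, for each position [q], whether the
   expression may end after [q] and which positions can read the letter
   after [q]. *)
Notation glushkov := (bool * (seq bool * seq (bool * seq bool)))%type.

Definition gl_null : glushkov -> bool := fst.
Definition gl_first (g : glushkov) : seq bool := g.2.1.
Definition gl_follow (g : glushkov) : seq (bool * seq bool) := g.2.2.

Definition gl_prop (b : bool) : glushkov :=
  (false, ([:: b], [:: (true, [:: false])])).

Definition gl_test (b : bool) : glushkov := (b, ([::], [::])).

Definition gl_off (g : glushkov) : seq bool := nseq (size (gl_first g)) false.

Definition gl_plus (g h : glushkov) : glushkov :=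
  (gl_null g || gl_null h, (gl_first g ++ gl_first h,
    [seq (p.1, p.2 ++ gl_off h) | p <- gl_follow g] ++
    [seq (p.1, gl_off g ++ p.2) | p <- gl_follow h])).

Definition gl_seq (g h : glushkov) : glushkov :=
  (gl_null g && gl_null h,
   (gl_first g ++ (if gl_null g then gl_first h else gl_off h),
    [seq (p.1 && gl_null h, p.2 ++ (if p.1 then gl_first h else gl_off h))
       | p <- gl_follow g] ++
    [seq (p.1, gl_off g ++ p.2) | p <- gl_follow h])).

Definition gl_star (g : glushkov) : glushkov :=
  (true, (gl_first g,
    [seq (p.1, [seq nth false p.2 i || (p.1 && nth false (gl_first g) i)
                  | i <- iota 0 (size (gl_first g))])
       | p <- gl_follow g])).

Definition code_glushkov (a : seq bool) (s : seq data) : data -> glushkov :=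
  trec (fun t v =>
    let: k := dtagof t in
    if k == 0 then gl_prop (code_psat a (darg 0 t)) else
    if k == 1 then gl_test (darg 0 t \in s) else
    if k == 2 then gl_plus (nth (gl_test false) v 0) (nth (gl_test false) v 1)
    else if k == 3 then
      gl_seq (nth (gl_test false) v 0) (nth (gl_test false) v 1)
    else gl_star (nth (gl_test false) v 0)).

(** A row of a matrix times a vector in the (min, +) semiring, truncated at [cap]: the cheapest way
    to read the current letter and to continue. *)
Definition best (cap c : nat) (bits : seq bool) (d : seq nat) : nat :=
  foldr (fun i r => if nth false bits i then minn (c + nth 0 d i) r else r)
    cap (iota 0 (size bits)).

(** Here [x] is the price of ending the match at the current position. *)
Definition gl_value cap c (g : glushkov) (x : nat) (d : seq nat) : nat :=
  minn (best cap c (gl_first g) d) (if gl_null g then x else cap).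

Definition gl_back cap c (g : glushkov) (x : nat) (d : seq nat) : seq nat :=
  [seq minn (best cap c p.2 d) (if p.1 then x else cap) | p <- gl_follow g].

Definition modal_cost (cp : bool) (t : data) : nat :=
  let: k := dtagof t in if k <= 5 then 0 else if k <= 7 then 1 else cp.

Definition modal_budget (n : nat) (t : data) : nat :=
  let: k := dtagof t in if k <= 5 then 0 else if k <= 7 then n else 1.

Definition is_box (t : data) : bool :=
  let: k := dtagof t in (k == 5) || ((k == 7) || (k == 9)).

Definition modal_body (t : data) : data :=
  let: k := dtagof t in darg (if (k == 6) || (k == 7) then 2 else 1) t.

(** This is the value infinity. Anything above both 1 and [n], the possible budgets, would separate
    success from failure; this choice gives exactly [3 * (n + 1)] possible entries, the base of the
    bound, and leaves room for the mark 2 of the initial word. *)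
Definition cap (n : nat) : nat := 3 * n + 2.

(** For a box the matches searched for are the violating ones: ending is free where the body fails,
    and [node] negates the verdict. *)
Definition modal_end n (s : seq data) (t : data) : nat :=
  if (modal_body t \in s) (+) is_box t then 0 else cap n.

Definition node a (cp : bool) n (s : seq data) (o : nat) (d e : seq nat)
    (t : data) : bool * (seq nat * seq nat) :=
  let: k := dtagof t in
  if k <= 3 then
    ((if k == 0 then nth false a (dnat (darg 0 t)) else
      if k == 1 then ~~ nth false a (dnat (darg 0 t)) else
      if k == 2 then (darg 0 t \in s) && (darg 1 t \in s)
      else (darg 0 t \in s) || (darg 1 t \in s)), ([::], [::]))
  else
    let: f := fun g =>
      ((gl_value (cap n) (modal_cost cp t) g (modal_end n s t) (drop o d)
          <= modal_budget n t) (+) is_box t,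
       (gl_back (cap n) (modal_cost cp t) g (modal_end n s t) (drop o d),
        gl_back (cap n) (modal_cost cp t) g (modal_end n s t) (drop o e))) in
    f (code_glushkov a s (darg 0 t)).

(* An accumulator [(s, (d, e))] holds the codes of the true subformulas treated
   so far and the values of their positions. *)
Definition add_node a (cp : bool) n (d e : seq nat) (t : data)
    (r : seq data * (seq nat * seq nat)) : seq data * (seq nat * seq nat) :=
  let: f := fun v : bool * (seq nat * seq nat) =>
    (if v.1 then t :: r.1 else r.1, (r.2.1 ++ v.2.1, r.2.2 ++ v.2.2)) in
  f (node a cp n r.1 (size r.2.1) d e t).

Definition backstep a (cp : bool) n (d e : seq nat) (s : seq data) :
    seq data * (seq nat * seq nat) :=
  foldr (add_node a cp n d e) ([::], ([::], [::])) s.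

(** The number of entries does not depend on letters or values, so a run on empty arguments measures
    it. *)
Definition width (s : seq data) : nat :=
  size (backstep [::] false 0 [::] [::] s).2.1.

Definition dtable (l : nat) (x : seq nat) : seq nat := take l (behead x).
Definition etable (l : nat) (x : seq nat) : seq nat := drop l (behead x).

Definition etable_reset n (l : nat) (x : seq nat) : seq nat :=
  if dtable l x == etable l x then nseq l (cap n) else etable l x.

(* A state is the word [h :: d ++ e], where [h] is 2 initially and afterwards
   tells whether p was true in the previous letter; [u] is the rank of p. *)
Definition cp_flag (u : nat) (a : seq bool) (x : seq nat) : bool :=
  (head 0 x == 2) || (head 0 x != nth false a u).

Definition nba_step (u n : nat) (t : data) (s : seq data) (l : nat)
    (a : seq bool) (x y : seq nat) : bool :=
  (head 0 y == nth false a u) &&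
  let: f := fun r : seq data * (seq nat * seq nat) =>
    (* The initial word carries no values to be compared; its step checks instead that the whole
       formula holds at position 0. *)
    if head 0 x == 2 then t \in r.1
    else (dtable l x == r.2.1) && (etable l x == r.2.2) in
  f (backstep a (cp_flag u a x) n (dtable l y) (etable_reset n l y) s).

Definition nba_fin (l : nat) (x : seq nat) : bool :=
  (head 0 x != 2) && (dtable l x == etable l x).

Fixpoint words (b l : nat) : seq (seq nat) :=
  if l is l'.+1 then
    flatten [seq [seq c :: w | w <- words b l'] | c <- iota 0 b]
  else [:: [::]].

(** * Computability of the transition relation *)

Section Computability.
Context {X : Type} {x0 : code X}.
Implicit Types (t : X -> data) (a : X -> seq bool) (s : X -> seq data).
Implicit Types (n c l : X -> nat) (d e : X -> seq nat) (b : X -> bool).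
Implicit Types (g h : X -> glushkov).

Lemma computable_dnat t : computable t -> computable (fun x => dnat (t x)).
Proof. by move=> ct; rewrite /dnat; computability. Qed.

Lemma computable_darg n t :
  computable n -> computable t -> computable (fun x => darg (n x) (t x)).
Proof. by move=> cn ct; rewrite /darg; computability. Qed.

Lemma computable_code_subs t :
  computable t -> computable (fun x => code_subs (t x)).
Proof.
move=> ct; rewrite /code_subs.
simple apply computable_trec; last by [].
by computability.
Qed.
End Computability.

Ltac computable_local :=
  first [ simple apply computable_dnat | simple apply computable_darg
        | simple apply computable_code_subs ].
Ltac computable_base :=
  first [ computable_arith | computable_seq2 | computable_data ].
Ltac computable_user ::= first [ computable_base | computable_local ].

Section ComputabilityGlushkov.
Context {X : Type} {x0 : code X}.
Implicit Types (t : X -> data) (a : X -> seq bool) (s : X -> seq data).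
Implicit Types (n c l : X -> nat) (d e : X -> seq nat) (b : X -> bool).
Implicit Types (g h : X -> glushkov).

Lemma computable_code_psat a t :
  computable a -> computable t -> computable (fun x => code_psat (a x) (t x)).
Proof.
move=> ca ct; rewrite /code_psat.
simple apply computable_trec; last by [].
by computability.
Qed.

Lemma computable_gl_null g :
  computable g -> computable (fun x => gl_null (g x)).
Proof. exact: computable_fst. Qed.

Lemma computable_gl_first g :
  computable g -> computable (fun x => gl_first (g x)).
Proof. by move=> cg; rewrite /gl_first; computability. Qed.

Lemma computable_gl_follow g :
  computable g -> computable (fun x => gl_follow (g x)).
Proof. by move=> cg; rewrite /gl_follow; computability. Qed.

Lemma computable_gl_prop b :
  computable b -> computable (fun x => gl_prop (b x)).
Proof. by move=> cb; rewrite /gl_prop; computability. Qed.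

Lemma computable_gl_test b :
  computable b -> computable (fun x => gl_test (b x)).
Proof. by move=> cb; rewrite /gl_test; computability. Qed.

Lemma computable_gl_off g :
  computable g -> computable (fun x => gl_off (g x)).
Proof. by move=> cg; rewrite /gl_off /gl_first; computability. Qed.
End ComputabilityGlushkov.

Ltac computable_gl0 :=
  first [ simple apply computable_code_psat | simple apply computable_gl_null
        | simple apply computable_gl_first | simple apply computable_gl_follow
        | simple apply computable_gl_prop | simple apply computable_gl_test
        | simple apply computable_gl_off ].
Ltac computable_user ::=
  first [ computable_base | computable_local | computable_gl0 ].

Section ComputabilityGlushkovOperations.
Context {X : Type} {x0 : code X}.
Implicit Types (g h : X -> glushkov).

Lemma computable_gl_plus g h :
  computable g -> computable h -> computable (fun x => gl_plus (g x) (h x)).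
Proof. by move=> cg ch; rewrite /gl_plus; computability. Qed.

Lemma computable_gl_seq g h :
  computable g -> computable h -> computable (fun x => gl_seq (g x) (h x)).
Proof. by move=> cg ch; rewrite /gl_seq; computability. Qed.

Lemma computable_gl_star g :
  computable g -> computable (fun x => gl_star (g x)).
Proof. by move=> cg; rewrite /gl_star; computability. Qed.
End ComputabilityGlushkovOperations.

Ltac computable_gl1 :=
  first [ simple apply computable_gl_plus | simple apply computable_gl_seq
        | simple apply computable_gl_star ].
Ltac computable_user ::=
  first [ computable_base | computable_local | computable_gl0 | computable_gl1 ].

Section ComputabilityNode.
Context {X : Type} {x0 : code X}.
Implicit Types (t : X -> data) (a : X -> seq bool) (s : X -> seq data).
Implicit Types (n c l : X -> nat) (d e : X -> seq nat) (b : X -> bool).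
Implicit Types (g h : X -> glushkov).

Lemma computable_code_glushkov a s t :
  computable a -> computable s -> computable t ->
  computable (fun x => code_glushkov (a x) (s x) (t x)).
Proof.
move=> ca cs ct; rewrite /code_glushkov.
simple apply computable_trec; last by [].
by computability.
Qed.

Lemma computable_best n c (u : X -> seq bool) d :
  computable n -> computable c -> computable u -> computable d ->
  computable (fun x => best (n x) (c x) (u x) (d x)).
Proof. by move=> *; rewrite /best; computability. Qed.

Lemma computable_modal_cost b t : computable b -> computable t ->
  computable (fun x => modal_cost (b x) (t x)).
Proof. by move=> *; rewrite /modal_cost; computability. Qed.

Lemma computable_modal_budget n t : computable n -> computable t ->
  computable (fun x => modal_budget (n x) (t x)).
Proof. by move=> *; rewrite /modal_budget; computability. Qed.

Lemma computable_is_box t : computable t -> computable (fun x => is_box (t x)).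
Proof. by move=> *; rewrite /is_box; computability. Qed.

Lemma computable_modal_body t :
  computable t -> computable (fun x => modal_body (t x)).
Proof. by move=> *; rewrite /modal_body; computability. Qed.

Lemma computable_cap n : computable n -> computable (fun x => cap (n x)).
Proof. by move=> *; rewrite /cap; computability. Qed.
End ComputabilityNode.

Ltac computable_node0 :=
  first [ simple apply computable_code_glushkov | simple apply computable_best
        | simple apply computable_modal_cost
        | simple apply computable_modal_budget | simple apply computable_is_box
        | simple apply computable_modal_body | simple apply computable_cap ].
Ltac computable_user ::= first [ computable_base | computable_local
  | computable_gl0 | computable_gl1 | computable_node0 ].

Section ComputabilityStep.
Context {X : Type} {x0 : code X}.
Implicit Types (t : X -> data) (a : X -> seq bool) (s : X -> seq data).
Implicit Types (n c l : X -> nat) (d e : X -> seq nat) (b : X -> bool).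
Implicit Types (g h : X -> glushkov).

Lemma computable_modal_end n s t :
  computable n -> computable s -> computable t ->
  computable (fun x => modal_end (n x) (s x) (t x)).
Proof. by move=> *; rewrite /modal_end; computability. Qed.

Lemma computable_gl_value n c g l d :
  computable n -> computable c -> computable g -> computable l ->
  computable d -> computable (fun x => gl_value (n x) (c x) (g x) (l x) (d x)).
Proof. by move=> *; rewrite /gl_value; computability. Qed.

Lemma computable_gl_back n c g l d :
  computable n -> computable c -> computable g -> computable l ->
  computable d -> computable (fun x => gl_back (n x) (c x) (g x) (l x) (d x)).
Proof. by move=> *; rewrite /gl_back; computability. Qed.
End ComputabilityStep.

Ltac computable_node1 :=
  first [ simple apply computable_modal_end | simple apply computable_gl_value
        | simple apply computable_gl_back ].
Ltac computable_user ::= first [ computable_base | computable_local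
  | computable_gl0 | computable_gl1 | computable_node0 | computable_node1 ].

Lemma computable_node {X : Type} {x0 : code X} (a : X -> seq bool)
    (b : X -> bool) (n : X -> nat) (s : X -> seq data) (o : X -> nat)
    (d e : X -> seq nat) (t : X -> data) :
  computable a -> computable b -> computable n -> computable s ->
  computable o -> computable d -> computable e -> computable t ->
  computable (fun x => node (a x) (b x) (n x) (s x) (o x) (d x) (e x) (t x)).
Proof. by move=> *; rewrite /node; computability. Qed.

Lemma computable_add_node {X : Type} {x0 : code X} (a : X -> seq bool)
    (b : X -> bool) (n : X -> nat) (d e : X -> seq nat) (t : X -> data)
    (r : X -> seq data * (seq nat * seq nat)) :
  computable a -> computable b -> computable n ->
  computable d -> computable e -> computable t -> computable r ->
  computable (fun x => add_node (a x) (b x) (n x) (d x) (e x) (t x) (r x)).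
Proof.
move=> *; rewrite /add_node; computability;
  by simple apply computable_node; computability.
Qed.

Lemma computable_backstep {X : Type} {x0 : code X} (a : X -> seq bool)
    (b : X -> bool) (n : X -> nat) (d e : X -> seq nat) (s : X -> seq data) :
  computable a -> computable b -> computable n ->
  computable d -> computable e -> computable s ->
  computable (fun x => backstep (a x) (b x) (n x) (d x) (e x) (s x)).
Proof.
move=> *; rewrite /backstep; computability.
by simple apply computable_add_node; computability.
Qed.

Ltac computable_node2 := simple apply computable_backstep.
Ltac computable_user ::= first [ computable_base | computable_local
  | computable_gl0 | computable_gl1 | computable_node0 | computable_node1
  | computable_node2 ].

Section ComputabilityTables.
Context {X : Type} {x0 : code X}.
Implicit Types (n l u : X -> nat) (w y : X -> seq nat).

Lemma computable_width (s : X -> seq data) :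
  computable s -> computable (fun x => width (s x)).
Proof. by move=> *; rewrite /width; computability. Qed.

Lemma computable_dtable l w :
  computable l -> computable w -> computable (fun x => dtable (l x) (w x)).
Proof. by move=> *; rewrite /dtable; computability. Qed.

Lemma computable_etable l w :
  computable l -> computable w -> computable (fun x => etable (l x) (w x)).
Proof. by move=> *; rewrite /etable; computability. Qed.

Lemma computable_etable_reset n l w :
  computable n -> computable l -> computable w ->
  computable (fun x => etable_reset (n x) (l x) (w x)).
Proof. by move=> *; rewrite /etable_reset /dtable /etable; computability. Qed.

Lemma computable_cp_flag u (a : X -> seq bool) w :
  computable u -> computable a -> computable w ->
  computable (fun x => cp_flag (u x) (a x) (w x)).
Proof. by move=> *; rewrite /cp_flag; computability. Qed.

Lemma computable_nba_fin l w :
  computable l -> computable w -> computable (fun x => nba_fin (l x) (w x)).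
Proof. by move=> *; rewrite /nba_fin /dtable /etable; computability. Qed.

Lemma computable_words n l :
  computable n -> computable l -> computable (fun x => words (n x) (l x)).
Proof.
move=> cn cl; apply: (computable_ext (g := fun x => iter (l x)
  (fun s : seq (seq nat) => flatten [seq [seq i :: v | v <- s]
     | i <- iota 0 (n x)]) [:: [::]])).
  by move=> x; elim: (l x) => //= k ->.
by computability.
Qed.
End ComputabilityTables.

Ltac computable_node3 :=
  first [ simple apply computable_width | simple apply computable_dtable
        | simple apply computable_etable | simple apply computable_etable_reset
        | simple apply computable_cp_flag | simple apply computable_nba_fin
        | simple apply computable_words ].
Ltac computable_user ::= first [ computable_base | computable_local
  | computable_gl0 | computable_gl1 | computable_node0 | computable_node1
  | computable_node2 | computable_node3 ].

Lemma computable_nba_step {X : Type} {x0 : code X} (u n : X -> nat)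
    (t : X -> data) (s : X -> seq data) (l : X -> nat) (a : X -> seq bool)
    (w y : X -> seq nat) :
  computable u -> computable n -> computable t -> computable s ->
  computable l -> computable a -> computable w -> computable y ->
  computable (fun x =>
    nba_step (u x) (n x) (t x) (s x) (l x) (a x) (w x) (y x)).
Proof. by move=> *; rewrite /nba_step; computability. Qed.

(** * Values of the positions of a regular expression *)

Section Best.
Variables (M c : nat).

Lemma best_nil d : best M c [::] d = M. Proof. by []. Qed.

Lemma best_cons b bs d :
  best M c (b :: bs) d =
  if b then minn (c + head 0 d) (best M c bs (behead d))
  else best M c bs (behead d).
Proof.
rewrite /best /= -[1]addn0 iotaDl foldr_map nth0.
suff -> : foldr (fun x r => if nth false bs x then minn (c + nth 0 d (1 + x)) r
    else r) M (iota 0 (size bs)) = foldr (fun i r => if nth false bs i then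
    minn (c + nth 0 (behead d) i) r else r) M (iota 0 (size bs)) by [].
by elim: (iota _ _) => //= i r ->; rewrite nth_behead.
Qed.

Lemma best_le bs d : best M c bs d <= M.
Proof.
by elim: bs d => [|b bs IH] d //; rewrite best_cons; case: b; rewrite ?geq_min IH ?orbT.
Qed.

Lemma best_cat b1 b2 d1 d2 : size b1 = size d1 ->
  best M c (b1 ++ b2) (d1 ++ d2) = minn (best M c b1 d1) (best M c b2 d2).
Proof.
elim: b1 d1 => [|b b1 IH] [|x d1] //= => [_|[E]].
  by apply/esym/minn_idPr/best_le.
by rewrite !best_cons /= IH //; case: b; rewrite ?minnA.
Qed.

Lemma best_off n d : best M c (nseq n false) d = M.
Proof. by elim: n d => //= n IH d; rewrite best_cons. Qed.

Lemma best_or b1 b2 d : size b1 = size b2 ->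
  best M c [seq nth false b1 i || nth false b2 i | i <- iota 0 (size b2)] d =
  minn (best M c b1 d) (best M c b2 d).
Proof.
elim: b1 b2 d => [|b b1 IH] [|b' b2] d //= => [_|[E]]; first by rewrite minnn.
rewrite !best_cons -[1]addn0 iotaDl -map_comp.
have -> : best M c [seq ((fun i => nth false (b :: b1) i || nth false (b' :: b2) i)
    \o addn 1) i | i <- iota 0 (size b2)] (behead d) =
    minn (best M c b1 (behead d)) (best M c b2 (behead d)) by rewrite -IH.
by case: b; case: b' => //=; lia.
Qed.

Lemma best_leq bs d d' : size d = size d' ->
  (forall i, nth 0 d i <= nth 0 d' i) -> best M c bs d <= best M c bs d'.
Proof.
elim: bs d d' => [|b bs IH] d d' // E H; rewrite !best_cons.
have Hb : best M c bs (behead d) <= best M c bs (behead d').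
  by apply: IH => [|i]; rewrite ?size_behead ?E // !nth_behead.
by have := H 0; rewrite !nth0; case: b => //; lia.
Qed.
End Best.

Definition gl_wf (n : nat) (g : glushkov) : Prop :=
  [/\ size (gl_first g) = n, size (gl_follow g) = n
    & forall p, p \in gl_follow g -> size p.2 = n].

Section Composition.
Variables (M c n1 n2 : nat) (g1 g2 : glushkov).
Hypotheses (w1 : gl_wf n1 g1) (w2 : gl_wf n2 g2).

Lemma gl_plus_wf : gl_wf (n1 + n2) (gl_plus g1 g2).
Proof.
case: w1 w2 => a1 b1 d1 [a2 b2 d2]; split; rewrite /gl_first /gl_follow /=.
- by rewrite size_cat a1 a2.
- by rewrite size_cat !size_map b1 b2.
- move=> p; rewrite mem_cat => /orP[] /mapP [q Hq ->] /=;
    rewrite size_cat size_nseq; first by rewrite d1 // a2.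
  by rewrite d2 // a1.
Qed.

Lemma gl_seq_wf : gl_wf (n1 + n2) (gl_seq g1 g2).
Proof.
case: w1 w2 => a1 b1 d1 [a2 b2 d2]; split; rewrite /gl_first /gl_follow /=.
- by rewrite size_cat a1; case: ifP; rewrite ?size_nseq a2.
- by rewrite size_cat !size_map b1 b2.
- move=> p; rewrite mem_cat => /orP[] /mapP [q Hq ->] /=; rewrite size_cat.
    by rewrite d1 //; case: ifP; rewrite ?size_nseq a2.
  by rewrite size_nseq d2 // a1.
Qed.

Lemma gl_star_wf : gl_wf n1 (gl_star g1).
Proof.
case: w1 => a1 b1 d1; split; rewrite /gl_first /gl_follow //= ?size_map //.
by move=> p /mapP [q Hq ->] /=; rewrite size_map size_iota.
Qed.

Section Plus.
Variables (x : nat) (d1 d2 : seq nat).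
Hypotheses (s1 : size d1 = n1) (s2 : size d2 = n2).

Lemma gl_value_plus : gl_value M c (gl_plus g1 g2) x (d1 ++ d2) =
  minn (gl_value M c g1 x d1) (gl_value M c g2 x d2).
Proof.
case: w1 w2 => a1 _ _ [a2 _ _].
rewrite /gl_value {1}/gl_first /= best_cat ?a1 //.
have := @best_le M c (gl_first g1) d1; have := @best_le M c (gl_first g2) d2.
rewrite /gl_null /=; case: g1.1; case: g2.1 => /=; lia.
Qed.

Lemma gl_back_plus : gl_back M c (gl_plus g1 g2) x (d1 ++ d2) =
  gl_back M c g1 x d1 ++ gl_back M c g2 x d2.
Proof.
case: w1 w2 => a1 b1 e1 [a2 b2 e2].
rewrite /gl_back map_cat -!map_comp; congr (_ ++ _); apply/eq_in_map => p Hp /=.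
  rewrite best_cat ?e1 // best_off; congr minn; apply/minn_idPl; exact: best_le.
rewrite best_cat ?size_nseq ?a1 // best_off; congr minn; apply/minn_idPr.
exact: best_le.
Qed.

(** Ending the first factor at a position costs what the second factor costs from there, so the
    value of the second is the end value of the first. *)
Lemma gl_value_seq : gl_value M c (gl_seq g1 g2) x (d1 ++ d2) =
  gl_value M c g1 (gl_value M c g2 x d2) d1.
Proof.
case: w1 w2 => a1 _ _ [a2 _ _].
rewrite /gl_value {1}/gl_first /= best_cat ?a1 //.
have := @best_le M c (gl_first g1) d1; have := @best_le M c (gl_first g2) d2.
by rewrite /gl_null /=; case: g1.1; case: g2.1; rewrite /= ?best_off; lia.
Qed.

Lemma best_first_seq : best M c (gl_first (gl_seq g1 g2)) (d1 ++ d2) =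
  minn (best M c (gl_first g1) d1)
       (if gl_null g1 then best M c (gl_first g2) d2 else M).
Proof.
case: w1 => a1 _ _; rewrite {1}/gl_first /= best_cat ?a1 //.
by case: ifP; rewrite // best_off.
Qed.

Lemma gl_back_seq : gl_back M c (gl_seq g1 g2) x (d1 ++ d2) =
  gl_back M c g1 (gl_value M c g2 x d2) d1 ++ gl_back M c g2 x d2.
Proof.
case: w1 w2 => a1 b1 e1 [a2 b2 e2].
rewrite /gl_back map_cat -!map_comp; congr (_ ++ _); apply/eq_in_map => p Hp /=.
  rewrite best_cat ?e1 // /gl_value.
  have := @best_le M c p.2 d1; have := @best_le M c (gl_first g2) d2.
  by rewrite /gl_null; case: p.1; case: g2.1; rewrite /= ?best_off; lia.
rewrite best_cat ?size_nseq ?a1 // best_off; congr minn; apply/minn_idPr.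
exact: best_le.
Qed.

Lemma gl_value_star : gl_value M c (gl_star g1) x d1 =
  minn (best M c (gl_first g1) d1) x.
Proof. by []. Qed.

(* A loop that reads no letter never improves the value, so the start of the
   next iteration only contributes its first positions. *)
Lemma gl_back_star : gl_back M c (gl_star g1) x d1 =
  gl_back M c g1 (gl_value M c (gl_star g1) x d1) d1.
Proof.
case: w1 => a1 b1 e1; rewrite /gl_back -map_comp; apply/eq_in_map => p Hp /=.
rewrite gl_value_star; case: p.1 (e1 p Hp) => /= Es.
  by rewrite best_or ?a1 ?Es // minnA.
congr minn; congr best; apply: (@eq_from_nth _ false); rewrite size_map size_iota.
  by rewrite a1 Es.
by move=> i Hi; rewrite (nth_map 0) ?size_iota // nth_iota // add0n orbF.
Qed.
End Plus.
End Composition.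

Section Regex.
Variables (P : finType) (V : eqType) (vs : seq V).

Definition letter (A : {set option P}) : seq bool :=
  [seq x \in A | x <- enum [the finType of option P]].

Lemma dnat_dnum n : dnat (dnum n) = n.
Proof. by rewrite /dnat; elim: n => //= n ->. Qed.

Lemma nth_letter A (x : option P) :
  nth false (letter A) (dnat (dord x)) = (x \in A).
Proof.
rewrite dnat_dnum (nth_map x); first by rewrite nth_enum_rank.
by rewrite -cardE.
Qed.

Lemma darg_dtag k s i : darg i (dtag k s) = nth DNil s i.
Proof. by rewrite /darg /= dargs_dlist. Qed.

Lemma code_psatE A (f : pform P) : code_psat (letter A) (dpform f) = psat A f.
Proof.
elim: f => [x|f IH|f IHf g IHg|f IHf g IHg];
  rewrite /code_psat /= trec_dtag dtagof_dtag /= -/(code_psat _).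
- by rewrite darg_dtag nth_letter.
- by rewrite -IH.
- by rewrite -IHf -IHg.
- by rewrite -IHf -IHg.
Qed.

Fixpoint positions (r : regex P V) : nat :=
  match r with
  | RProp _ => 1
  | RTest _ => 0
  | RPlus r1 r2 | RSeq r1 r2 => positions r1 + positions r2
  | RStar r1 => positions r1
  end.

Lemma positions_length r : positions r <= regex_length r.
Proof.
by elim: r => //= [f|r1 H1 r2 H2|r1 H1 r2 H2|r H]; [case: f | lia | lia | lia].
Qed.

Section Local.
Variables (a : seq bool) (s : seq data).
Local Notation gl r := (code_glushkov a s (dregex vs r)).

Lemma gl_propE (f : pform P) : gl (RProp V f) = gl_prop (code_psat a (dpform f)).
Proof. by rewrite /code_glushkov /= trec_dtag dtagof_dtag darg_dtag. Qed.

Lemma gl_testE (f : form P V) : gl (RTest f) = gl_test (dform vs f \in s).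
Proof. by rewrite /code_glushkov /= trec_dtag dtagof_dtag darg_dtag. Qed.

Lemma gl_plusE (r1 r2 : regex P V) : gl (RPlus r1 r2) = gl_plus (gl r1) (gl r2).
Proof. by rewrite {1}/code_glushkov /= trec_dtag dtagof_dtag. Qed.

Lemma gl_seqE (r1 r2 : regex P V) : gl (RSeq r1 r2) = gl_seq (gl r1) (gl r2).
Proof. by rewrite {1}/code_glushkov /= trec_dtag dtagof_dtag. Qed.

Lemma gl_starE (r : regex P V) : gl (RStar r) = gl_star (gl r).
Proof. by rewrite {1}/code_glushkov /= trec_dtag dtagof_dtag. Qed.

Lemma gl_wf_positions (r : regex P V) : gl_wf (positions r) (gl r).
Proof.
elim: r => [f|f|r1 IH1 r2 IH2|r1 IH1 r2 IH2|r IH].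
- by rewrite gl_propE; split=> // p; rewrite inE => /eqP ->.
- by rewrite gl_testE.
- by rewrite gl_plusE; apply: gl_plus_wf.
- by rewrite gl_seqE; apply: gl_seq_wf.
- by rewrite gl_starE; apply: gl_star_wf.
Qed.
End Local.

Section Paths.
Variables (w : nat -> {set option P}) (alpha : V -> nat).
Variables (s : nat -> seq data) (M : nat) (cost : nat -> nat).
Local Notation gl r i := (code_glushkov (letter (w i)) (s i) (dregex vs r)).

Definition path_cost m n := \sum_(m <= i < n) cost i.

Definition tests_ok (r : regex P V) := forall f, f \in test_subforms r ->
  forall i, dform vs f \in s i <-> sat w alpha f i.

(** The Bellman equations of a shortest-path problem, on the positions from [lo] up to but excluding
    [hi]. *)
Definition consistent (r : regex P V) (x : nat -> nat) (D : nat -> seq nat) lo hi :=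
  forall i, lo <= i < hi -> D i = gl_back M (cost i) (gl r i) (x i) (D i.+1).

Lemma path_cost_cat m k n : m <= k <= n ->
  path_cost m n = path_cost m k + path_cost k n.
Proof. by case/andP=> H1 H2; rewrite /path_cost (big_cat_nat H1 H2). Qed.

Lemma path_cost0 m : path_cost m m = 0.
Proof. by rewrite /path_cost big_geq. Qed.

Lemma path_cost1 m : path_cost m m.+1 = cost m.
Proof. by rewrite /path_cost big_nat1. Qed.

Lemma rel_le r m n : Defs.rel w alpha r m n -> m <= n.
Proof.
elim: r m n => [f|f|r1 IH1 r2 IH2|r1 IH1 r2 IH2|r IH] m n /=.
- by case=> ->.
- by case=> ->.
- by case=> [/IH1|/IH2].
- by case=> k [/IH1 H1 /IH2 H2]; exact: leq_trans H1 H2.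
- by elim=> [x y /IH|//|x y z _ H1 _ H2]; last exact: leq_trans H1 H2.
Qed.

Lemma tests_ok_cat (r1 r2 r : regex P V) :
  test_subforms r = test_subforms r1 ++ test_subforms r2 ->
  tests_ok r -> tests_ok r1 /\ tests_ok r2.
Proof. by move=> E T; split=> f Hf; apply: T; rewrite E mem_cat Hf ?orbT. Qed.

Lemma table_split n1 n2 (D : nat -> seq nat) :
  (forall i, size (D i) = n1 + n2) -> exists D1 D2,
  [/\ forall i, D i = D1 i ++ D2 i, forall i, size (D1 i) = n1
    & forall i, size (D2 i) = n2].
Proof.
move=> sD; exists (fun i => take n1 (D i)), (fun i => drop n1 (D i)).
split=> i; [by rewrite cat_take_drop | by rewrite size_takel // sD leq_addr |].
by rewrite size_drop sD addKn.
Qed.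

(** Every step of a match uses one alternative of a minimum, so each solution of the equations,
    spurious or not, is a lower bound for the costs of all matches. *)
Lemma gl_value_rel r x D :
  tests_ok r -> (forall i, size (D i) = positions r) -> (forall i, x i <= M) ->
  (forall hi, consistent r x D 0 hi) -> forall m n, Defs.rel w alpha r m n ->
  gl_value M (cost m) (gl r m) (x m) (D m.+1) <= path_cost m n + x n.
Proof.
elim: r x D => [f|f|r1 IH1 r2 IH2|r1 IH1 r2 IH2|r IH] x D T sD xM C m n /=.
- case=> -> Hf; rewrite gl_propE /gl_value path_cost1 (C m.+2 m.+1 (ltnSn _)).
  rewrite gl_propE code_psatE Hf /gl_back /= /gl_first /= best_cons /=.
  by rewrite geq_min geq_min leq_add2l geq_minr.
- case=> -> Hf; rewrite gl_testE /gl_value path_cost0 /gl_null /=.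
  by rewrite (proj2 (T f _ m)) ?geq_minr //=; case: (f) => *; rewrite inE eqxx.
- case: (@tests_ok_cat r1 r2 (RPlus r1 r2) (erefl _) T) => T1 T2.
  have wf1 i := gl_wf_positions (letter (w i)) (s i) r1.
  have wf2 i := gl_wf_positions (letter (w i)) (s i) r2.
  have [D1 [D2 [E s1 s2]]] := @table_split (positions r1) (positions r2) D sD.
  have CC i : D1 i = gl_back M (cost i) (gl r1 i) (x i) (D1 i.+1) /\
              D2 i = gl_back M (cost i) (gl r2 i) (x i) (D2 i.+1).
    have /eqP := C i.+1 i (ltnSn i).
    rewrite gl_plusE !E (gl_back_plus _ _ (wf1 i) (wf2 i)) // eqseq_cat.
      by case/andP=> /eqP ? /eqP ?.
    by rewrite s1 size_map; case: (wf1 i).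
  rewrite gl_plusE E (gl_value_plus _ _ (wf1 m) (wf2 m)) //.
  case=> H; rewrite geq_min.
    by rewrite (IH1 x D1) // => hi i _; exact: (CC i).1.
  by rewrite orbC (IH2 x D2) // => hi i _; exact: (CC i).2.
- case: (@tests_ok_cat r1 r2 (RSeq r1 r2) (erefl _) T) => T1 T2.
  have wf1 i := gl_wf_positions (letter (w i)) (s i) r1.
  have wf2 i := gl_wf_positions (letter (w i)) (s i) r2.
  have [D1 [D2 [E s1 s2]]] := @table_split (positions r1) (positions r2) D sD.
  pose y i := gl_value M (cost i) (gl r2 i) (x i) (D2 i.+1).
  have yM i : y i <= M by rewrite geq_min best_le.
  have CC i : D1 i = gl_back M (cost i) (gl r1 i) (y i) (D1 i.+1) /\
              D2 i = gl_back M (cost i) (gl r2 i) (x i) (D2 i.+1).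
    have /eqP := C i.+1 i (ltnSn i).
    rewrite gl_seqE !E (gl_back_seq _ _ (wf1 i) (wf2 i)) // eqseq_cat.
      by case/andP=> /eqP ? /eqP ?.
    by rewrite s1 size_map; case: (wf1 i).
  rewrite gl_seqE E (gl_value_seq _ _ (wf1 m) (wf2 m)) //.
  case=> k [H1 H2].
  have L1 : gl_value M (cost m) (gl r1 m) (y m) (D1 m.+1) <= path_cost m k + y k.
    by apply: IH1 => // hi i _; exact: (CC i).1.
  have L2 : y k <= path_cost k n + x n.
    by apply: IH2 => // hi i _; exact: (CC i).2.
  rewrite (@path_cost_cat m k n) ?(rel_le H1) ?(rel_le H2) //.
  by apply: leq_trans L1 _; rewrite -addnA leq_add2l.
- have wf i := gl_wf_positions (letter (w i)) (s i) r.
  (* The star is the end value of its own body: after an iteration one may stop or start another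
     one. By [gl_back_star] the table solves the equations of the body with this end value. *)
  pose y i := gl_value M (cost i) (gl (RStar r) i) (x i) (D i.+1).
  have yM i : y i <= M by rewrite geq_min best_le.
  have CC hi : consistent r y D 0 hi.
    by move=> i Hi; rewrite (C hi i Hi) gl_starE (gl_back_star _ _ (wf i)) // -gl_starE.
  rewrite -[gl_value _ _ _ _ _]/(y m).
  have yx i : y i <= x i by rewrite /y gl_starE /= geq_minr.
  have step k k' : Defs.rel w alpha r k k' -> y k <= path_cost k k' + y k'.
    move=> H; apply: leq_trans (IH y D T sD yM CC k k' H).
    rewrite /y gl_starE gl_value_star /gl_value.
    rewrite leq_min geq_minl /=; case: ifP => _ //.
    by rewrite geq_min best_le.
  suff H k k' : clos_refl_trans nat (Defs.rel w alpha r) k k' ->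
      k <= k' /\ y k <= path_cost k k' + y k'.
    by move=> /H [_ Hk]; apply: leq_trans Hk _; rewrite leq_add2l.
  elim=> [i j H|i|i j l _ [I1 L1] _ [I2 L2]].
  + by split; [exact: rel_le H | exact: step].
  + by rewrite path_cost0.
  + split; first exact: leq_trans I1 I2.
    rewrite (@path_cost_cat i j l) ?I1 //.
    by apply: leq_trans L1 _; rewrite -addnA leq_add2l.
Qed.

Lemma gl_null_rel r : tests_ok r ->
  forall m, gl_null (gl r m) -> Defs.rel w alpha r m m.
Proof.
elim: r => [f|f|r1 IH1 r2 IH2|r1 IH1 r2 IH2|r IH] T m.
- by rewrite gl_propE.
- rewrite gl_testE => H; split=> //; apply/T => //.
  by case: (f) => * /=; rewrite inE eqxx.
- case: (@tests_ok_cat r1 r2 (RPlus r1 r2) (erefl _) T) => T1 T2.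
  by rewrite gl_plusE => /orP[/(IH1 T1)|/(IH2 T2)]; [left|right].
- case: (@tests_ok_cat r1 r2 (RSeq r1 r2) (erefl _) T) => T1 T2.
  by rewrite gl_seqE => /andP[/(IH1 T1) H1 /(IH2 T2) H2]; exists m.
- by move=> _; apply: rt_refl.
Qed.

(** All entries are infinite at [hi], so a smaller value can only have been passed down from a match
    that ends before [hi]. Only matches that read a letter are treated; the empty ones are covered
    by [gl_null_rel]. *)
Lemma best_first_rel lo hi r x D :
  tests_ok r -> (forall i, size (D i) = positions r) -> (forall i, x i <= M) ->
  consistent r x D lo hi -> D hi = nseq (positions r) M ->
  forall m, lo <= m < hi ->
  best M (cost m) (gl_first (gl r m)) (D m.+1) < M ->
  exists n, [/\ m < n < hi, Defs.rel w alpha r m n &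
    path_cost m n + x n <= best M (cost m) (gl_first (gl r m)) (D m.+1)].
Proof.
elim: r x D => [f|f|r1 IH1 r2 IH2|r1 IH1 r2 IH2|r IH] x D T sD xM C DN m Hm /=.
- rewrite gl_propE code_psatE /gl_first /= best_cons.
  case: ifP => Hf; last by rewrite best_nil ltnn.
  rewrite best_nil => H.
  (* If [m] were the last position, reading its letter would lead to an entry of [D hi], which is
     infinite. *)
  have Hm' : m.+1 < hi.
    rewrite ltn_neqAle; case/andP: (Hm) => _ ->; rewrite andbT.
    by apply/eqP => E; move: H; rewrite E DN /=; lia.
  exists m.+1; rewrite path_cost1 ltnSn Hm'; split=> //.
  move: H; rewrite (C m.+1); last by case/andP: Hm => H1 H2; rewrite leqW.
  by rewrite gl_propE /gl_back /= best_cons best_nil; lia.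
- by rewrite gl_testE /= best_nil ltnn.
- case: (@tests_ok_cat r1 r2 (RPlus r1 r2) (erefl _) T) => T1 T2.
  have wf1 i := gl_wf_positions (letter (w i)) (s i) r1.
  have wf2 i := gl_wf_positions (letter (w i)) (s i) r2.
  have [D1 [D2 [E s1 s2]]] := @table_split (positions r1) (positions r2) D sD.
  have [N1 N2] : D1 hi = nseq (positions r1) M /\ D2 hi = nseq (positions r2) M.
    have /eqP := DN; rewrite E /= nseqD eqseq_cat ?s1 ?size_nseq //.
    by case/andP=> /eqP ? /eqP ?.
  have CC i : lo <= i < hi ->
     D1 i = gl_back M (cost i) (gl r1 i) (x i) (D1 i.+1) /\
     D2 i = gl_back M (cost i) (gl r2 i) (x i) (D2 i.+1).
    move=> Hi; have /eqP := C i Hi.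
    rewrite gl_plusE !E (gl_back_plus _ _ (wf1 i) (wf2 i)) // eqseq_cat.
      by case/andP=> /eqP ? /eqP ?.
    by rewrite s1 size_map; case: (wf1 i).
  rewrite gl_plusE E {1 2}/gl_first /= best_cat ?s1; last by case: (wf1 m).
  rewrite -/(gl_first _) -/(gl_first _) gtn_min => /orP[] H.
    have [|n [H1 H2 H3]] := IH1 x D1 T1 s1 xM _ N1 m Hm H.
      by move=> i Hi; exact: (CC i Hi).1.
    have [L|L] := leqP (best M (cost m) (gl_first (gl r1 m)) (D1 m.+1))
                       (best M (cost m) (gl_first (gl r2 m)) (D2 m.+1)).
      by exists n; split=> //; left.
    have [|n' [H1' H2' H3']] := IH2 x D2 T2 s2 xM _ N2 m Hm (ltn_trans L H).
      by move=> i Hi; exact: (CC i Hi).2.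
    by exists n'; split=> //; right.
  have [|n [H1 H2 H3]] := IH2 x D2 T2 s2 xM _ N2 m Hm H.
    by move=> i Hi; exact: (CC i Hi).2.
  have [L|L] := leqP (best M (cost m) (gl_first (gl r1 m)) (D1 m.+1))
                     (best M (cost m) (gl_first (gl r2 m)) (D2 m.+1)).
    have [|n' [H1' H2' H3']] := IH1 x D1 T1 s1 xM _ N1 m Hm (leq_ltn_trans L H).
      by move=> i Hi; exact: (CC i Hi).1.
    by exists n'; split=> //; left.
  by exists n; split=> //; right.
- case: (@tests_ok_cat r1 r2 (RSeq r1 r2) (erefl _) T) => T1 T2.
  have wf1 i := gl_wf_positions (letter (w i)) (s i) r1.
  have wf2 i := gl_wf_positions (letter (w i)) (s i) r2.
  have [D1 [D2 [E s1 s2]]] := @table_split (positions r1) (positions r2) D sD.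
  have [N1 N2] : D1 hi = nseq (positions r1) M /\ D2 hi = nseq (positions r2) M.
    have /eqP := DN; rewrite E /= nseqD eqseq_cat ?s1 ?size_nseq //.
    by case/andP=> /eqP ? /eqP ?.
  pose y i := gl_value M (cost i) (gl r2 i) (x i) (D2 i.+1).
  have yM i : y i <= M by rewrite geq_min best_le.
  have CC i : lo <= i < hi ->
     D1 i = gl_back M (cost i) (gl r1 i) (y i) (D1 i.+1) /\
     D2 i = gl_back M (cost i) (gl r2 i) (x i) (D2 i.+1).
    move=> Hi; have /eqP := C i Hi.
    rewrite gl_seqE !E (gl_back_seq _ _ (wf1 i) (wf2 i)) // eqseq_cat.
      by case/andP=> /eqP ? /eqP ?.
    by rewrite s1 size_map; case: (wf1 i).
  have C1 : consistent r1 y D1 lo hi by move=> i Hi; exact: (CC i Hi).1.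
  have C2 : consistent r2 x D2 lo hi by move=> i Hi; exact: (CC i Hi).2.
  have I1 := IH1 y D1 T1 s1 yM C1 N1.
  have I2 := IH2 x D2 T2 s2 xM C2 N2.
  rewrite gl_seqE E (@best_first_seq _ _ _ _ _ (wf1 m)) //.
  set b1 := best _ _ (gl_first (gl r1 m)) _.
  set b2 := best _ _ (gl_first (gl r2 m)) _ => H.
  (* When the second term is strictly smaller, the first factor matches the empty word at [m] and
     the first letter belongs to the second factor. *)
  have [L|L] := leqP b1 (if gl_null (gl r1 m) then b2 else M); last first.
    move: L H; case: ifP => Hn L _; last by have := best_le M (cost m)
      (gl_first (gl r1 m)) (D1 m.+1); rewrite leqNgt L.
    have [|n [H1 H2 H3]] := I2 m Hm.
      exact: leq_trans L (best_le _ _ _ _).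
    by exists n; split=> //; exists m; split=> //; exact: gl_null_rel Hn.
  have [|k [Hk Hr Hc]] := I1 m Hm.
    by move: H; rewrite gtn_min => /orP[//|]; exact: leq_ltn_trans L.
  have Hk' : lo <= k < hi by lia.
  have yk : y k < M.
    apply: leq_ltn_trans (leq_addl _ _) (leq_ltn_trans Hc _).
    by move: H; rewrite gtn_min => /orP[//|]; exact: leq_ltn_trans L.
  have [L2|L2] := leqP (best M (cost k) (gl_first (gl r2 k)) (D2 k.+1))
                     (if gl_null (gl r2 k) then x k else M).
    have yE : y k = best M (cost k) (gl_first (gl r2 k)) (D2 k.+1).
      by rewrite /y /gl_value; apply/minn_idPl.
    have [|n [H1 H2 H3]] := I2 k Hk'; first by rewrite -yE.
    exists n; split; [lia | by exists k | ].
    rewrite (@path_cost_cat m k n); last by lia.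
    by rewrite -yE in H3; rewrite -addnA; apply: leq_trans Hc; rewrite leq_add2l.
  have yE : y k = if gl_null (gl r2 k) then x k else M.
    by rewrite /y /gl_value; apply/minn_idPr; exact: ltnW.
  move: yk yE; case: ifP => [Hn|_ + E2]; last by rewrite E2 ltnn.
  move=> _ E2; exists k; split; [lia | | by rewrite -E2].
  by exists k; split=> //; exact: gl_null_rel Hn.
- have wf i := gl_wf_positions (letter (w i)) (s i) r.
  pose y i := gl_value M (cost i) (gl (RStar r) i) (x i) (D i.+1).
  have yM i : y i <= M by rewrite geq_min best_le.
  have CC : consistent r y D lo hi.
    by move=> i Hi; rewrite (C i Hi) gl_starE (gl_back_star _ _ (wf i)) // -gl_starE.
  rewrite gl_starE /=.
  have I := IH y D T sD yM CC DN.
  (* Each iteration provided by [I] reads at least one letter, so the distance to [hi] decreases. *)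
  have [k] := ubnP (hi - m); elim: k m Hm => // k IHk m Hm Hk H.
  have [j [Hj Hr Hc]] := I m Hm H.
  have yE : y j = minn (best M (cost j) (gl_first (gl r j)) (D j.+1)) (x j).
    by rewrite /y gl_starE.
  have [L|L] := leqP (best M (cost j) (gl_first (gl r j)) (D j.+1)) (x j).
    have {}yE : y j = best M (cost j) (gl_first (gl r j)) (D j.+1).
      by rewrite yE; apply/minn_idPl.
    have [|||n [H1 H2 H3]] := IHk j; [lia | lia | by rewrite -yE; exact: leq_ltn_trans (leq_addl _ _) (leq_ltn_trans Hc H) |].
    exists n; split; [lia | |].
      by apply: rt_trans H2; exact: rt_step.
    rewrite (@path_cost_cat m j n); last by lia.
    by rewrite -yE in H3; rewrite -addnA; apply: leq_trans Hc; rewrite leq_add2l.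
  have {}yE : y j = x j by rewrite yE; apply/minn_idPr; exact: ltnW.
  by exists j; split; [lia | exact: rt_step | rewrite -yE].
Qed.
End Paths.
End Regex.

(* Subformula lists and their codes *)
Scheme form_regex_ind := Induction for form Sort Prop
with regex_form_ind := Induction for regex Sort Prop.
Combined Scheme form_regex_mutind from form_regex_ind, regex_form_ind.

Section Codes.
Variables (P : finType) (V : eqType) (vs : seq V).
Implicit Types (f g : form P V) (r : regex P V).

Lemma code_subs_dtag k s : code_subs (dtag k s) =
  let v := map code_subs s in
  (dtag k s :: (if k <= 1 then [::] else
     if k <= 3 then (nth ([::], [::]) v 0).1 ++ (nth ([::], [::]) v 1).1
     else (nth ([::], [::]) v 0).2 ++
          (nth ([::], [::]) v (if (k == 6) || (k == 7) then 2 else 1)).1),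
   if k == 0 then [::] else
   if k == 1 then (nth ([::], [::]) v 0).1 else
   (nth ([::], [::]) v 0).2 ++
   (if k <= 3 then (nth ([::], [::]) v 1).2 else [::])).
Proof. by rewrite {1}/code_subs trec_dtag dtagof_dtag. Qed.

Lemma code_subsE :
  (forall f, (code_subs (dform vs f)).1 = map (dform vs) (subforms f)) /\
  (forall r, (code_subs (dregex vs r)).2 = map (dform vs) (test_subforms r)).
Proof.
apply: form_regex_mutind => [a|a|f Hf g Hg|f Hf g Hg|r Hr f Hf|r Hr f Hf
  |r Hr z f Hf|r Hr z f Hf|r Hr f Hf|r Hr f Hf|b|f Hf|r Hr r' Hr'|r Hr r' Hr'|r Hr];
  rewrite [X in code_subs X]/= code_subs_dtag /= ?map_cat ?Hf ?Hg ?Hr ?Hr' ?cats0 //.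
Qed.

(** This order suits [foldr], which works from the right and so meets a formula after its proper
    subformulas. *)
Fixpoint suffix_closed (l : seq (form P V)) : bool :=
  if l is f :: l' then
    all (fun g => g \in l') (behead (subforms f)) && suffix_closed l'
  else true.

Lemma suffix_closed_subforms :
  (forall f l, suffix_closed l -> suffix_closed (subforms f ++ l)) /\
  (forall r l, suffix_closed l -> suffix_closed (test_subforms r ++ l)).
Proof.
have A (s l : seq (form P V)) : all (fun g => g \in s ++ l) s.
  by apply/allP => x; rewrite mem_cat => ->.
apply: form_regex_mutind => [a|a|f Hf g Hg|f Hf g Hg|r Hr f Hf|r Hr f Hf
  |r Hr z f Hf|r Hr z f Hf|r Hr f Hf|r Hr f Hf|b|f Hf|r Hr r' Hr'|r Hr r' Hr'|r Hr]
  l Hl /=; rewrite ?A //= -?catA; auto.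
Qed.

Definition direct_subs (t : data) : seq data := behead (code_subs t).1.

Lemma direct_subsE f :
  direct_subs (dform vs f) = map (dform vs) (behead (subforms f)).
Proof. by rewrite /direct_subs code_subsE.1 behead_map. Qed.

Fixpoint admissible (Q : form P V -> Prop) (s : seq data) : Prop :=
  if s is t :: s' then
    [/\ exists2 f, Q f & t = dform vs f,
        {subset direct_subs t <= s'} & admissible Q s']
  else True.

(** [undup] keeps the last of several occurrences, so subformulas remain to the right of the
    formulas that contain them. *)
Lemma admissible_undup (Q : form P V -> Prop) l :
  suffix_closed l -> (forall f, f \in l -> Q f) ->
  admissible Q (undup (map (dform vs) l)).
Proof.
elim: l => //= f l IH /andP[/allP C1 C2] HQ.
have {}IH : admissible Q (undup (map (dform vs) l)).
  by apply: IH => // g Hg; apply: HQ; rewrite inE Hg orbT.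
case: ifP => // _; split=> //; first by exists f => //; apply: HQ; rewrite inE eqxx.
move=> t; rewrite direct_subsE mem_undup => /mapP [g Hg ->].
by apply: map_f; exact: C1.
Qed.
End Codes.

(** * Truth of a subformula *)

Section Truth.
Variables (P : finType) (V : eqType) (vs : seq V).
Variables (w : nat -> {set option P}) (alpha : V -> nat) (n : nat).
Implicit Types (f g : form P V) (r : regex P V) (t : data).

Definition uniform f : Prop :=
  match f with DiaLe _ z _ | BoxLe _ z _ => alpha z = n | _ => True end.

Definition step_cost t i := modal_cost (changepoint w i) t.

Definition witnessed t r (Q : nat -> Prop) i := exists j,
  [/\ path_cost (step_cost t) i (i + j) <= modal_budget n t,
      Defs.rel w alpha r i (i + j) & Q (i + j)].

Lemma path_cost_const c i j : path_cost (fun=> c) i (i + j) = c * j.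
Proof. by rewrite /path_cost sum_nat_const_nat addKn mulnC. Qed.

Lemma path_cost_changepoint i j :
  path_cost (fun m => nat_of_bool (changepoint w m)) i (i + j) =
  count (changepoint w) (iota i j).
Proof.
rewrite /path_cost -sum1_count [RHS]big_mkcond /= /index_iota addKn.
by apply: eq_bigr => m _; case: ifP.
Qed.

(** All modal operators become one scheme: a diamond asks for a match within the budget that ends
    well, a box for the absence of one that ends badly. Recovering a box from this absence is
    classical. *)
Lemma modal_view f (t := dform vs f) : uniform f -> 3 < dtagof t ->
  exists r g, [/\ darg 0 t = dregex vs r, modal_body t = dform vs g,
    forall h, h \in g :: test_subforms r -> h \in behead (subforms f),
    positions r <= own_regex_length f
    & forall i, sat w alpha f i <->
        (if is_box t then ~ witnessed t r (fun m => ~ sat w alpha g m) i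
         else witnessed t r (sat w alpha g) i)].
Proof.
have sub r g h : h \in g :: test_subforms r -> h \in test_subforms r ++ subforms g.
  rewrite inE mem_cat => /orP[/eqP ->|->] //.
  by apply/orP; right; case: (g) => *; rewrite inE eqxx.
have neg (Q : nat -> Prop) m : ~ ~ Q m -> Q m by apply: NNPP.
rewrite {}/t; case: f => [a|a|f g|f g|r f|r f|r z f|r z f|r f|r f] U;
  rewrite ?dtagof_dtag // => _; exists r, f; rewrite /witnessed /modal_body
    /modal_budget /is_box /step_cost /modal_cost ?dtagof_dtag ?darg_dtag /=;
  split=> //; try exact: sub; try exact: positions_length; move=> i; split.
- by case=> j [H1 H2]; exists j; rewrite path_cost_const.
- by case=> j [_ H1 H2]; exists j.
- by move=> H [j [_ H1]]; apply; exact: H.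
- move=> H j Hj; apply: (neg) => N; apply: H; exists j.
  by rewrite path_cost_const.
- by case=> j [H1 H2 H3]; exists j; rewrite path_cost_const mul1n -U.
- by case=> j []; rewrite path_cost_const mul1n -U => H1 H2 H3; exists j.
- move=> H [j []]; rewrite path_cost_const mul1n -U => H1 H2; apply; exact: H.
- move=> H j Hj Hr; apply: (neg) => N; apply: H; exists j.
  by rewrite path_cost_const mul1n -U.
- by case=> j [H1 H2 H3]; exists j; rewrite path_cost_changepoint.
- by case=> j []; rewrite path_cost_changepoint => H1 H2 H3; exists j.
- by move=> H [j []]; rewrite path_cost_changepoint => H1 H2; apply; exact: H.
- move=> H j Hj Hr; apply: (neg) => N; apply: H; exists j.
  by rewrite path_cost_changepoint.
Qed.

Lemma best_take M c bs d : best M c bs d = best M c bs (take (size bs) d).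
Proof.
elim: bs d => // b bs IH [|x d]; rewrite !best_cons //=.
by rewrite -IH.
Qed.

Lemma gl_value_take M c (h : glushkov) k x d : gl_wf k h ->
  gl_value M c h x d = gl_value M c h x (take k d).
Proof. by case=> E _ _; rewrite /gl_value best_take E. Qed.

Lemma gl_back_take M c (h : glushkov) k x d : gl_wf k h ->
  gl_back M c h x d = gl_back M c h x (take k d).
Proof.
case=> _ _ E; apply/eq_in_map => p Hp.
by rewrite best_take (E p Hp).
Qed.

Definition node_width t : nat := size (node [::] false 0 [::] 0 [::] [::] t).2.1.

Definition node_back (s : nat -> seq data) t i (d : seq nat) : seq nat :=
  (node (letter (w i)) (changepoint w i) n (s i) 0 d d t).2.1.

Lemma node_modal a cp s o d e f r (t := dform vs f) :
  3 < dtagof t -> darg 0 t = dregex vs r ->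
  [/\ node_width t = positions r,
      (node a cp n s o d e t).1 =
        (gl_value (cap n) (modal_cost cp t) (code_glushkov a s (dregex vs r))
           (modal_end n s t) (take (positions r) (drop o d))
           <= modal_budget n t) (+) is_box t
    & (node a cp n s o d e t).2 =
        (gl_back (cap n) (modal_cost cp t) (code_glushkov a s (dregex vs r))
           (modal_end n s t) (take (positions r) (drop o d)),
         gl_back (cap n) (modal_cost cp t) (code_glushkov a s (dregex vs r))
           (modal_end n s t) (take (positions r) (drop o e)))].
Proof.
move=> Ht Er; rewrite /node_width /node leqNgt Ht /= Er; split.
- by rewrite size_map; case: (gl_wf_positions vs [::] [::] r).
- by rewrite -(gl_value_take _ _ _ _ (gl_wf_positions vs a s r)).
- by rewrite -!(gl_back_take _ _ _ _ (gl_wf_positions vs a s r)).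
Qed.

(** A node reads only its own window of the tables, which allows induction over the list of
    subformulas with one window at a time. *)
Lemma node_take a cp s o d e f (t := dform vs f) : uniform f ->
  node a cp n s o d e t =
  node a cp n s 0 (take (node_width t) (drop o d))
                  (take (node_width t) (drop o e)) t.
Proof.
move=> U; case: (ltnP 3 (dtagof t)) => Ht; last by rewrite /node Ht.
have [r [g [Er _ _ _ _]]] := modal_view U Ht.
have [W v1 b1] := node_modal a cp s o d e Ht Er.
have [_ v2 b2] := node_modal a cp s 0 (take (node_width t) (drop o d))
  (take (node_width t) (drop o e)) Ht Er.
rewrite [LHS]surjective_pairing [RHS]surjective_pairing v1 v2 b1 b2 -W.
by rewrite !drop0 !take_takel.
Qed.

Lemma size_node a cp s o d e f (t := dform vs f) : uniform f ->
  size (node a cp n s o d e t).2.1 = node_width t /\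
  size (node a cp n s o d e t).2.2 = node_width t.
Proof.
move=> U; case: (ltnP 3 (dtagof t)) => Ht.
  have [r [g [Er _ _ _ _]]] := modal_view U Ht.
  have [W _ ->] := node_modal a cp s o d e Ht Er.
  rewrite W !size_map.
  by case: (gl_wf_positions vs a s r).
by rewrite /node_width /node Ht.
Qed.

Lemma node_width_length f : uniform f ->
  node_width (dform vs f) <= own_regex_length f.
Proof.
move=> U; case: (ltnP 3 (dtagof (dform vs f))) => Ht.
  have [r [g [Er _ _ L _]]] := modal_view U Ht.
  by have [-> _ _] := node_modal [::] false [::] 0 [::] [::] Ht Er.
by rewrite /node_width /node Ht.
Qed.

Lemma node_back_e s t i d e :
  (node (letter (w i)) (changepoint w i) n (s i) 0 d e t).2 =
  (node_back s t i d, node_back s t i e).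
Proof. by rewrite /node_back /node; case: ifP. Qed.

Lemma node_truth_e a cp s o d e e' t :
  (node a cp n s o d e t).1 = (node a cp n s o d e' t).1.
Proof. by rewrite /node; case: ifP. Qed.

Lemma modal_budget_cap t : modal_budget n t < cap n.
Proof. by rewrite /modal_budget /cap; case: ifP => _; [|case: ifP => _]; lia. Qed.

(* The condition on [H] says that the finite values of [D] are realized within
   a bounded time, which excludes postponing a diamond forever. *)
Definition realized (s : nat -> seq data) t (D : nat -> seq nat) :=
  forall m, exists hi H,
    [/\ m < hi, H m.+1 = D m.+1, forall i, size (H i) = node_width t,
        forall i, m <= i < hi -> H i = node_back s t i (H i.+1)
      & H hi = nseq (node_width t) (cap n)].

(** A witness within the budget forces a small value by [gl_value_rel], for which the equations
    suffice. Conversely a small value yields a witness by [best_first_rel], applied to the finite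
    computation that [realized] supplies. *)
Lemma node_truth f (t := dform vs f) (s : nat -> seq data) (D : nat -> seq nat) :
  uniform f ->
  (forall g, g \in behead (subforms f) ->
     forall i, dform vs g \in s i <-> sat w alpha g i) ->
  (forall i, size (D i) = node_width t) ->
  (forall i, D i = node_back s t i (D i.+1)) ->
  realized s t D ->
  forall i e, (node (letter (w i)) (changepoint w i) n (s i) 0 (D i.+1) e t).1
     <-> sat w alpha f i.
Proof.
move=> U Hs sD cD rD i e.
have mh g : g \in subforms g by case: (g) => *; rewrite inE eqxx.
case: (ltnP 3 (dtagof t)) => Ht; last first.
  rewrite {}/t in sD cD rD Ht *.
  case: f U Hs sD cD rD Ht => [a|a|f g|f g|r f|r f|r z f|r z f|r f|r f] U Hs _ _ _;
    rewrite ?dtagof_dtag // => _; rewrite /node dtagof_dtag /= !darg_dtag.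
  - by rewrite nth_letter.
  - by rewrite nth_letter.
  - split=> [/andP[H1 H2]|[H1 H2]].
      by split; apply/Hs => //=; rewrite mem_cat mh ?orbT.
    by apply/andP; split; apply/Hs => //=; rewrite mem_cat mh ?orbT.
  - split=> [/orP[H1|H1]|[H1|H1]].
    + by left; apply/Hs => //=; rewrite mem_cat mh ?orbT.
    + by right; apply/Hs => //=; rewrite mem_cat mh ?orbT.
    + by apply/orP; left; apply/Hs => //=; rewrite mem_cat mh ?orbT.
    + by apply/orP; right; apply/Hs => //=; rewrite mem_cat mh ?orbT.
have [r [g [Er Eg Hsub _ ->]]] := modal_view U Ht.
have [W -> _] := node_modal (letter (w i)) (changepoint w i) (s i) 0 (D i.+1) e Ht Er.
rewrite drop0 take_oversize; last by rewrite sD W.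
have T : tests_ok vs w alpha s r.
  by move=> h Hh j; apply: Hs; apply: Hsub; rewrite inE Hh orbT.
pose x j := modal_end n (s j) t.
have xM j : x j <= cap n by rewrite /x /modal_end; case: ifP.
have x0 j : x j < cap n <-> (if is_box t then ~ sat w alpha g j else sat w alpha g j).
  rewrite /x /modal_end Eg.
  have Hg : dform vs g \in s j <-> sat w alpha g j.
    by apply: Hs; apply: Hsub; rewrite inE eqxx.
  have c0 : 0 < cap n by rewrite /cap; lia.
  case: (is_box t); case: (dform vs g \in s j) Hg => Hg /=; rewrite ?ltnn ?c0;
    split=> //.
  - by case; apply/Hg.
  - by move=> _ /Hg.
  - by move=> _; apply/Hg.
  - by move/Hg.
have x00 j : x j < cap n -> x j = 0 by rewrite /x /modal_end; case: ifP; rewrite ?ltnn.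
have bE j d : size d = node_width t -> node_back s t j d = gl_back (cap n)
    (step_cost t j) (code_glushkov (letter (w j)) (s j) (dregex vs r)) (x j) d.
  move=> sd; rewrite /node_back.
  have [_ _ ->] := node_modal (letter (w j)) (changepoint w j) (s j) 0 d d Ht Er.
  by rewrite drop0 take_oversize // sd W.
set v := gl_value _ _ _ _ _.
have key : v <= modal_budget n t <->
    witnessed t r (fun j => if is_box t then ~ sat w alpha g j else sat w alpha g j) i.
  split=> [Hv|[j [H1 H2 /x0 /x00 H3]]]; last first.
    have sD' k : size (D k) = positions r by rewrite sD.
    have C hi : consistent vs w s (cap n) (step_cost t) r x D 0 hi.
      by move=> k _; rewrite {1}cD bE.
    have := gl_value_rel T sD' xM C H2.
    by rewrite H3 addn0 => H; exact: leq_trans H H1.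
  have Hc := leq_ltn_trans Hv (modal_budget_cap t).
  move: Hv; rewrite /v /gl_value geq_min => /orP[Hb|].
    have [hi [H [Hi HD sH cH HN]]] := rD i.
    have sH' k : size (H k) = positions r by rewrite sH.
    have C : consistent vs w s (cap n) (step_cost t) r x H i hi.
      by move=> k Hk; rewrite (cH k Hk) bE.
    rewrite W in HN.
    have [||j [Hj1 Hj2 Hj3]] := best_first_rel T sH' xM C HN (m := i).
    - by rewrite leqnn.
    - by rewrite HD; exact: leq_ltn_trans Hb (modal_budget_cap t).
    rewrite HD in Hj3; have Hj : i + (j - i) = j by lia.
    have Hle : path_cost (step_cost t) i j + x j <= modal_budget n t.
      exact: leq_trans Hj3 Hb.
    exists (j - i); rewrite Hj; split=> //; first exact: leq_trans (leq_addr _ _) Hle.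
    apply/x0; apply: leq_ltn_trans (modal_budget_cap t).
    exact: leq_trans (leq_addl _ _) Hle.
  (* The value can also come from ending at once, by a match that reads no letter. *)
  case: ifP => [Hn Hx|_ Hx]; last by move: (modal_budget_cap t); rewrite ltnNge Hx.
  exists 0; rewrite addn0 path_cost0; split=> //; first exact: gl_null_rel Hn.
  by apply/x0; apply: leq_ltn_trans Hx (modal_budget_cap t).
case: (is_box t) key => [] key /=; rewrite ?addbT ?addbF //.
split=> [/negP H /key|H]; first by [].
by apply/negP => /key.
Qed.
End Truth.

(** * Limits of sequences *)

Lemma nonincreasing_stable (f : nat -> nat) :
  (forall k, f k.+1 <= f k) -> exists K, forall k, K <= k -> f k = f K.
Proof.
move=> H; have mono j k : j <= k -> f k <= f j.
  move/subnK <-; elim: (k - j) => // i; exact: leq_trans (H _).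
suff X b : forall K, f K <= b -> exists K, forall k, K <= k -> f k = f K.
  exact: (X (f 0) 0).
elim: b => [|b IH] K HK.
  by exists K => k /mono; lia.
case: (excluded_middle_informative (exists2 k, K <= k & f k < f K)).
  by case=> k _ Hk; apply: (IH k); rewrite -ltnS; exact: leq_trans Hk HK.
move=> N; exists K => k Hk; apply/eqP; rewrite eqn_leq mono //= leqNgt.
by apply/negP => L; apply: N; exists k.
Qed.

Lemma sumn_leq_eq (s t : seq nat) : size s = size t ->
  (forall i, nth 0 s i <= nth 0 t i) -> sumn t <= sumn s -> s = t.
Proof.
have le u v : size u = size v -> (forall i, nth 0 u i <= nth 0 v i) ->
    sumn u <= sumn v.
  elim: u v => [|x u IH] [|y v] //= [E] H; apply: leq_add; first exact: (H 0).
  by apply: IH => // i; exact: (H i.+1).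
elim: s t => [|x s IH] [|y t] //= [E] H Hs.
have := H 0 => /= H0; have H' i := H i.+1; have Hst := le s t E H'.
by rewrite (IH t) //; [congr (_ :: _); lia | lia].
Qed.

(** The sum of the entries is a nonincreasing number, hence eventually constant; with a constant
    sum, entries that only decrease cannot change. *)
Lemma table_limit (u : nat -> nat -> seq nat) (L : nat) :
  (forall i k, size (u i k) = L) ->
  (forall i k j, nth 0 (u i k.+1) j <= nth 0 (u i k) j) ->
  exists D, forall i, exists K, forall k, K <= k -> u i k = D i.
Proof.
move=> sz mono.
have ex i : exists x, exists K, forall k, K <= k -> u i k = x.
  have [|K HK] := @nonincreasing_stable (fun k => sumn (u i k)).
    move=> k; rewrite leqNgt; apply/negP => Hlt.
    have E := @sumn_leq_eq (u i k.+1) (u i k) _ (mono i k) (ltnW Hlt).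
    by rewrite E ?ltnn ?sz // in Hlt.
  exists (u i K), K => k Hk; apply: sumn_leq_eq; rewrite ?sz ?HK // => j.
  rewrite -(subnK Hk); elim: (k - K) => // m IHm; exact: leq_trans (mono _ _ _) IHm.
by exists (fun i => sval (constructive_indefinite_description _ (ex i))) => i;
  case: constructive_indefinite_description.
Qed.

(** A prefix is [good] if it is shared by sequences of arbitrarily large index. Since [Q] is finite,
    a good prefix has a good extension by one value; otherwise the largest of finitely many bounds
    would refute it. *)
Lemma koenig (T : eqType) (Q : seq T) (x : nat -> nat -> T) :
  (forall N i, x N i \in Q) ->
  exists y, forall k m, exists2 N, m <= N & forall i, i < k -> x N i = y i.
Proof.
move=> HQ; case: Q HQ => [/(_ 0 0)//|q0 Q] HQ.
pose good p := forall m, exists2 N, m <= N & forall i, i < size p -> x N i = nth q0 p i.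
have ext p : good p -> exists q, good (rcons p q).
  move=> Hp; apply: NNPP => /not_ex_all_not H.
  have bad q : exists m, forall N, m <= N ->
      (forall i, i < size p -> x N i = nth q0 p i) -> x N (size p) <> q.
    move: (H q) => /not_all_ex_not [m Hm]; exists m => N HN Hi E; apply: Hm.
    exists N => // i; rewrite size_rcons ltnS leq_eqVlt nth_rcons => /orP[/eqP ->|L].
      by rewrite ltnn eqxx.
    by rewrite L Hi.
  have [m Hm] : exists m, forall q, q \in q0 :: Q -> forall N, m <= N ->
      (forall i, i < size p -> x N i = nth q0 p i) -> x N (size p) <> q.
    elim: (q0 :: Q) => [|q s [m Hm]]; first by exists 0.
    have [m' Hm'] := bad q; exists (maxn m m') => r; rewrite inE => /orP[/eqP ->|Hr] N;
    rewrite geq_max => /andP[H1 H2]; [exact: Hm' | exact: Hm].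
  have [N HN Hi] := Hp m; exact: (Hm (x N (size p)) (HQ _ _) N HN Hi).
pose nxt p := if excluded_middle_informative (good p) is left H
  then rcons p (sval (constructive_indefinite_description _ (ext p H))) else p.
pose pre k := iter k nxt [::].
have gd k : good (pre k) /\ size (pre k) = k.
  elim: k => [|k [G E]]; first by split=> // m; exists m.
  rewrite /pre /= -/(pre k) /nxt; case: excluded_middle_informative => // H.
  by rewrite size_rcons E; case: constructive_indefinite_description.
have sub k j i : i < k -> nth q0 (pre (j + k)) i = nth q0 (pre k) i.
  move=> Hi; elim: j => // j <-; rewrite addSn /pre /= -/(pre (j + k)) /nxt.
  case: excluded_middle_informative => // H; rewrite nth_rcons (gd (j + k)).2.
  by rewrite (leq_trans Hi) // leq_addl.
exists (fun i => nth q0 (pre i.+1) i) => k m.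
have [G E] := gd k; have [N HN Hi] := G m; exists N => // i Hik.
by rewrite Hi ?E // -(subnK Hik) sub.
Qed.

Lemma mem_words b l x : (x \in words b l) = (size x == l) && all (fun c => c < b) x.
Proof.
elim: l x => [|l IH] x; first by case: x.
apply/flattenP/idP => [[_ /mapP [c Hc ->] /mapP [z Hz ->]]|].
  by rewrite /= eqSS; move: Hc Hz; rewrite mem_iota IH /= => -> /andP[-> ->].
case: x => // c x; rewrite /= eqSS => /andP[E /andP[Hc Hx]].
exists [seq c :: v | v <- words b l]; last by apply: map_f; rewrite IH E.
by apply/mapP; exists c; rewrite ?mem_iota.
Qed.

Lemma size_words b l : size (words b l) = b ^ l.
Proof.
elim: l => // l IH; rewrite [words _ _]/= size_flatten expnS -[b in b * _](size_iota 0).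
by elim: (iota 0 b) => //= c s ->; rewrite size_map IH mulSn.
Qed.

(** * Backward consistent tables *)

Section Tables.
Variables (P : finType) (V : eqType) (vs : seq V).
Variables (w : nat -> {set option P}) (alpha : V -> nat) (n : nat).
Variable Q : form P V -> Prop.
Hypothesis Q_uniform : forall f, Q f -> uniform alpha n f.
Hypothesis Q_sub : forall f g, Q f -> g \in behead (subforms f) -> Q g.

Local Notation adm := (admissible vs Q).

Lemma backstep_cons a cp d e t s : backstep a cp n d e (t :: s) =
  add_node a cp n d e t (backstep a cp n d e s).
Proof. by []. Qed.

Definition table_width (s : seq data) : nat := sumn (map node_width s).

Lemma size_backstep a cp d e s : adm s ->
  size (backstep a cp n d e s).2.1 = table_width s /\
  size (backstep a cp n d e s).2.2 = table_width s.
Proof.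
elim: s => // t s IH [[f Qf ->] _ /IH [E1 E2]].
rewrite backstep_cons /add_node; set r := backstep _ _ _ _ _ _ in E1 E2 *.
have [E3 E4] := size_node vs w a cp r.1 (size r.2.1) d e (Q_uniform Qf).
by rewrite /= !size_cat E3 E4 E1 E2 /table_width /= addnC.
Qed.

Lemma backstep_bound a cp d e s :
  all (fun x => x < (cap n).+1) (backstep a cp n d e s).2.1 /\
  all (fun x => x < (cap n).+1) (backstep a cp n d e s).2.2.
Proof.
have B M c g x dd : all (fun x => x < M.+1) (gl_back M c g x dd).
  by apply/allP => y /mapP [p _ ->]; rewrite ltnS geq_min best_le.
elim: s => // t s [E1 E2]; rewrite backstep_cons /= !all_cat E1 E2 /node.
by case: ifP => _ //=; rewrite !B.
Qed.

Lemma backstep_sub a cp d e s : {subset (backstep a cp n d e s).1 <= s}.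
Proof.
elim: s => // t s IH x; rewrite backstep_cons /= inE; case: ifP => _.
  by rewrite inE => /orP[->//|/IH ->]; rewrite orbT.
by move/IH => ->; rewrite orbT.
Qed.

Lemma backstep_e a cp d e e' s :
  (backstep a cp n d e s).1 = (backstep a cp n d e' s).1 /\
  (backstep a cp n d e s).2.1 = (backstep a cp n d e' s).2.1.
Proof.
elim: s => // t s [E1 E2]; rewrite !backstep_cons /= E1 E2; split.
  by rewrite (node_truth_e n a cp _ _ d e e').
by congr (_ ++ _); rewrite /node; case: ifP.
Qed.

Lemma backstep_take a cp d e s : adm s -> backstep a cp n d e s =
  backstep a cp n (take (table_width s) d) (take (table_width s) e) s.
Proof.
(* The cut is at any [k] beyond the width, so that the truncated tables stay the same while the list
   shrinks in the induction. *)
have gen k : adm s -> table_width s <= k -> backstep a cp n d e s =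
    backstep a cp n (take k d) (take k e) s.
  elim: s => // t s IH [[f Qf ->] _ Hs] Hk.
  have L : table_width s <= k by apply: leq_trans Hk; rewrite /table_width /= leq_addl.
  rewrite !backstep_cons -(IH Hs L) /add_node.
  have [-> _] := size_backstep a cp d e Hs.
  rewrite (node_take vs w _ _ _ _ d e (Q_uniform Qf)).
  rewrite (node_take vs w _ _ _ _ (take k d) (take k e) (Q_uniform Qf)).
  rewrite !take_drop !take_takel //; move: Hk; rewrite /table_width /= ; lia.
by move=> Hs; apply: gen.
Qed.

Definition step_at s i d e := backstep (letter (w i)) (changepoint w i) n d e s.

(** Quantifying over all formulas with a given code makes the statement independent of whether
    distinct formulas have distinct codes. *)
Definition truth_ok (s : seq data) (tab : nat -> seq data) := forall f, Q f ->
  dform vs f \in s -> forall i, dform vs f \in tab i <-> sat w alpha f i.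

Lemma step_at_cons t s i d e f (tab := step_at s i d e)
    (D := take (node_width t) (drop (table_width s) d))
    (E := take (node_width t) (drop (table_width s) e)) :
  adm s -> Q f -> t = dform vs f ->
  step_at (t :: s) i d e =
  (if (node (letter (w i)) (changepoint w i) n tab.1 0 D E t).1 then t :: tab.1
   else tab.1,
   (tab.2.1 ++ node_back w n (fun=> tab.1) t i D,
    tab.2.2 ++ node_back w n (fun=> tab.1) t i E)).
Proof.
move=> Hs Qf Et; rewrite /step_at backstep_cons -/(step_at s i d e).
rewrite -/tab /add_node; have [Es _] := size_backstep (letter (w i)) (changepoint w i) d e Hs.
have N : node (letter (w i)) (changepoint w i) n tab.1 (table_width s) d e t =
    node (letter (w i)) (changepoint w i) n tab.1 0 D E t.
  by rewrite Et (node_take vs w _ _ _ _ d e (Q_uniform Qf)) -Et.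
by have := node_back_e w n (fun=> tab.1) t i D E; rewrite Es N => /= ->.
Qed.

Lemma truth_ok_cons t s tab (v : nat -> bool) (f : form P V) : adm (t :: s) -> t = dform vs f ->
  t \notin s -> (forall i, {subset (tab i : seq data) <= s}) -> truth_ok s tab ->
  (forall g, Q g -> t = dform vs g -> forall i, v i <-> sat w alpha g i) ->
  truth_ok (t :: s) (fun i => if v i then t :: tab i else tab i).
Proof.
move=> A Et Ht sub T Hv g Qg; rewrite inE => Hg i.
have [Eg|Ng] := eqVneq (dform vs g) t.
  have := Hv g Qg (esym Eg) i; rewrite Eg => <-; case: (v i).
    by rewrite inE eqxx.
  by split=> // /sub Hx; rewrite Hx in Ht.
move: Hg; rewrite (negPf Ng) /= => Hg; rewrite -(T g Qg Hg i).
by case: (v i) => //; rewrite inE (negPf Ng).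
Qed.

Lemma children_ok t s tab (g : form P V) : adm (t :: s) -> Q g -> t = dform vs g ->
  truth_ok s tab -> forall h, h \in behead (subforms g) ->
  forall i, dform vs h \in tab i <-> sat w alpha h i.
Proof.
case=> _ Hsub _ Qg Et T h Hh i; apply: T; first exact: Q_sub Hh.
by apply: Hsub; rewrite Et direct_subsE map_f.
Qed.

Lemma node_back_ext (s s' : nat -> seq data) t i d : s i = s' i ->
  node_back w n s t i d = node_back w n s' t i d.
Proof. by rewrite /node_back => ->. Qed.

Section Soundness.
Variables (l : nat) (d e ee : nat -> seq nat) (rz : nat -> bool).
Hypotheses (sd : forall i, size (d i) = l) (se : forall i, size (e i) = l).
Hypothesis rz_true : forall i, rz i -> ee i = nseq l (cap n) /\ d i = e i.
Hypothesis rz_false : forall i, ~~ rz i -> ee i = e i.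
Hypothesis rz_inf : infinitely_often rz.

(** The resets are given abstractly, by their times [rz] and the table [ee] after resetting, because
    position 0 has no stored tables and gets values chosen for the purpose. *)
Lemma backstep_sound s : adm s -> uniq s -> table_width s <= l ->
  (forall i, take (table_width s) (d i) = (step_at s i (d i.+1) (ee i.+1)).2.1) ->
  (forall i, take (table_width s) (e i) = (step_at s i (d i.+1) (ee i.+1)).2.2) ->
  truth_ok s (fun i => (step_at s i (d i.+1) (ee i.+1)).1).
Proof.
elim: s => // t s IH A; rewrite cons_uniq => /andP[Ht Us] Hl Hd He.
have [[f Qf Et] Hsub Hs] := A.
have {}Hl : table_width s + node_width t <= l.
  by move: Hl; rewrite /table_width /= addnC.
have tw : table_width (t :: s) = table_width s + node_width t.
  by rewrite /table_width /= addnC.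
pose a i := step_at s i (d i.+1) (ee i.+1).
pose D i := take (node_width t) (drop (table_width s) (d i)).
pose E i := take (node_width t) (drop (table_width s) (e i)).
pose EE i := take (node_width t) (drop (table_width s) (ee i)).
have stE i := step_at_cons i (d i.+1) (ee i.+1) Hs Qf Et.
have sz i : size (a i).2.1 = table_width s /\ size (a i).2.2 = table_width s.
  exact: size_backstep.
have Hd' i : take (table_width s) (d i) = (a i).2.1 /\
    D i = node_back w n (fun i => (a i).1) t i (D i.+1).
  have := Hd i; rewrite stE tw /= -/(a i) => H.
  have := congr1 (take (table_width s)) H; rewrite take_takel ?leq_addr //.
  rewrite take_size_cat; last by case: (sz i).
  move=> ->; split=> //; have := congr1 (drop (table_width s)) H.
  rewrite drop_size_cat; last by case: (sz i).
  by rewrite [_ + node_width t]addnC -take_drop -/(D i) => ->; exact: node_back_ext.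
have He' i : take (table_width s) (e i) = (a i).2.2 /\
    E i = node_back w n (fun i => (a i).1) t i (EE i.+1).
  have := He i; rewrite stE tw /= -/(a i) => H.
  have := congr1 (take (table_width s)) H; rewrite take_takel ?leq_addr //.
  rewrite take_size_cat; last by case: (sz i).
  move=> ->; split=> //; have := congr1 (drop (table_width s)) H.
  rewrite drop_size_cat; last by case: (sz i).
  by rewrite [_ + node_width t]addnC -take_drop -/(E i) => ->; exact: node_back_ext.
have T : truth_ok s (fun i => (a i).1).
  apply: IH => // [|i|i]; [lia | exact: (Hd' i).1 | exact: (He' i).1].
have szD i : size (D i) = node_width t.
  by rewrite size_takel // size_drop sd; lia.
have szE i : size (E i) = node_width t.
  by rewrite size_takel // size_drop se; lia.
have rD : realized w n (fun i => (a i).1) t D.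
  (* Take two consecutive resets [t1 < t2] after [m]. Between them [e] is computed from infinite
     entries at [t2], without any influence of [d], and at [t1] it agrees with [d]. So [d] up to
     [t1], continued by [e], is a finite computation of the value in question. *)
  move=> m; have [t1 L1 R1] := rz_inf m.+1.
  have ex : exists j, (t1 < j) && rz j.
    by have [j Lj Rj] := rz_inf t1.+1; exists j; rewrite Lj.
  case: (ex_minnP ex) => t2 /andP[L2 R2] Hmin.
  have nr j : t1 < j < t2 -> ~~ rz j.
    move=> /andP[H1 H2]; apply/negP => R; have := Hmin j.
    by rewrite H1 R leqNgt H2 => /(_ isT).
  have EEn : EE t2 = nseq (node_width t) (cap n).
    rewrite /EE (rz_true R2).1 -(@subnKC (table_width s) l); last by lia.
    rewrite nseqD drop_size_cat ?size_nseq //.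
    rewrite -(@subnKC (node_width t) (l - table_width s)); last by lia.
    by rewrite nseqD take_size_cat ?size_nseq.
  exists t2, (fun j => if j <= t1 then D j else if j < t2 then E j
              else nseq (node_width t) (cap n)); split.
  - lia.
  - by rewrite L1.
  - by move=> j; case: ifP => // _; case: ifP => // _; rewrite size_nseq.
  - move=> j Hj; have [Hj1|Hj1] := ltnP j t1.
      by rewrite ltnW // (Hd' j).2.
    have EEj : EE j.+1 = if j.+1 < t2 then E j.+1 else nseq (node_width t) (cap n).
      case: ltnP => L; first by rewrite /EE rz_false // nr //; lia.
      by rewrite -EEn; congr EE; lia.
    have [E1|N1] := eqVneq j t1.
      rewrite E1 leqnn -E1 -EEj -(He' j).2 /D /E.
      by rewrite E1 (rz_true R1).2.
    have -> : (j <= t1) = false by lia.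
    by case/andP: (Hj) => _ ->; rewrite -EEj -(He' j).2.
  - by rewrite leqNgt L2 ltnn.
move=> g Qg Hg i; rewrite stE /= -/(a i) -/(D i.+1) -/(EE i.+1).
pose v i := (node (letter (w i)) (changepoint w i) n (a i).1 0 (D i.+1) (EE i.+1) t).1.
have X := @truth_ok_cons t s (fun i => (a i).1) v f A Et Ht _ T _ g Qg Hg i.
apply: X => [j|h Qh Eh j]; first exact: backstep_sub.
rewrite /v Eh; rewrite Eh in szD rD; apply: (@node_truth _ _ vs w alpha n h (fun i => (a i).1) D) => //.
- exact: Q_uniform.
- exact: (children_ok A Qh Eh T).
- by move=> k; rewrite -Eh (Hd' k).2.
Qed.
End Soundness.

(** Value iteration: [k] backward steps that start with infinite entries. *)
Fixpoint chain s (d : nat -> seq nat) i k : seq nat :=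
  if k is k'.+1 then (step_at s i (d i.+1) (chain s d i.+1 k')).2.2
  else nseq (table_width s) (cap n).

Lemma node_back_leq s t i d d' : size d = size d' ->
  (forall j, nth 0 d j <= nth 0 d' j) ->
  forall j, nth 0 (node_back w n s t i d) j <= nth 0 (node_back w n s t i d') j.
Proof.
move=> Es H j; rewrite /node_back /node; case: ifP => // _ /=.
rewrite !drop0 /gl_back; set g := code_glushkov _ _ _.
have [L|L] := ltnP j (size (gl_follow g)); last by rewrite !nth_default ?size_map.
rewrite !(nth_map (false, [::])) // leq_min.
by rewrite geq_min best_leq //= geq_minr.
Qed.

Lemma node_back_cap s t i d j : nth 0 (node_back w n s t i d) j <= cap n.
Proof.
rewrite /node_back /node; case: ifP => _ /=; first by rewrite nth_nil.
rewrite /gl_back; set g := code_glushkov _ _ _.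
have [L|L] := ltnP j (size (gl_follow g)); last by rewrite nth_default ?size_map.
by rewrite (nth_map (false, [::])) // geq_min best_le.
Qed.

Lemma backstep_exists s : adm s -> uniq s -> exists d,
  [/\ forall i, size (d i) = table_width s,
      forall i e, (step_at s i (d i.+1) e).2.1 = d i,
      forall e, truth_ok s (fun i => (step_at s i (d i.+1) (e i)).1)
    & forall i, exists K, forall k, K <= k -> chain s d i k = d i].
Proof.
elim: s => [|t s IH] A.
  move=> _; exists (fun=> [::]); split=> // i; exists 0 => k _.
  by case: k.
rewrite cons_uniq => /andP[Ht Us]; have [[f Qf Et] Hsub Hs] := A.
have [d [sd cd Td kd]] := IH Hs Us.
pose tab i := (step_at s i (d i.+1) [::]).1.
have tabE i e : (step_at s i (d i.+1) e).1 = tab i.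
  exact: (backstep_e _ _ _ _ _ _).1.
have T : truth_ok s tab by exact: (Td (fun=> [::])).
(* Value iteration for the window of [t] alone, with the truth of the smaller formulas already
   final. *)
pose ch := fix ch i k := if k is k'.+1 then node_back w n tab t i (ch i.+1 k')
  else nseq (node_width t) (cap n).
have nbs i x : size (node_back w n tab t i x) = node_width t.
  by rewrite /node_back {1}Et (size_node vs w _ _ _ _ _ _ (Q_uniform Qf)).1 Et.
have sch i k : size (ch i k) = node_width t.
  by case: k => [|k] /=; rewrite ?size_nseq ?nbs.
have mono i k j : nth 0 (ch i k.+1) j <= nth 0 (ch i k) j.
  elim: k i j => [|k IHk] i j.
    rewrite [ch i 0]/= nth_nseq; case: ifP => L; first exact: node_back_cap.
    by rewrite nth_default // sch leqNgt L.
  by apply: node_back_leq => [|j']; [rewrite !sch | exact: IHk].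
have [D HD] := table_limit sch mono.
have sD i : size (D i) = node_width t.
  by have [K /(_ K (leqnn _)) <-] := HD i; exact: sch.
have cD i : D i = node_back w n tab t i (D i.+1).
  have [K HK] := HD i; have [K' HK'] := HD i.+1.
  rewrite -(HK (maxn K K').+1); last by rewrite leqW // leq_maxl.
  by rewrite -(HK' (maxn K K')) ?leq_maxr.
have rD : realized w n tab t D.
  move=> m; have [K HK] := HD m.+1; have Lm : m < m.+1 + K by rewrite addSn ltnS leq_addr.
  exists (m.+1 + K), (fun j => if j <= m then D j else ch j (m.+1 + K - j)); split=> //.
  - by rewrite ltnn addKn HK.
  - by move=> j; case: ifP.
  - move=> j /andP[Hj1 Hj2].
    have -> : (j.+1 <= m) = false by apply/negP; lia.
    case: ifP => L.
      have -> : j = m by lia.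
      by rewrite addKn HK // -cD.
    have -> : m.+1 + K - j = (m.+1 + K - j.+1).+1 by lia.
    by [].
  - by rewrite leqNgt Lm subnn.
have tw : table_width (t :: s) = table_width s + node_width t.
  by rewrite /table_width /= addnC.
pose dd i := d i ++ D i.
have stE i e1 e2 : size e1 = table_width s -> size e2 = node_width t ->
    step_at (t :: s) i (dd i.+1) (e1 ++ e2) =
    (if (node (letter (w i)) (changepoint w i) n (tab i) 0 (D i.+1) e2 t).1
     then t :: tab i else tab i,
     (d i ++ D i, (step_at s i (d i.+1) e1).2.2 ++ node_back w n tab t i e2)).
  move=> s1 s2; rewrite (step_at_cons i _ _ Hs Qf Et).
  have -> : step_at s i (dd i.+1) (e1 ++ e2) = step_at s i (d i.+1) e1.
    rewrite /step_at backstep_take // take_size_cat ?sd //.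
    by rewrite take_size_cat.
  rewrite tabE cd !drop_size_cat ?sd // !take_oversize ?sD ?s2 //.
  by rewrite [in RHS](cD i).
have dE i e : (step_at (t :: s) i (dd i.+1) e).1 =
    (step_at (t :: s) i (dd i.+1) (nseq (table_width s) 0 ++ nseq (node_width t) 0)).1
    /\ (step_at (t :: s) i (dd i.+1) e).2.1 =
    (step_at (t :: s) i (dd i.+1) (nseq (table_width s) 0 ++ nseq (node_width t) 0)).2.1.
  exact: backstep_e.
exists dd; split.
- by move=> i; rewrite size_cat sd sD tw.
- by move=> i e; rewrite (dE i e).2 stE ?size_nseq.
- move=> e g Qg Hg i; rewrite (dE i (e i)).1 stE ?size_nseq //.
  pose v i := (node (letter (w i)) (changepoint w i) n (tab i) 0 (D i.+1)
    (nseq (node_width t) 0) t).1.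
  have X := @truth_ok_cons t s tab v f A Et Ht _ T _ g Qg Hg i.
  apply: X => [j|h Qh Eh j]; first exact: backstep_sub.
  rewrite /v Eh; rewrite Eh in sD rD; apply: (@node_truth _ _ vs w alpha n h tab D) => //.
  + exact: Q_uniform.
  + exact: (children_ok A Qh Eh T).
  + by move=> k; rewrite -Eh -cD.
- have chE k i : chain (t :: s) dd i k = chain s d i k ++ ch i k.
    elim: k i => [|k IHk] i; first by rewrite /= tw nseqD.
    have sc : size (chain s d i.+1 k) = table_width s.
      case: k {IHk} => [|k] /=; first by rewrite size_nseq.
      exact: (size_backstep _ _ _ _ Hs).2.
    rewrite -[LHS]/((step_at (t :: s) i (dd i.+1) (chain (t :: s) dd i.+1 k)).2.2).
    by rewrite IHk stE.
  move=> i; have [K HK] := kd i; have [K' HK'] := HD i; exists (maxn K K') => k.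
  by rewrite geq_max chE => /andP[/HK -> /HK' ->].
Qed.

(* The resets are determined backwards, so a fair sequence [e] is obtained as a
   limit of the sequences that are reset at a late time [N]. *)
Lemma fair_exists s d : adm s -> (forall i, size (d i) = table_width s) ->
  (forall i e, (step_at s i (d i.+1) e).2.1 = d i) ->
  (forall i, exists K, forall k, K <= k -> chain s d i k = d i) ->
  exists e,
  [/\ forall i, size (e i) = table_width s,
      forall i, all (fun x => x < (cap n).+1) (e i),
      infinitely_often (fun i => d i == e i)
    & forall i, (step_at s i (d i.+1) (if d i.+1 == e i.+1 then
        nseq (table_width s) (cap n) else e i.+1)).2.2 = e i].
Proof.
move=> Hs sd cd kd.
pose rs i x := if d i == x then nseq (table_width s) (cap n) else x.
pose bk i x := (step_at s i (d i.+1) x).2.2.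
pose g := fix g i k := if k is k'.+1 then bk i (rs i.+1 (g i.+1 k')) else d i.
pose x N i := g i (N - i).
have xE N i : i < N -> x N i = bk i (rs i.+1 (x N i.+1)).
  by move=> L; rewrite /x; have -> : N - i = (N - i.+1).+1 by lia.
have db i : all (fun x => x < (cap n).+1) (d i).
  by rewrite -(cd i [::]); exact: (backstep_bound _ _ _ _ _).1.
have sx N i : size (x N i) = table_width s /\ all (fun x => x < (cap n).+1) (x N i).
  rewrite /x; case: (N - i) => [|k] /=; first by rewrite sd db.
  by split; [exact: (size_backstep _ _ _ _ Hs).2 | exact: (backstep_bound _ _ _ _ _).2].
(* If there is no reset strictly between [i] and the next reset [j], then [x N i] is the value
   iteration with [j - i] steps. Once [j - i] reaches [K] this is [d i], so [i] itself is a reset.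
   As [K] does not depend on [N], resets survive the passage to the limit. *)
have brk i : exists K, forall N, i + K <= N ->
    exists2 j, i <= j <= i + K & d j == x N j.
  have [K HK] := kd i; exists K => N HN.
  have ex : exists j, (i < j) && ((d j == x N j) || (N < j)).
    by exists (i + K + N).+1; lia.
  case: (ex_minnP ex) => j /andP[Lij Hj] Hmin.
  have [L|L] := leqP j (i + K).
    exists j; first by rewrite ltnW.
    by case/orP: Hj => //; lia.
  have [LN|LN] := leqP j N.
    have Hj' : d j = x N j by case/orP: Hj => [/eqP //|]; lia.
    exists i; first by rewrite leqnn leq_addr.
    suff H k : k <= j - i -> 0 < k -> x N (j - k) = chain s d (j - k) k.
      have Ei : i = j - (j - i) by lia.
      rewrite [in x N i]Ei H ?leqnn //; last by lia.
      by rewrite -Ei HK //; lia.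
    elim: k => // k IHk Hk _; rewrite xE; last by lia.
    have Ej : (j - k.+1).+1 = j - k by lia.
    rewrite /= Ej; case: k IHk Hk Ej => [|k] IHk Hk Ej.
      have R : rs j (x N j) = nseq (table_width s) (cap n) by rewrite /rs Hj' eqxx.
      by rewrite subn0 R /bk Ej subn0.
    rewrite /bk Ej -IHk //; last by lia.
    rewrite /rs; case: ifP => // B; exfalso.
    by have := Hmin (j - k.+1); rewrite B /=; lia.
  have := Hmin N; case: (ltnP i N) => LiN; last first.
    have -> : N = i by lia.
    move=> _; exists i; first by rewrite leqnn leq_addr.
    by have -> : x i i = d i by rewrite /x subnn.
  by rewrite {1}/x subnn eqxx /= => /(_ isT); rewrite leqNgt LN.
have [y Hy] : exists y, forall k m, exists2 N, m <= N & forall i, i < k -> x N i = y i.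
  apply: (@koenig _ (words (cap n).+1 (table_width s))) => N i.
  by have [s1 s2] := sx N i; rewrite mem_words s1 eqxx.
exists y; split.
- by move=> i; have [N _ /(_ i (leqnn _)) <-] := Hy i.+1 0; case: (sx N i).
- by move=> i; have [N _ /(_ i (leqnn _)) <-] := Hy i.+1 0; case: (sx N i).
- move=> i; have [K HK] := brk i; have [N HN EN] := Hy (i + K).+1 (i + K).
  have [j /andP[Hj1 Hj2] Hj] := HK N HN; exists j => //.
  by rewrite -EN.
- move=> i; have [N HN EN] := Hy i.+2 i.+1.
  by rewrite -(EN i) // xE // -(EN i.+1).
Qed.
End Tables.

(** * The Büchi automaton on words *)

Lemma subforms_trans (P : finType) (V : eqType) (phi f g : form P V) :
  f \in subforms phi -> g \in behead (subforms f) -> g \in subforms phi.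
Proof.
have : suffix_closed (subforms phi).
  by rewrite -[subforms phi]cats0; apply: (@suffix_closed_subforms P V).1.
elim: (subforms phi) => //= h l IH /andP[/allP Hh Hl].
rewrite inE => /orP[/eqP ->|Hf] Hg; first by rewrite inE Hh ?orbT.
by rewrite inE IH ?orbT.
Qed.

Section Words.
Variables (P : finType) (V : eqType) (phi : form P V) (z : V) (alpha : V -> nat).
Hypothesis vars_phi : vars phi =i [:: z].

Let n := alpha z.
Let t := dform [:: z] phi.
Let s := undup (code_subs t).1.
Let l := width s.

Variable u : nat.
Hypothesis letter_p :
  forall A : {set option P}, nth false (letter A) u = (None \in A).

Lemma uniform_subforms f : f \in subforms phi -> uniform alpha n f.
Proof.
move=> Hf; case: f Hf => //= r z' g Hg.
  have : z' \in vars phi.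
    rewrite mem_cat; apply/orP; left; rewrite /dia_vars mem_pmap.
    by apply/mapP; exists (DiaLe r z' g).
  by rewrite vars_phi inE => /eqP ->.
have : z' \in vars phi.
  rewrite mem_cat; apply/orP; right; rewrite /box_vars mem_pmap.
  by apply/mapP; exists (BoxLe r z' g).
by rewrite vars_phi inE => /eqP ->.
Qed.

Let Q (f : form P V) : Prop := f \in subforms phi.
Let Q_uniform f : Q f -> uniform alpha n f := @uniform_subforms f.
Let Q_sub f g : Q f -> g \in behead (subforms f) -> Q g := @subforms_trans P V phi f g.

Lemma codes_map : s = undup (map (dform [:: z]) (subforms phi)).
Proof. by rewrite /s /t (@code_subsE P V [:: z]).1. Qed.

Lemma admissible_codes : admissible [:: z] Q s.
Proof.
rewrite codes_map; apply: admissible_undup => //.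
by rewrite -[subforms phi]cats0; apply: (@suffix_closed_subforms P V).1.
Qed.

Lemma width_codes : l = table_width s.
Proof.
have U f : Q f -> uniform (fun=> 0) 0 f by case: f.
by case: (size_backstep (fun=> set0) U [::] false [::] [::] admissible_codes).
Qed.

Lemma phi_code : t \in s.
Proof.
rewrite codes_map mem_undup map_f //.
by case: (phi) => *; rewrite inE eqxx.
Qed.

(** The positions are paid for by the lengths of the regular expressions, the flag by the fact that
    there is at least one subformula. *)
Lemma width_le : 2 * l + 1 <= 2 * fsize phi.
Proof.
have A : l <= \sum_(g <- undup (subforms phi)) own_regex_length g.
  rewrite width_codes /table_width codes_map.
  rewrite sumnE big_map.
  (* Each code is charged to one subformula that has it, and different codes are charged to
     different subformulas. *)
  have H : {subset undup (map (dform [:: z]) (subforms phi)) <=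
            map (dform [:: z]) (undup (subforms phi))}.
    by move=> x; rewrite mem_undup => /mapP [f Hf ->]; rewrite map_f ?mem_undup.
  have := undup_uniq (map (dform [:: z]) (subforms phi)).
  have U f : f \in undup (subforms phi) -> uniform alpha n f.
    by rewrite mem_undup; exact: uniform_subforms.
  elim: (undup (subforms phi)) (undup _) H U => [|f r IH] d H U Ud.
    case: d H {Ud} => [|x d] H; first by rewrite !big_nil.
    by have := H x (mem_head _ _).
  rewrite big_cons.
  have Uf : uniform alpha n f by apply: U; rewrite inE eqxx.
  have {}IH e : {subset e <= map (dform [:: z]) r} -> uniq e ->
      \sum_(x <- e) node_width x <= \sum_(j <- r) own_regex_length j.
    by move=> He Ue; apply: IH => // g Hg; apply: U; rewrite inE Hg orbT.
  have [Hin|Hin] := boolP (dform [:: z] f \in d).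
    rewrite (perm_big _ (perm_to_rem Hin)) big_cons leq_add //.
      exact: (node_width_length [:: z] (fun=> set0) Uf).
    apply: IH; last exact: rem_uniq.
    move=> x; rewrite mem_rem_uniq // inE => /andP[Nx /H].
    by rewrite inE (negPf Nx).
  apply: leq_trans (leq_addl _ _); apply: IH => // x Hx.
  have := H x Hx; rewrite inE => /orP[/eqP E|//].
  by rewrite -E Hx in Hin.
have B : 0 < size (undup (subforms phi)).
  have : phi \in undup (subforms phi).
    by rewrite mem_undup; case: (phi) => *; rewrite inE eqxx.
  by case: (undup _).
by rewrite /fsize; lia.
Qed.

Definition start_word : seq nat := nseq (2 * l + 1) 2.

Definition word_ok (x : seq nat) := x \in words (cap n).+1 (2 * l + 1).

Lemma start_word_ok : word_ok start_word.
Proof.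
by rewrite /word_ok mem_words size_nseq eqxx all_nseq /cap; apply/orP; right; lia.
Qed.

Lemma size_word x : word_ok x -> size x = 2 * l + 1.
Proof. by rewrite /word_ok mem_words => /andP[/eqP]. Qed.

Lemma size_dtable x : word_ok x -> size (dtable l x) = l.
Proof. by move/size_word => E; rewrite size_takel // size_behead E; lia. Qed.

Lemma size_etable x : word_ok x -> size (etable l x) = l.
Proof. by move/size_word => E; rewrite size_drop size_behead E; lia. Qed.

Lemma word_split x : word_ok x -> x = head 0 x :: dtable l x ++ etable l x.
Proof.
move/size_word; rewrite /dtable /etable cat_take_drop.
by case: x => //=; lia.
Qed.

Lemma nba_step_head a x y :
  nba_step u n t s l a x y -> head 0 y = nth false a u.
Proof. by case/andP=> /eqP. Qed.

(** The flag of the source and the letter decide whether there is a changepoint; after that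
    [backstep] computes both tables of the source from the target. *)
Lemma nba_step_inj a x x' y : word_ok x -> word_ok x' ->
  head 0 x != 2 -> head 0 x = head 0 x' ->
  nba_step u n t s l a x y -> nba_step u n t s l a x' y -> x = x'.
Proof.
move=> wx wx' Nx E /andP[_ H] /andP[_ H'].
move: H H'; rewrite /cp_flag -E (negPf Nx) => /andP[/eqP D1 /eqP E1] /andP[/eqP D2 /eqP E2].
by rewrite (word_split wx) (word_split wx') E D1 E1 D2 E2.
Qed.

Section Run.
Variable w : nat -> {set option P}.

Definition run (x : nat -> seq nat) := [/\ x 0 = start_word,
  forall i, word_ok (x i),
  forall i, nba_step u n t s l (letter (w i)) (x i) (x i.+1)
  & infinitely_often (fun i => nba_fin l (x i))].

Lemma run_flag x i : run x -> cp_flag u (letter (w i)) (x i) = changepoint w i.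
Proof.
case=> x0 _ st _; rewrite /cp_flag letter_p; case: i => [|i].
  by rewrite x0 /start_word addn1.
rewrite (nba_step_head (st i)) letter_p /changepoint /=.
by case: (None \in w i); case: (None \in w i.+1).
Qed.

Lemma run_sound x : run x -> sat w alpha phi 0.
Proof.
move=> Rx; have fl i := run_flag i Rx; case: Rx => x0 wx st fin.
have hx i : head 0 (x i.+1) != 2.
  by rewrite (nba_step_head (st i)); case: (nth _ _ _).
pose ee i := etable_reset n l (x i).
pose r i := step_at w n s i (dtable l (x i.+1)) (ee i.+1).
(* Since the initial word stores no tables, position 0 is given the values that the first step
   computes, and it never counts as a reset. *)
pose d i := if i is 0 then (r 0).2.1 else dtable l (x i).
pose e i := if i is 0 then (r 0).2.2 else etable l (x i).
pose e' i := if i is 0 then (r 0).2.2 else ee i.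
pose rz i := (0 < i) && (dtable l (x i) == etable l (x i)).
have rE i : r i = step_at w n s i (d i.+1) (e' i.+1) by [].
have [sr1 sr2] : size (r 0).2.1 = l /\ size (r 0).2.2 = l.
  rewrite width_codes; exact: (size_backstep w Q_uniform _ _ _ _ admissible_codes).
have stE i : (r i).2.1 = d i /\ (r i).2.2 = e i.
  case: i => // i; have /andP[_] := st i.+1; rewrite fl (negPf (hx i)).
  by case/andP=> /eqP E1 /eqP E2; split; [exact: esym E1 | exact: esym E2].
have sd i : size (d i) = l by case: i => // i; rewrite size_dtable.
have se i : size (e i) = l by case: i => // i; rewrite size_etable.
have R1 i : rz i -> e' i = nseq l (cap n) /\ d i = e i.
  by case: i => // i; rewrite /rz /= /ee /etable_reset => H; rewrite H; split=> //; exact/eqP.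
have R2 i : ~~ rz i -> e' i = e i.
  by case: i => // i; rewrite /rz /= /ee /etable_reset => /negPf ->.
have R3 : infinitely_often rz.
  move=> i; have [j Hj /andP[_ Fj]] := fin i.+1; exists j; first exact: ltnW.
  by rewrite /rz Fj (leq_ltn_trans _ Hj).
have T := @backstep_sound P V [:: z] w alpha n Q Q_uniform Q_sub l d e e' rz
  sd se R1 R2 R3 s admissible_codes (undup_uniq _) _ _ _.
have {}T : truth_ok [:: z] w alpha Q s (fun i => (r i).1).
  apply: T; rewrite -?width_codes // => i; rewrite take_oversize ?sd ?se //.
    by case: (stE i).
  by case: (stE i).
apply/(T phi _ phi_code 0).
  by rewrite /Q; case: (phi) => *; rewrite inE eqxx.
have /andP[_] := st 0; rewrite fl x0 /start_word addn1 /=.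
by [].
Qed.

Lemma run_complete : sat w alpha phi 0 -> exists x, run x.
Proof.
move=> Hsat.
have [d [sd cd Td kd]] := @backstep_exists P V [:: z] w alpha n Q Q_uniform Q_sub s
  admissible_codes (undup_uniq _).
have [e [se be fe ce]] := @fair_exists P V [:: z] w alpha n Q Q_uniform s d
  admissible_codes sd cd kd.
have db i : all (fun x => x < (cap n).+1) (d i).
  by rewrite -(cd i [::]); exact: (backstep_bound _ _ _ _ _ _).1.
pose x i := if i is i'.+1 then nat_of_bool (None \in w i') :: d i ++ e i
  else start_word.
have dx i : dtable l (x i.+1) = d i.+1.
  by rewrite /dtable /= take_size_cat // sd width_codes.
have ex i : etable l (x i.+1) = e i.+1.
  by rewrite /etable /= drop_size_cat // sd width_codes.
have wx i : word_ok (x i).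
  case: i => [|i]; first exact: start_word_ok.
  rewrite /word_ok mem_words /= size_cat sd se -width_codes all_cat be db /cap.
  by case: (None \in w i); rewrite !andbT; lia.
have hx i : head 0 (x i.+1) != 2 by rewrite /=; case: (_ \in _).
have flx i : cp_flag u (letter (w i)) (x i) = changepoint w i.
  rewrite /cp_flag letter_p; case: i => [|i].
    by rewrite /x /start_word addn1.
  by rewrite /changepoint /=; case: (None \in w i); case: (None \in w i.+1).
exists x; split=> // [i|i]; last first.
  have [j Hj Ej] := fe i.+1; case: j Hj Ej => // j Hj Ej; exists j.+1; first exact: ltnW.
  by rewrite /nba_fin hx dx ex.
rewrite /nba_step flx letter_p eqxx /= dx.
have -> : etable_reset n l (x i.+1) = if d i.+1 == e i.+1 then
    nseq (table_width s) (cap n) else e i.+1.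
  by rewrite /etable_reset dx ex width_codes.
have := cd i (if d i.+1 == e i.+1 then nseq (table_width s) (cap n) else e i.+1).
have := ce i; rewrite /step_at.
have Tp := Td (fun i => if d i.+1 == e i.+1 then nseq (table_width s) (cap n) else e i.+1) phi _ phi_code i.
move: Tp; rewrite /step_at; set r := backstep _ _ _ _ _ _ => Tp E2 E1.
case: i @r Tp E1 E2 => [|i] r Tp E1 E2.
  rewrite /x /start_word addn1 /=; apply/Tp => //.
  by rewrite /Q; case: (phi) => *; rewrite inE eqxx.
by rewrite (negPf (hx i)) dx ex E1 E2 !eqxx.
Qed.
End Run.
End Words.

(** * Determinization *)

Definition edge (M : seq (seq bool)) (p q : nat) : bool :=
  nth false (nth [::] M p) q.

(* A tracker is a vector indexed by the states: 0 means absent, 1 present, and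
   2 present and known to have visited a final state since the last reset. *)
Definition track (m : nat) (M : seq (seq bool)) (F : seq bool) (v : seq nat) :=
  [seq (if has (fun p => (nth 0 v p == 2) && edge M p q) (iota 0 m) ||
           (has (fun p => (nth 0 v p == 1) && edge M p q) (iota 0 m) &&
            nth false F q) then 2
        else if has (fun p => (nth 0 v p == 1) && edge M p q) (iota 0 m) then 1
        else 0) | q <- iota 0 m].

Definition supp (v : seq nat) : seq bool := [seq 0 < c | c <- v].
Definition live (v : seq nat) : bool := has (fun c => 0 < c) v.
Definition full (v : seq nat) : bool := all (fun c => c != 1) v.
(** A tracker that fires forgets the visits, so the next firing requires new visits to final
    states. *)
Definition relax (v : seq nat) : seq nat :=
  if full v then [seq minn c 1 | c <- v] else v.

Definition keep (im : seq (seq nat)) (j : nat) : bool :=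
  live (nth [::] im j) &&
  ~~ has (fun i => supp (nth [::] im i) == supp (nth [::] im j)) (iota 0 j).

Definition kept (im : seq (seq nat)) : seq (seq nat) :=
  [seq relax (nth [::] im j) | j <- [seq j <- iota 0 (size im) | keep im j]].

Definition single (m q : nat) : seq nat := [seq nat_of_bool (i == q) | i <- iota 0 m].

(** The oldest tracker holds all reachable states. A new tracker is started at each of them whose
    singleton is not tracked already. *)
Definition fresh (m : nat) (ks : seq (seq nat)) : seq (seq nat) :=
  [seq single m q | q <- [seq q <- iota 0 m |
     (0 < nth 0 (head [::] ks) q) &&
     ~~ has (fun v => supp v == supp (single m q)) ks]].

Definition images m M F (st : seq (seq nat)) := [seq track m M F v | v <- st].

Definition slots_step m M F st :=
  kept (images m M F st) ++ fresh m (kept (images m M F st)).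

Definition first_index (L : nat) (B : nat -> bool) (k : nat) : nat :=
  head L [seq j <- iota 0 k | B j].

Definition removed_at L im := first_index L (fun j => ~~ keep im j) (size im).
Definition green_at L im :=
  first_index L (fun j => keep im j && full (nth [::] im j)) (size im).

(* Lower positions take precedence; at equal positions (both are [L]) nothing
   happened. *)
Definition slots_color L (im : seq (seq nat)) : nat :=
  if removed_at L im <= green_at L im then 2 * (L - removed_at L im) + 1
  else 2 * (L - green_at L im).

Lemma first_index_le L (B : pred nat) k j : j < k -> B j -> first_index L B k <= j.
Proof.
rewrite /first_index => Hj Bj.
have -> : iota 0 k = iota 0 j ++ j :: iota j.+1 (k - j.+1).
  by rewrite -{1}(subnKC Hj) addSnnS iotaD.
rewrite filter_cat /= Bj; case E : (filter B (iota 0 j)) => [|x r] //=.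
have : x \in filter B (iota 0 j) by rewrite E mem_head.
by rewrite mem_filter mem_iota /= => /andP[_ /ltnW].
Qed.

Lemma first_index_lt L (B : pred nat) k : first_index L B k < L ->
  first_index L B k < k /\ B (first_index L B k).
Proof.
rewrite /first_index; case E : (filter B (iota 0 k)) => [|x r] /=.
  by rewrite ltnn.
have : x \in filter B (iota 0 k) by rewrite E mem_head.
by rewrite mem_filter mem_iota /= => /andP[-> ->].
Qed.

Lemma nth_supp v q : nth false (supp v) q = (0 < nth 0 v q).
Proof.
have [L|L] := ltnP q (size v); first by rewrite (nth_map 0).
by rewrite !nth_default ?size_map.
Qed.

Lemma supp_relax v : supp (relax v) = supp v.
Proof.
rewrite /relax; case: ifP => // _; rewrite /supp -map_comp.
by apply: eq_map => -[|[|c]].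
Qed.

Lemma live_supp u v : supp u = supp v -> live u = live v.
Proof.
have E x : live x = has id (supp x) by rewrite has_map.
by rewrite !E => ->.
Qed.

Lemma liveP v : reflect (exists q, 0 < nth 0 v q) (live v).
Proof.
apply: (iffP hasP) => [[c /(nthP 0) [q _ <-] H]|[q H]]; first by exists q.
exists (nth 0 v q) => //; apply: mem_nth; rewrite ltnNge; apply/negP => L.
by rewrite nth_default in H.
Qed.

Lemma nth_single m q i : nth 0 (single m q) i = (i < m) && (i == q).
Proof.
have [L|L] := ltnP i m; last by rewrite nth_default ?size_map ?size_iota.
by rewrite (nth_map 0) ?size_iota // nth_iota.
Qed.

(** * Supports of trackers *)

Section Kept.
Variable im : seq (seq nat).

Lemma nth_kept j : j < size im -> keep im j ->
  count (keep im) (iota 0 j) < size (kept im) /\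
  nth [::] (kept im) (count (keep im) (iota 0 j)) = relax (nth [::] im j).
Proof.
move=> Hj Kj; rewrite /kept.
have -> : iota 0 (size im) = iota 0 j ++ j :: iota j.+1 (size im - j.+1).
  by rewrite -{1}(subnKC Hj) addSnnS iotaD.
rewrite filter_cat /= Kj map_cat size_cat nth_cat !size_map size_filter ltnn subnn /=.
by rewrite addnS ltnS leq_addr.
Qed.

Lemma mem_kept v : v \in kept im ->
  exists j, [/\ j < size im, keep im j & v = relax (nth [::] im j)].
Proof.
by case/mapP=> j; rewrite mem_filter mem_iota /= => /andP[K H] ->; exists j.
Qed.

Lemma uniq_supp_kept : uniq (map supp (kept im)).
Proof.
rewrite -map_comp map_inj_in_uniq ?filter_uniq ?iota_uniq // => i j.
rewrite !mem_filter => /andP[/andP[_ Ki] _] /andP[/andP[_ Kj] _] /=.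
rewrite !supp_relax => E.
have [L|L|//] := ltngtP i j.
  by case/hasP: Kj; exists i; rewrite ?mem_iota ?E.
by case/hasP: Ki; exists j; rewrite ?mem_iota ?E.
Qed.

Lemma first_kept j : j < size im -> live (nth [::] im j) ->
  exists i, [/\ i <= j, keep im i & supp (nth [::] im i) = supp (nth [::] im j)].
Proof.
elim: {j}_.+1 {-2}j (ltnSn j) => // k IH j Hk Hj Lj.
case Kj : (keep im j); first by exists j.
move: Kj; rewrite /keep Lj /= => /negbFE/hasP [i]; rewrite mem_iota /= => Hi /eqP E.
have Hik : i < k by exact: leq_trans Hi _.
have Li : live (nth [::] im i) by rewrite (live_supp E).
have [i' [H1 H2 H3]] := IH i Hik (ltn_trans Hi Hj) Li.
by exists i'; split=> //; [lia | rewrite H3].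
Qed.
End Kept.

Lemma mem_fresh m ks v : v \in fresh m ks ->
  exists q, [/\ q < m, v = single m q, 0 < nth 0 (head [::] ks) q &
    forall u, u \in ks -> supp u <> supp (single m q)].
Proof.
case/mapP=> q; rewrite mem_filter mem_iota /= => /andP[/andP[H1 H2] H3] ->.
exists q; split=> // u Hu E; case/hasP: H2; exists u => //; exact/eqP.
Qed.

Lemma single_inj m q q' : q < m -> supp (single m q) = supp (single m q') -> q = q'.
Proof.
move=> H /(congr1 (fun s => nth false s q)); rewrite !nth_supp !nth_single H eqxx /=.
by case: eqP.
Qed.

Lemma uniq_supp_step m ks : uniq (map supp ks) -> uniq (map supp (ks ++ fresh m ks)).
Proof.
move=> U; rewrite map_cat cat_uniq U /=; apply/andP; split.
  apply/hasPn => _ /mapP [v /mem_fresh [q [_ -> _ H]] ->].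
  by apply/mapP => -[u Hu /esym]; exact: H.
rewrite -map_comp map_inj_in_uniq ?filter_uniq ?iota_uniq // => i j.
rewrite !mem_filter !mem_iota /= => /andP[_ Hi] _; exact: single_inj.
Qed.

Definition laminar (u v : seq nat) :=
  [\/ forall q, 0 < nth 0 u q -> 0 < nth 0 v q -> False,
      forall q, 0 < nth 0 u q -> 0 < nth 0 v q
    | forall q, 0 < nth 0 v q -> 0 < nth 0 u q].

Lemma laminar_supp u v u' v' : supp u = supp u' -> supp v = supp v' ->
  laminar u v -> laminar u' v'.
Proof.
move=> Eu Ev; have eu q : (0 < nth 0 u' q) = (0 < nth 0 u q) by rewrite -!nth_supp Eu.
have ev q : (0 < nth 0 v' q) = (0 < nth 0 v q) by rewrite -!nth_supp Ev.
by case=> H; [apply: Or31|apply: Or32|apply: Or33] => q; rewrite eu ev; exact: H.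
Qed.

Lemma laminar_single m q v : laminar (single m q) v /\ laminar v (single m q).
Proof.
have [H|H] := boolP (0 < nth 0 v q).
  by split; [apply: Or32|apply: Or33] => i; rewrite nth_single;
    case: eqP => [->|]; rewrite ?andbF.
by split; apply: Or31 => i; rewrite nth_single; case: eqP => [->|];
  rewrite ?andbF // ?(negPf H).
Qed.

Lemma laminar_count (u v : seq nat) : size u = size v ->
  (forall q, 0 < nth 0 u q -> 0 < nth 0 v q) ->
  count (fun c => 0 < c) u = count (fun c => 0 < c) v -> supp u = supp v.
Proof.
elim: u v => [|x u IH] [|y v] //= [E] H.
have H0 := H 0; have H1 q := H q.+1; rewrite /= in H0 H1.
have L : count (fun c => 0 < c) u <= count (fun c => 0 < c) v.
  elim: u v E H1 {IH H H0} => [|a u IHu] [|b v] //= [E] H.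
  have H0 := H 0; have H1 q := H q.+1; rewrite /= in H0 H1.
  by apply: leq_add; [case: (0 < a) H0 => // -> | exact: IHu].
move=> C; have Exy : (0 < x) = (0 < y).
  by move: C H0; case: (0 < x); case: (0 < y) => //= C H0; [have := H0 isT | lia].
by rewrite Exy (IH v) //; move: C; rewrite Exy => /addnI.
Qed.

(** A member of a laminar family is determined by its least element and its cardinality: sets with a
    common element are nested, and nested sets of the same size coincide. *)
Lemma size_laminar m (st : seq (seq nat)) :
  (forall v, v \in st -> size v = m /\ live v) -> uniq (map supp st) ->
  (forall u v, u \in st -> v \in st -> laminar u v) -> size st <= m * m.
Proof.
move=> S U Lm.
pose f v := (find (fun c : nat => 0 < c) v, (count (fun c : nat => 0 < c) v).-1).
have Us : uniq st by exact: map_uniq U.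
have inj : {in st &, injective f}.
  move=> u v Hu Hv [E1 E2].
  have [su lu] := S u Hu; have [sv lv] := S v Hv.
  have c1 : 0 < count (fun c => 0 < c) u by rewrite -has_count.
  have c2 : 0 < count (fun c => 0 < c) v by rewrite -has_count.
  have E3 : count (fun c => 0 < c) u = count (fun c => 0 < c) v by lia.
  suff E : supp u = supp v.
    move/(nthP [::]): Hu => [i Hi Ei]; move/(nthP [::]): Hv => [j Hj Ej].
    have Es : nth [::] (map supp st) i = nth [::] (map supp st) j.
      by rewrite !(nth_map [::]) // Ei Ej.
    move/eqP: Es; rewrite nth_uniq ?size_map // => /eqP Eij.
    by rewrite -Ei -Ej Eij.
  have n1 := nth_find 0 lu; have n2 := nth_find 0 lv.
  case: (Lm u v Hu Hv) => H.
  - by case: (H _ n1); rewrite E1.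
  - by apply: laminar_count; rewrite ?su ?sv.
  - by apply/esym/laminar_count; rewrite ?su ?sv.
have -> : m * m = size [seq (i, j) | i <- iota 0 m, j <- iota 0 m].
  by rewrite size_allpairs size_iota.
rewrite -(size_map f).
apply: uniq_leq_size; first by rewrite map_inj_in_uniq.
move=> _ /mapP [v Hv ->]; have [sv lv] := S v Hv.
apply/allpairsP; exists (f v); split=> //; rewrite mem_iota /=.
  by rewrite -sv -has_find.
by have := count_size (fun c => 0 < c) v; have := lv; rewrite /live has_count sv; lia.
Qed.

(** * Correctness of the trackers *)

Section Determinization.
Variables (m i0 : nat) (Mt : nat -> seq (seq bool)) (F : seq bool).
Hypothesis i0_lt : i0 < m.

Fixpoint desc (s x k q : nat) : bool :=
  if k is k'.+1 then
    (q < m) && has (fun p => desc s x k' p && edge (Mt (s + k')) p q) (iota 0 m)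
  else q == x.

Definition reach t q := desc 0 i0 t q.

Hypothesis reach_inj : forall t p p' q, reach t p -> reach t p' ->
  edge (Mt t) p q -> edge (Mt t) p' q -> p = p'.

Lemma descE s x k q : desc s x k.+1 q =
  (q < m) && has (fun p => desc s x k p && edge (Mt (s + k)) p q) (iota 0 m).
Proof. by []. Qed.

Lemma descS s x k q : reflect
  (exists p, [/\ p < m, q < m, desc s x k p & edge (Mt (s + k)) p q])
  (desc s x k.+1 q).
Proof.
rewrite descE; apply: (iffP andP) => [[Hq /hasP [p]]|[p [H1 H2 H3 H4]]].
  by rewrite mem_iota /= => Hp /andP[H1 H2]; exists p.
by split=> //; apply/hasP; exists p; rewrite ?mem_iota ?H3 ?H4.
Qed.

Lemma desc_lt s x k q : x < m -> desc s x k q -> q < m.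
Proof. by case: k => [|k] Hx; [move/eqP=> -> | rewrite descE => /andP[]]. Qed.

Lemma desc_trans s x j p k q :
  desc s x j p -> desc (s + j) p k q -> desc s x (j + k) q.
Proof.
move=> H; elim: k q => [|k IH] q; first by move/eqP ->; rewrite addn0.
case/descS=> r [H1 H2 H3 H4]; rewrite addnS; apply/descS; exists r; split=> //.
  exact: IH.
by rewrite addnA.
Qed.

Lemma desc_split s x j k q : desc s x (j + k) q ->
  exists p, desc s x j p /\ desc (s + j) p k q.
Proof.
elim: k q => [|k IH] q; first by rewrite addn0 => H; exists q; rewrite /= eqxx.
rewrite addnS => /descS [r [H1 H2 /IH [p [H3 H4]] H5]].
exists p; split=> //; apply/descS; exists r; split=> //.
by rewrite -addnA.
Qed.

Lemma reach_lt t q : reach t q -> q < m.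
Proof. exact: desc_lt. Qed.

Lemma reach_trans t p k q : reach t p -> desc t p k q -> reach (t + k) q.
Proof. exact: (@desc_trans 0 i0 t p k q). Qed.

Lemma desc_inj t p p' k q : reach t p -> reach t p' ->
  desc t p k q -> desc t p' k q -> p = p'.
Proof.
move=> Rp Rp'; elim: k q => [|k IH] q; first by move=> /eqP <- /eqP ->.
case/descS=> r [_ _ H3 H4] /descS [r' [_ _ H3' H4']].
have E := reach_inj (reach_trans Rp H3) (reach_trans Rp' H3') H4 H4'.
by rewrite -E in H3'; exact: IH H3 H3'.
Qed.

Fixpoint slots t : seq (seq nat) :=
  if t is t'.+1 then slots_step m (Mt t') F (slots t') else [:: single m i0].

Local Notation im t := (images m (Mt t) F (slots t)).
Local Notation slot t j := (nth [::] (slots t) j).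

Definition bounded (v : seq nat) := all (fun c => c <= 2) v.

Lemma nth_image M v q : q < m -> nth 0 (track m M F v) q =
  if has (fun p => (nth 0 v p == 2) && edge M p q) (iota 0 m) ||
     (has (fun p => (nth 0 v p == 1) && edge M p q) (iota 0 m) &&
      nth false F q) then 2
  else if has (fun p => (nth 0 v p == 1) && edge M p q) (iota 0 m) then 1
  else 0.
Proof. by move=> H; rewrite (nth_map 0) ?size_iota // nth_iota. Qed.

Lemma bounded_nth v q : bounded v -> nth 0 v q <= 2.
Proof.
move=> /allP H; have [L|L] := ltnP q (size v); first by apply/H/mem_nth.
by rewrite nth_default.
Qed.

Lemma size_image M v : size (track m M F v) = m.
Proof. by rewrite size_map size_iota. Qed.

Lemma bounded_image M v : bounded (track m M F v).
Proof. by apply/allP => c /mapP [q _ ->]; case: ifP => // _; case: ifP. Qed.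

Lemma image_pos M v q : bounded v -> 0 < nth 0 (track m M F v) q <->
  exists p, [/\ p < m, q < m, 0 < nth 0 v p & edge M p q].
Proof.
move=> B; split=> [H|[p [H1 H2 H3 H4]]].
  have Hq : q < m.
    by rewrite ltnNge; apply/negP => L; rewrite nth_default ?size_image in H.
  move: H; rewrite nth_image //; case: ifP => [/orP[/hasP|/andP[/hasP]]|_].
  - by case=> p; rewrite mem_iota /= => Hp /andP[/eqP E H] _; exists p; rewrite E.
  - by case=> p; rewrite mem_iota /= => Hp /andP[/eqP E H] _; exists p; rewrite E.
  - case: ifP => // /hasP [p]; rewrite mem_iota /= => Hp /andP[/eqP E H] _.
    by exists p; rewrite E.
rewrite nth_image //; case: ifP => // /norP[N1 _]; case: ifP => // N2.
have := bounded_nth p B; case E : (nth 0 v p) H3 => [|[|[|c]]] // _ _.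
  by case/hasP: N2; exists p; rewrite ?mem_iota ?E.
by case/hasP: N1; exists p; rewrite ?mem_iota ?E.
Qed.

Lemma size_relax v : size (relax v) = size v.
Proof. by rewrite /relax; case: ifP; rewrite ?size_map. Qed.

Lemma bounded_relax v : bounded v -> bounded (relax v).
Proof.
rewrite /relax; case: ifP => // _ _; apply/allP => c /mapP [b _ ->].
by rewrite geq_min orbT.
Qed.

Lemma relax_pos v q : (0 < nth 0 (relax v) q) = (0 < nth 0 v q).
Proof. by rewrite -!nth_supp supp_relax. Qed.

Definition slots_ok t (s : seq (seq nat)) :=
  [/\ forall v, v \in s -> [/\ size v = m, bounded v & live v],
      uniq (map supp s),
      forall u v, u \in s -> v \in s -> laminar u v,
      forall v, v \in s -> forall q, 0 < nth 0 v q -> reach t q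
    & forall q, reach t q -> 0 < nth 0 (head [::] s) q].

Lemma bounded_single q : bounded (single m q).
Proof. by apply/allP => c /mapP [i _ ->]; case: (_ == _). Qed.

Lemma live_single q : q < m -> live (single m q).
Proof. by move=> H; apply/liveP; exists q; rewrite nth_single H eqxx. Qed.

(** Images preserve inclusion and, because reachable predecessors are unique, disjointness, so the
    supports stay laminar. The oldest tracker cannot be removed as a duplicate and is live as long
    as some state is reachable, which keeps it equal to the set of reachable states. *)
Lemma slots_inv t : slots_ok t (slots t).
Proof.
elim: t => [|t [I1 I2 I3 I4 I5]].
  split=> //= [v|u v|v|q].
  - by rewrite inE => /eqP ->; rewrite size_map size_iota bounded_single live_single.
  - by rewrite !inE => /eqP -> _; exact: (laminar_single m i0 v).1.
  - by rewrite inE => /eqP -> q; rewrite nth_single /reach /=; case: eqP; rewrite ?andbF.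
  - by rewrite /reach /= => /eqP ->; rewrite nth_single i0_lt eqxx.
have imE j : j < size (im t) -> exists2 u, u \in slots t &
    nth [::] (im t) j = track m (Mt t) F u.
  by rewrite size_map => Hj; exists (slot t j); rewrite ?mem_nth // (nth_map [::]).
have kE v : v \in kept (im t) -> exists u, [/\ u \in slots t,
    v = relax (track m (Mt t) F u) & live v].
  case/mem_kept=> j [Hj /andP[Lj _] ->]; have [u Hu E] := imE j Hj.
  exists u; rewrite -E; split=> //.
  by rewrite (live_supp (v := nth [::] (im t) j)) ?supp_relax.
have memE v : v \in slots t.+1 -> v \in kept (im t) \/ exists q, [/\ q < m,
    v = single m q & 0 < nth 0 (head [::] (kept (im t))) q].
  rewrite /= mem_cat => /orP[|/mem_fresh [q [H1 H2 H3 _]]]; first by left.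
  by right; exists q.
have kR v q : v \in kept (im t) -> 0 < nth 0 v q -> reach t.+1 q.
  case/kE=> u [Hu -> _]; rewrite relax_pos.
  have [_ Bu _] := I1 u Hu.
  case/(image_pos _ _ Bu)=> p [H1 H2 H3 H4]; apply/descS; exists p; split=> //.
  exact: I4 Hu _ H3.
have hk q : 0 < nth 0 (head [::] (kept (im t))) q -> reach t.+1 q.
  case E : (kept (im t)) => [|v r] /=; first by rewrite nth_nil.
  by apply: kR; rewrite E mem_head.
split.
- move=> v /memE [/kE [u [_ -> Lv]]|[q [Hq -> _]]].
    by rewrite size_relax size_image bounded_relax // bounded_image.
  by rewrite size_map size_iota bounded_single live_single.
- by apply: uniq_supp_step; exact: uniq_supp_kept.
- move=> u v /memE [Hu|[q [_ -> _]]]; last by move=> _; exact: (laminar_single m q v).1.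
  move=> /memE [Hv|[q [_ -> _]]]; last exact: (laminar_single m q u).2.
  have [u' [Hu' -> _]] := kE u Hu; have [v' [Hv' -> _]] := kE v Hv.
  apply: laminar_supp (esym (supp_relax _)) (esym (supp_relax _)) _.
  have [_ Bu _] := I1 u' Hu'; have [_ Bv _] := I1 v' Hv'.
  case: (I3 u' v' Hu' Hv') => H.
  + apply: Or31 => q /(image_pos _ _ Bu) [p [_ _ H3 H4]].
    move=> /(image_pos _ _ Bv) [p' [_ _ H3' H4']].
    have E := reach_inj (I4 _ Hu' _ H3) (I4 _ Hv' _ H3') H4 H4'.
    by rewrite -E in H3'; exact: H H3 H3'.
  + apply: Or32 => q /(image_pos _ _ Bu) [p [H1 H2 H3 H4]].
    by apply/(image_pos _ _ Bv); exists p; split=> //; exact: H.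
  + apply: Or33 => q /(image_pos _ _ Bv) [p [H1 H2 H3 H4]].
    by apply/(image_pos _ _ Bu); exists p; split=> //; exact: H.
- move=> v /memE [Hv q|[q [Hq -> Rq]] q']; first exact: kR.
  by rewrite nth_single; case: eqP => [->|]; rewrite ?andbF // => _; exact: hk.
- move=> q /descS [p [H1 H2 /I5 H3 H4]].
  case Es : (slots t) I1 H3 => [|v r] I1 H3; first by rewrite /= nth_nil in H3.
  have [_ Bv _] := I1 v (mem_head _ _).
  have Pq : 0 < nth 0 (track m (Mt t) F v) q by apply/(image_pos _ _ Bv); exists p.
  have S0 : 0 < size (im t) by rewrite Es.
  have K0 : keep (im t) 0.
    by rewrite /keep /= andbT Es /=; apply/liveP; exists q.
  have [/= N1 N2] := nth_kept S0 K0; move: N1 N2; rewrite /= /slots_step.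
  case: (kept (im t)) => [|k0 ks] //= _ ->.
  by rewrite relax_pos Es.
Qed.

Lemma size_slots t : size (slots t) <= m * m.
Proof.
have [I1 I2 I3 _ _] := slots_inv t; apply: size_laminar => // v /I1 [-> _ ->] //.
Qed.

Lemma slot_next t j : j < size (slots t) -> keep (im t) j ->
  count (keep (im t)) (iota 0 j) < size (slots t.+1) /\
  slot t.+1 (count (keep (im t)) (iota 0 j)) = relax (track m (Mt t) F (slot t j)).
Proof.
move=> Hj Kj; have [|N1 N2] := @nth_kept (im t) j _ Kj; first by rewrite size_map.
rewrite /= /slots_step size_cat nth_cat N1 N2 (nth_map [::]) //; split=> //.
exact: leq_trans N1 (leq_addr _ _).
Qed.

Lemma slot_next_steady t p :
  (forall j, j <= p -> j < size (slots t) -> keep (im t) j) ->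
  p < size (slots t) ->
  p < size (slots t.+1) /\ slot t.+1 p = relax (track m (Mt t) F (slot t p)).
Proof.
move=> H Hp; have := slot_next Hp (H p (leqnn _) Hp).
suff -> : count (keep (im t)) (iota 0 p) = p by [].
rewrite -[RHS](size_iota 0) -size_filter; congr size; apply/all_filterP/allP => j.
by rewrite mem_iota /= => Hj; apply: H; [exact: ltnW | exact: ltn_trans Hj Hp].
Qed.

Definition steady p T := forall t, T <= t ->
  forall j, j <= p -> j < size (slots t) -> keep (im t) j.

Definition green p := infinitely_often (fun t =>
  [&& p < size (slots t), keep (im t) p & full (nth [::] (im t) p)]).

Lemma reach_path t q : reach t q -> exists x, [/\ x 0 = i0, x t = q,
  forall i, x i < m & forall i, i < t -> edge (Mt i) (x i) (x i.+1)].
Proof.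
elim: t q => [|t IH] q.
  by rewrite /reach /= => /eqP ->; exists (fun=> i0).
case/descS=> p [H1 H2 /IH [x [E1 E2 E3 E4]] H4].
exists (fun i => if i <= t then x i else q); split=> [|||i Hi].
- by rewrite leq0n.
- by rewrite ltnn.
- by move=> i; case: ifP.
- rewrite ltnS in Hi; rewrite Hi; case: ltnP => L; first exact: E4.
  have -> : i = t by lia.
  by rewrite E2.
Qed.

(** König's lemma gives a run that stays in the tracker. Its marks are inherited along the run
    alone, since predecessors are unique. A firing sets the mark to 1 and the next one requires 2,
    which it can only become at a final state. *)
Lemma det_sound p T : steady p T -> green p -> exists y,
  [/\ y 0 = i0, forall i, y i < m, forall i, edge (Mt i) (y i) (y i.+1)
    & infinitely_often (fun i => nth false F (y i))].
Proof.
move=> St Gr; have [T1 HT /and3P[Hp1 _ _]] := Gr T.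
have alive k : p < size (slots (T1 + k)).
  elim: k => [|k IH]; first by rewrite addn0.
  rewrite addnS; apply: (slot_next_steady _ IH).1 => j.
  by apply: St; rewrite (leq_trans HT) ?leq_addr.
pose v k := slot (T1 + k) p.
have vE k : v k.+1 = relax (track m (Mt (T1 + k)) F (v k)).
  rewrite /v addnS; apply: (slot_next_steady _ (alive k)).2 => j.
  by apply: St; rewrite (leq_trans HT) ?leq_addr.
have vm k : v k \in slots (T1 + k) by exact: mem_nth.
have vok k : [/\ size (v k) = m, bounded (v k) & live (v k)].
  by have [I1 _ _ _ _] := slots_inv (T1 + k); exact: I1.
have vR k q : 0 < nth 0 (v k) q -> reach (T1 + k) q.
  by have [_ _ _ I4 _] := slots_inv (T1 + k); apply: I4.
have back k q : 0 < nth 0 (v k) q -> exists x,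
    [/\ x 0 = i0, x (T1 + k) = q, forall i, x i < m,
     forall i, i < T1 + k -> edge (Mt i) (x i) (x i.+1)
     & forall i, i <= k -> 0 < nth 0 (v i) (x (T1 + i))].
  elim: k q => [|k IH] q Hq.
    have [x [E1 E2 E3 E4]] := reach_path (vR _ _ Hq).
    by exists x; split=> // i; rewrite leqn0 => /eqP ->; rewrite E2.
  move: (Hq); rewrite vE relax_pos; have [_ Bv _] := vok k.
  case/(image_pos _ _ Bv)=> r [Hr Hqm Pr Er].
  have [x [E1 E2 E3 E4 E5]] := IH r Pr.
  exists (fun i => if i <= T1 + k then x i else q); split=> [|||i Hi|i Hi].
  - by rewrite leq0n.
  - by rewrite addnS ltnn.
  - by move=> i; case: ifP.
  - rewrite addnS ltnS in Hi; rewrite Hi; case: ltnP => L; first exact: E4.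
    have -> : i = T1 + k by lia.
    by rewrite E2.
  - rewrite leq_add2l; case: ifP => L; first exact: E5.
    by have -> : i = k.+1 by lia.
have ex N : exists x : nat -> nat, [/\ x 0 = i0, forall i, x i < m,
     forall i, i < T1 + N -> edge (Mt i) (x i) (x i.+1)
     & forall i, i <= N -> 0 < nth 0 (v i) (x (T1 + i))].
  have [_ _ /liveP [q Hq]] := vok N; have [x [E1 E2 E3 E4 E5]] := back N q Hq.
  by exists x.
pose x N := sval (constructive_indefinite_description _ (ex N)).
have xP N : [/\ x N 0 = i0, forall i, x N i < m,
     forall i, i < T1 + N -> edge (Mt i) (x N i) (x N i.+1)
     & forall i, i <= N -> 0 < nth 0 (v i) (x N (T1 + i))].
  by rewrite /x; case: constructive_indefinite_description.
have [y Hy] := @koenig _ (iota 0 m) x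
  (fun N i => ltac:(rewrite mem_iota /=; by case: (xP N))).
have y0 : y 0 = i0.
  by have [N _ /(_ 0 isT) <-] := Hy 1 0; case: (xP N).
have ym i : y i < m.
  by have [N _ /(_ i (leqnn _)) <-] := Hy i.+1 0; case: (xP N).
have ye i : edge (Mt i) (y i) (y i.+1).
  have [N HN E] := Hy i.+2 i.+1; rewrite -(E i) // -(E i.+1) //.
  by case: (xP N) => _ _ H _; apply: H; rewrite (leq_trans HN) ?leq_addl.
have yv k : 0 < nth 0 (v k) (y (T1 + k)).
  have [N HN E] := Hy (T1 + k).+1 k; rewrite -(E (T1 + k)) //.
  by case: (xP N) => _ _ _ H; exact: H.
exists y; split=> // a.
have [t1 H1 /and3P[_ _ G1]] := Gr (T1 + a).
have [t2 H2 /and3P[_ _ G2]] := Gr t1.+1.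
pose k1 := t1 - T1; pose k2 := t2 - T1.
have e1 : t1 = T1 + k1 by rewrite /k1; lia.
have e2 : t2 = T1 + k2 by rewrite /k2; lia.
have fullE t k : t = T1 + k -> full (nth [::] (im t) p) ->
    full (track m (Mt (T1 + k)) F (v k)).
  by move=> ->; rewrite (nth_map [::]).
have {}G1 := fullE _ _ e1 G1; have {}G2 := fullE _ _ e2 G2.
case: (excluded_middle_informative (exists2 j, a <= j & nth false F (y j))) => // N.
exfalso.
have noF j : a <= j -> nth false F (y j) = false.
  by move=> Hj; apply/negP => H; apply: N; exists j.
(* Assuming no final state from time [a] on, the mark of the run remains 1 after the firing at [k1],
   which contradicts the one at [k2]. *)
have ones k : k1 < k -> k <= k2 -> nth 0 (v k) (y (T1 + k)) = 1.
  elim: k => // k IH; rewrite ltnS leq_eqVlt => /orP[/eqP <-|Lk] Hk2.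
    have := yv k1.+1; rewrite vE /relax G1.
    rewrite (nth_map 0) ?size_image; last exact: ym.
    by case: (nth _ _ _) => [|[|c]]; rewrite ?minnE //=; lia.
  have I := IH Lk (ltnW Hk2).
  have X : nth 0 (track m (Mt (T1 + k)) F (v k)) (y (T1 + k.+1)) = 1.
    rewrite nth_image ?ym // addnS noF ?andbF ?orbF; last by lia.
    have -> : has (fun q => (nth 0 (v k) q == 2) &&
        edge (Mt (T1 + k)) q (y (T1 + k).+1)) (iota 0 m) = false.
      apply/negP => /hasP [q]; rewrite mem_iota /= => Hq /andP[/eqP E Ed].
      have Eq := reach_inj (vR k q _) (vR k _ (yv k)) Ed (ye _).
      by move: I; rewrite -Eq ?E.
    have -> // : has (fun q => (nth 0 (v k) q == 1) &&
        edge (Mt (T1 + k)) q (y (T1 + k).+1)) (iota 0 m).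
    by apply/hasP; exists (y (T1 + k)); rewrite ?mem_iota ?ym // I eqxx ye.
  rewrite vE /relax; case: ifP => // _.
  by rewrite (nth_map 0) ?size_image ?X.
have L12 : k1 < k2 by rewrite /k1 /k2; lia.
have I := ones k2 L12 (leqnn _).
have X : nth 0 (track m (Mt (T1 + k2)) F (v k2)) (y (T1 + k2).+1) = 1.
  rewrite nth_image ?ym // noF ?andbF ?orbF; last by lia.
  have -> : has (fun q => (nth 0 (v k2) q == 2) &&
      edge (Mt (T1 + k2)) q (y (T1 + k2).+1)) (iota 0 m) = false.
    apply/negP => /hasP [q]; rewrite mem_iota /= => Hq /andP[/eqP E Ed].
    have Eq := reach_inj (vR k2 q _) (vR k2 _ (yv k2)) Ed (ye _).
    by move: I; rewrite -Eq ?E.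
  have -> // : has (fun q => (nth 0 (v k2) q == 1) &&
      edge (Mt (T1 + k2)) q (y (T1 + k2).+1)) (iota 0 m).
  by apply/hasP; exists (y (T1 + k2)); rewrite ?mem_iota ?ym // I eqxx ye.
move/allP: G2 => /(_ 1); rewrite -X => /(_ _)/negP; apply=> //.
by apply: mem_nth; rewrite size_image.
Qed.

Definition immortal t x := forall k, exists q, desc t x k q.

(** Otherwise each of the finitely many descendants after [k] steps dies out, and the largest of
    their lifetimes bounds that of [z]. *)
Lemma immortal_step t z k : immortal t z ->
  exists z', desc t z k z' /\ immortal (t + k) z'.
Proof.
move=> H; apply: NNPP => /not_ex_all_not N.
have bad q : exists K, desc t z k q -> forall r, ~~ desc (t + k) q K r.
  case D : (desc t z k q); last by exists 0.
  have : ~ immortal (t + k) q by move=> I; apply: (N q); split.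
  move=> /not_all_ex_not [K HK]; exists K => _ r; apply/negP => Hr.
  by apply: HK; exists r.
(* For [k = 0] the only descendant is [z] itself, which need not be below [m]; so it is listed
   separately. *)
have [K HK] : exists K, forall q, q \in z :: iota 0 m -> desc t z k q ->
    forall r, ~~ desc (t + k) q K r.
  elim: (z :: _) => [|q s [K HK]]; first by exists 0.
  have [K' HK'] := bad q.
  have up a b q' r : a <= b -> desc (t + k) q' b r -> exists r', desc (t + k) q' a r'.
    by move=> /subnKC <- /desc_split [r' [Hr _]]; exists r'.
  exists (maxn K K') => q'; rewrite inE => /orP[/eqP ->|Hq'] D r; apply/negP.
    by move/(up K' _ _ _ (leq_maxr _ _)) => [r' Hr']; move/negP: (HK' D r'); apply.
  by move/(up K _ _ _ (leq_maxl _ _)) => [r' Hr']; move/negP: (HK q' Hq' D r'); apply.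
have [r /desc_split [q [Hq Hr]]] := H (k + K).
have Hin : q \in z :: iota 0 m.
  rewrite inE mem_iota /=; case: k Hq {N bad HK Hr} => [|k]; first by rewrite /= => ->.
  by case/andP=> ->; rewrite orbT.
by move/negP: (HK q Hin Hq r); apply.
Qed.

Section Complete.
Variable y : nat -> nat.
Hypotheses (y0 : y 0 = i0) (ym : forall i, y i < m).
Hypothesis ye : forall i, edge (Mt i) (y i) (y i.+1).
Hypothesis yF : infinitely_often (fun i => nth false F (y i)).

Lemma y_desc s k : desc s (y s) k (y (s + k)).
Proof.
elim: k => [|k IH]; first by rewrite addn0 /=.
by rewrite addnS; apply/descS; exists (y (s + k)).
Qed.

Lemma y_reach t : reach t (y t).
Proof. by rewrite /reach -y0; exact: (y_desc 0 t). Qed.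

(* Each branching off of an immortal state yields one more immortal state at
   all later times, and there are at most [m] of them. *)
Lemma eventually_alone : exists s, forall k x,
  desc s (y s) k x -> immortal (s + k) x -> x = y (s + k).
Proof.
apply: NNPP => /not_ex_all_not N.
have bad s : exists k x, [/\ desc s (y s) k x, immortal (s + k) x & x <> y (s + k)].
  have := N s => /not_all_ex_not [k /not_all_ex_not [x H]]; exists k, x.
  have [H1 H2] := imply_to_and _ _ H; have [H3 H4] := imply_to_and _ _ H2.
  by split.
have many b : exists T ls, [/\ size ls = b, uniq ls & forall x, x \in ls ->
    [/\ reach T x, immortal T x & x <> y T]].
  elim: b => [|b [T [ls [E U H]]]]; first by exists 0, [::].
  have [k [x [Dx Ix Nx]]] := bad T.
  pose f z := if excluded_middle_informative (immortal T z) is left Him then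
    sval (constructive_indefinite_description _ (immortal_step k Him)) else 0.
  have fP z : z \in ls -> desc T z k (f z) /\ immortal (T + k) (f z).
    case/H=> _ I _; rewrite /f; case: excluded_middle_informative => // I'.
    by case: constructive_indefinite_description.
  exists (T + k), (x :: map f ls); split.
  - by rewrite /= size_map E.
  - rewrite /= map_inj_in_uniq ?U ?andbT.
      apply/mapP => -[z Hz Ex]; have [Rz _ Nz] := H z Hz.
      have [Dz _] := fP z Hz; rewrite -Ex in Dz.
      exact: (Nz (desc_inj Rz (y_reach T) Dz Dx)).
    move=> z z' Hz Hz' Ef; have [Rz _ _] := H z Hz; have [Rz' _ _] := H z' Hz'.
    have [Dz _] := fP z Hz; have [Dz' _] := fP z' Hz'; rewrite -Ef in Dz'.
    exact: desc_inj Rz Rz' Dz Dz'.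
  - move=> q; rewrite inE => /orP[/eqP ->|/mapP [z Hz ->]].
      by split=> //; exact: reach_trans (y_reach T) Dx.
    have [Dz Iz] := fP z Hz; have [Rz _ Nz] := H z Hz; split=> //.
      exact: reach_trans Rz Dz.
    by move=> Ez; rewrite Ez in Dz; exact: (Nz (desc_inj Rz (y_reach T) Dz (y_desc T k))).
have [T [ls [E U H]]] := many m.+1.
have : size ls <= size (iota 0 m).
  by apply: uniq_leq_size => // x /H [/reach_lt Hx _ _]; rewrite mem_iota.
by rewrite E size_iota ltnn.
Qed.

Definition branch s k := [seq desc s (y s) k q | q <- iota 0 m].

Lemma nth_branch s k q : nth false (branch s k) q = desc s (y s) k q.
Proof.
have [L|L] := ltnP q m; first by rewrite (nth_map 0) ?size_iota // nth_iota.
rewrite nth_default ?size_map ?size_iota //; apply/esym/negP => /(desc_lt (ym s)).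
by rewrite ltnNge L.
Qed.

Lemma supp_branch s k v : size v = m ->
  (forall q, (0 < nth 0 v q) = desc s (y s) k q) -> supp v = branch s k.
Proof.
move=> E H; apply: (@eq_from_nth _ false); first by rewrite !size_map size_iota.
by move=> q _; rewrite nth_supp nth_branch.
Qed.

Lemma branch_image s k v : bounded v -> supp v = branch s k ->
  supp (track m (Mt (s + k)) F v) = branch s k.+1.
Proof.
move=> B E; have Ev q : (0 < nth 0 v q) = desc s (y s) k q by rewrite -nth_supp E nth_branch.
apply: supp_branch; first exact: size_image.
move=> q; apply/idP/idP => [/(image_pos _ _ B) [p [H1 H2 H3 H4]]|].
  by apply/descS; exists p; rewrite -Ev.
case/descS=> p [H1 H2 H3 H4]; apply/(image_pos _ _ B); exists p.
by rewrite Ev.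
Qed.

(** The step into a positive time has just ensured that the singleton of [y s] is tracked. Later the
    tracker of the branch can only give way to an older one with the same support. *)
Lemma branch_slot s k : 0 < s -> exists2 j, j < size (slots (s + k)) &
  supp (slot (s + k) j) = branch s k.
Proof.
move=> Hs; elim: k => [|k [j Hj Ej]].
  rewrite addn0; case: s Hs => // s _.
  set ks := kept (im s); have yh : 0 < nth 0 (head [::] ks) (y s.+1).
    have [_ _ _ _ /(_ _ (y_reach s.+1))] := slots_inv s.+1.
    have fr0 : fresh m [::] = [::].
      by rewrite /fresh (eq_filter (a2 := pred0)) ?filter_pred0 // => q; rewrite nth_nil.
    by rewrite -[slots s.+1]/(ks ++ fresh m ks); case: (ks) => //; rewrite fr0.
  have sE : supp (single m (y s.+1)) = branch s.+1 0.
    apply: supp_branch; first by rewrite size_map size_iota.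
    move=> q; rewrite nth_single /=; case: eqP => [->|]; rewrite ?ym ?andbF //.
  have [/hasP [v Hv /eqP Ev]|Hn] := boolP (has (fun v => supp v == supp (single m (y s.+1))) ks).
    have Hv' : v \in slots s.+1 by rewrite /= mem_cat Hv.
    by exists (index v (slots s.+1)); rewrite ?index_mem // nth_index // Ev.
  have Hv' : single m (y s.+1) \in slots s.+1.
    rewrite /= mem_cat; apply/orP; right; apply: map_f.
    by rewrite mem_filter yh Hn mem_iota ym.
  by exists (index (single m (y s.+1)) (slots s.+1)); rewrite ?index_mem // nth_index.
have [I1 _ _ _ _] := slots_inv (s + k).
have [sv Bv _] := I1 _ (mem_nth [::] Hj).
have Ei := branch_image Bv Ej.
have Lj : live (nth [::] (im (s + k)) j).
  rewrite (nth_map [::]) //; apply/liveP; exists (y (s + k.+1)).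
  by rewrite -nth_supp Ei nth_branch y_desc.
have [|i [Hi Ki Es]] := first_kept _ Lj; first by rewrite size_map.
have Hi' : i < size (slots (s + k)) by exact: leq_ltn_trans Hi Hj.
have [N1 N2] := slot_next Hi' Ki; rewrite addnS.
exists (count (keep (im (s + k))) (iota 0 i)) => //; rewrite N2 supp_relax.
by rewrite -(nth_map [::] [::]) // Es (nth_map [::]).
Qed.

(** The index of the tracker whose support is the branch never increases, hence settles, and it can
    settle only if nothing at or before it is removed any more. This tracker keeps firing: after a
    visit of [y] to a final state all descendants of that state are marked 2, while the other
    members of the branch are mortal and leave no descendants after a bounded time. *)
Lemma det_complete : exists p T, steady p T /\ green p.
Proof.
(* The time is shifted by one because [branch_slot] relies on a preceding step. *)
have [s0 Hs0] := eventually_alone; pose s := s0.+1.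
have Hs k x : desc s (y s) k x -> immortal (s + k) x -> x = y (s + k).
  have E : s = s0 + 1 by rewrite addn1.
  move=> D; have D0 : desc s0 (y s0) (1 + k) x.
    by apply: (@desc_trans _ _ 1 (y s)); [rewrite E; exact: y_desc | rewrite -E].
  by rewrite E -addnA; exact: Hs0 D0.
pose J k := index (branch s k) (map supp (slots (s + k))).
have Jin k : J k < size (slots (s + k)).
  have [j Hj Ej] := @branch_slot s k isT; rewrite /J -[X in _ < X](size_map supp).
  by rewrite index_mem; apply/(nthP [::]); exists j; rewrite ?size_map // (nth_map [::]).
have JE k : supp (slot (s + k) (J k)) = branch s k.
  rewrite -(nth_map [::] [::]) // nth_index // -index_mem size_map; exact: Jin.
have Jeq k j : j < size (slots (s + k)) -> supp (slot (s + k) j) = branch s k -> J k = j.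
  move=> Hj Ej; have [_ I2 _ _ _] := slots_inv (s + k).
  by rewrite /J -Ej -(nth_map [::] [::]) // index_uniq ?size_map.
have ok k : [/\ size (slot (s + k) (J k)) = m, bounded (slot (s + k) (J k)) & live (slot (s + k) (J k))].
  by have [I1 _ _ _ _] := slots_inv (s + k); apply/I1/mem_nth.
have next k : exists i, [/\ i <= J k, keep (im (s + k)) i,
    J k.+1 = count (keep (im (s + k))) (iota 0 i) &
    supp (nth [::] (im (s + k)) i) = supp (nth [::] (im (s + k)) (J k))].
  have [_ Bv _] := ok k; have Ei := branch_image Bv (JE k).
  have Lj : live (nth [::] (im (s + k)) (J k)).
    rewrite (nth_map [::]) //; apply/liveP; exists (y (s + k.+1)).
    by rewrite -nth_supp Ei nth_branch y_desc.
  have [|i [Hi Ki Es]] := first_kept _ Lj; first by rewrite size_map.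
  have Hi' : i < size (slots (s + k)) by exact: leq_ltn_trans Hi (Jin k).
  have [N1 N2] := slot_next Hi' Ki.
  exists i; split=> //; apply: Jeq; rewrite addnS // N2 supp_relax.
  by rewrite -(nth_map [::] [::]) // Es (nth_map [::]).
have cle k i : count (keep (im (s + k))) (iota 0 i) <= i.
  by rewrite -{2}(size_iota 0 i) count_size.
have [K HK] : exists K, forall k, K <= k -> J k = J K.
  apply: nonincreasing_stable => k; have [i [Hi _ -> _]] := next k.
  exact: leq_trans (cle k i) Hi.
pose p := J K.
have keepall k : K <= k -> forall j, j <= p -> keep (im (s + k)) j.
  move=> Hk; have [i [Hi Ki Ec _]] := next k.
  move: Hi Ec; rewrite !HK //; last exact: leqW.
  rewrite -/p => Hi Ec; have Eip : i = p.
    by apply/eqP; rewrite eqn_leq Hi Ec cle.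
  move=> j; rewrite leq_eqVlt => /orP[/eqP ->|Hj]; first by rewrite -Eip.
  have : all (keep (im (s + k))) (iota 0 p).
    by rewrite all_count size_iota {2}Ec Eip.
  by move/allP; apply; rewrite mem_iota.
have pin k : K <= k -> p < size (slots (s + k)) by move=> Hk; rewrite /p -(HK k Hk); exact: Jin.
have St : steady p (s + K).
  move=> t Ht j Hj _; have -> : t = s + (t - s) by lia.
  by apply: keepall => //; lia.
exists p, (s + K); split=> //.
move=> a; pose a' := maxn a (s + K).
case: (excluded_middle_informative (exists2 t, a' <= t & full (nth [::] (im t) p))).
  case=> t; rewrite geq_max => /andP[Ha Ht] Hf; exists t => //.
  have -> : t = s + (t - s) by lia.
  apply/and3P; split; [apply: pin; lia | apply: keepall; lia | ].
  by have <- : t = s + (t - s) by lia.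
move=> N; exfalso.
have nofull t : a' <= t -> full (nth [::] (im t) p) = false.
  by move=> Ht; apply/negP => H; apply: N; exists t.
pose v k := slot (s + k) p.
have vJ k : K <= k -> v k = slot (s + k) (J k) by move=> Hk; rewrite HK.
have vsupp k q : K <= k -> (0 < nth 0 (v k) q) = desc s (y s) k q.
  by move=> Hk; rewrite -nth_supp vJ // JE nth_branch.
have vbd k : K <= k -> bounded (v k) by move=> Hk; rewrite vJ //; case: (ok k).
have vsz k : K <= k -> size (v k) = m by move=> Hk; rewrite vJ //; case: (ok k).
have vE k : a' <= s + k -> v k.+1 = track m (Mt (s + k)) F (v k).
  move=> Hk; have Kk : K <= k by rewrite /a' in Hk; lia.
  rewrite /v addnS (slot_next_steady _ (pin k Kk)).2; last by move=> j Hj _; exact: keepall.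
  by rewrite /relax; have := nofull _ Hk; rewrite (nth_map [::]) ?pin // => ->.
have [f0 Hf0 Ff] := yF (a' + s).+2; pose f := f0 - s.
have Ef : f0 = s + f by rewrite /f; lia.
rewrite Ef in Hf0 Ff.
have Hak k : f.-1 <= k -> a' <= s + k by lia.
have Kf k : f.-1 <= k -> K <= k by move=> H; have := Hak k H; rewrite /a'; lia.
have f0S : f = f.-1.+1 by lia.
have m2 : nth 0 (v f) (y (s + f)) = 2.
  rewrite f0S vE ?Hak // nth_image ?ym //.
  have Pv : 0 < nth 0 (v f.-1) (y (s + f.-1)) by rewrite vsupp ?Kf // y_desc.
  have Ed : edge (Mt (s + f.-1)) (y (s + f.-1)) (y (s + f.-1.+1)) by rewrite addnS.
  have B := bounded_nth (y (s + f.-1)) (vbd _ (Kf _ (leqnn _))).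
  case: ifP => //; rewrite -f0S Ff andbT => /norP[/hasPn N2 /hasPn N1].
  have Iy : y (s + f.-1) \in iota 0 m by rewrite mem_iota ym.
  move: (N2 _ Iy) (N1 _ Iy) Pv B; rewrite f0S /= Ed.
  by case: (nth 0 _ _) => [|[|[|c]]].
have marked k q : desc (s + f) (y (s + f)) k q -> nth 0 (v (f + k)) q = 2.
  elim: k q => [|k IH] q; first by move/eqP ->; rewrite addn0.
  case/descS=> r [Hr Hq /IH Er Ed]; rewrite addnS vE; last by apply: Hak; lia.
  rewrite nth_image //; case: ifP => // /norP[/hasPn /(_ r) H _].
  by move: H; rewrite mem_iota Hr Er eqxx /= addnA Ed => /(_ isT).
have die x : exists k, desc s (y s) f x -> x != y (s + f) -> forall q, ~~ desc (s + f) x k q.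
  case D : (desc s (y s) f x); last by exists 0.
  have [E|Nx] := eqVneq x (y (s + f)); first by exists 0.
  have : ~ immortal (s + f) x by move=> /(Hs _ _ D) E; rewrite E eqxx in Nx.
  move=> /not_all_ex_not [k Hk]; exists k => _ _ q; apply/negP => Hq.
  by apply: Hk; exists q.
(* There are finitely many side branches at time [s + f], so one [k] bounds all their lifetimes. *)
have [k Hk] : exists k, forall x, x \in iota 0 m -> desc s (y s) f x ->
    x != y (s + f) -> forall q, ~~ desc (s + f) x k q.
  elim: (iota 0 m) => [|x ls [k Hk]]; first by exists 0.
  have [k' Hk'] := die x.
  have up a1 b x' r : a1 <= b -> desc (s + f) x' b r -> exists r', desc (s + f) x' a1 r'.
    by move=> /subnKC <- /desc_split [r' [Hr _]]; exists r'.
  exists (maxn k k') => x'; rewrite inE => /orP[/eqP ->|Hx'] D1 D2 q; apply/negP.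
    by move/(up k' _ _ _ (leq_maxr _ _)) => [r' Hr']; move/negP: (Hk' D1 D2 r'); apply.
  by move/(up k _ _ _ (leq_maxl _ _)) => [r' Hr']; move/negP: (Hk x' Hx' D1 D2 r'); apply.
have Hfk : a' <= s + (f + k) by apply: Hak; lia.
have Kfk : K <= (f + k).+1 by apply: Kf; lia.
move/negP: (nofull _ Hfk); apply.
rewrite (nth_map [::]); last by apply: pin; apply: Kf; lia.
rewrite -/(v (f + k)) -vE //; apply/allP => c /(nthP 0) [q Hq <-].
rewrite vsz // in Hq; apply/negP => /eqP E1.
have D : desc s (y s) (f + k).+1 q by rewrite -vsupp // E1.
rewrite -addnS in D; have [x [D1 D2]] := desc_split D.
have Hx : x \in iota 0 m by rewrite mem_iota /= (desc_lt (ym s) D1).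
have [Ex|Nx] := eqVneq x (y (s + f)).
  by have := marked k.+1 q; rewrite -Ex D2 addnS E1 => /(_ isT).
have [r [D3 _]] : exists r, desc (s + f) x k r /\ desc (s + f + k) r 1 q.
  by apply: desc_split; rewrite addn1.
by move/negP: (Hk x Hx D1 Nx r); apply.
Qed.
End Complete.
End Determinization.

(** * The parity condition *)

Definition parity_accepts (f : nat -> nat) := exists c,
  [/\ ~~ odd c, infinitely_often (fun i => f i == c)
    & forall d, infinitely_often (fun i => f i == d) -> d <= c].

Lemma infinitely_often_max (f : nat -> nat) B X : (forall t, f t <= B) ->
  infinitely_often (fun t => X <= f t) -> exists c,
  [/\ X <= c, infinitely_often (fun t => f t == c)
    & forall d, infinitely_often (fun t => f t == d) -> d <= c].
Proof.
move=> HB; elim: {X}(B - X).+1 {-2}X (ltnSn (B - X)) => // k IH X Hk HX.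
case: (excluded_middle_informative (infinitely_often (fun t => X.+1 <= f t))) => H.
  have [t _ Ht] := H 0; have LB := HB t.
  have [|c [H1 H2 H3]] := IH X.+1 _ H; first by lia.
  by exists c; split=> //; exact: ltnW.
have [T HT] : exists T, forall t, T <= t -> f t <= X.
  have := H => /not_all_ex_not [T HT]; exists T => t Ht; rewrite leqNgt.
  by apply/negP => L; apply: HT; exists t.
exists X; split=> // [i|d Hd].
  have [t Ht HXt] := HX (maxn i T); exists t; first by lia.
  by rewrite eqn_leq HXt HT //; lia.
by have [t Ht /eqP <-] := Hd T; exact: HT.
Qed.

(** Removals and firings belong to steps whereas colors sit on states, so each color shows up one
    step late, after an arbitrary initial color. *)
Lemma parity_accepts_shift (f : nat -> nat) x :
  parity_accepts (fun i => if i is i'.+1 then f i' else x) <-> parity_accepts f.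
Proof.
have E c : infinitely_often (fun i => (if i is i'.+1 then f i' else x) == c) <->
    infinitely_often (fun i => f i == c).
  split=> H i; first by have [[|j] Hj Ej] := H i.+1 => //; exists j.
  by have [j Hj Ej] := H i; exists j.+1 => //; exact: leqW.
split=> -[c [H1 H2 H3]]; exists c; split=> //; try exact/E.
  by move=> d /E; exact: H3.
by move=> d /E; exact: H3.
Qed.

Lemma first_index_max L (B : pred nat) k : k <= L -> first_index L B k <= L.
Proof.
move=> Hk; rewrite leqNgt; apply/negP => H; move: (H); rewrite /first_index.
case E : (filter B (iota 0 k)) => [|x r] /=; first by rewrite ltnn.
have : x \in filter B (iota 0 k) by rewrite E mem_head.
by rewrite mem_filter mem_iota /=; lia.
Qed.

Lemma slots_color_lt L im : slots_color L im < 2 * L + 2.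
Proof. by rewrite /slots_color; case: ifP; lia. Qed.

Section Colors.
Variables (m i0 : nat) (Mt : nat -> seq (seq bool)) (F : seq bool) (L : nat).
Local Notation slots t := (slots m i0 Mt F t).
Local Notation im t := (images m (Mt t) F (slots t)).
Hypothesis size_le : forall t, size (slots t) <= L.

(** If [2 * (L - p)] is the largest recurring color, position [p] fires infinitely often, and
    eventually nothing at or before it is removed, as that would give a larger odd color. *)
Lemma parity_green : parity_accepts (fun t => slots_color L (im t)) <->
  exists p T, steady m i0 Mt F p T /\ green m i0 Mt F p.
Proof.
have szL t : size (im t) <= L by rewrite size_map.
have rL t : removed_at L (im t) <= L by exact: first_index_max.
have gL t : green_at L (im t) <= L by exact: first_index_max.
split=> [[c [Oc Ic Mc]]|[p [T [St Gr]]]].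
  have [T HT] : exists T, forall t, T <= t -> slots_color L (im t) <= c.
    apply: NNPP => N.
    have H : infinitely_often (fun t => c < slots_color L (im t)).
      move=> T; apply: NNPP => N2; apply: N; exists T => t Ht; rewrite leqNgt.
      by apply/negP => H; apply: N2; exists t.
    have [|d [H1 H2 _]] := @infinitely_often_max (fun t => slots_color L (im t))
      (2 * L + 2) c.+1 _ H; last by have := Mc d H2; lia.
    by move=> t; exact: ltnW (slots_color_lt _ _).
  have gr t : slots_color L (im t) = c ->
      [/\ green_at L (im t) < removed_at L (im t) & c = 2 * (L - green_at L (im t))].
    rewrite /slots_color; case: leqP => // _ E; exfalso; move: Oc; rewrite -E.
    by rewrite oddD oddM.
  have [t0 _ /eqP /gr [G0 Ec]] := Ic 0.
  pose p := green_at L (im t0); have pL : p < L by exact: leq_trans G0 (rL t0).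
  exists p, T; split.
    move=> t Ht j Hj Hsz; apply/negPn/negP => Nk.
    have Hr : removed_at L (im t) <= j by apply: first_index_le; rewrite ?size_map.
    have := HT t Ht; rewrite /slots_color Ec -/p.
    by case: (leqP (removed_at L (im t)) (green_at L (im t))) => H; lia.
  move=> i; have [t Ht /eqP Et] := Ic i; exists t => //.
  have [G1 Ec'] := gr t Et; have Ep : green_at L (im t) = p.
    by rewrite Ec in Ec'; move: (gL t) (gL t0); rewrite /p; lia.
  have := @first_index_lt L (fun j => keep (im t) j && full (nth [::] (im t) j)) (size (im t)).
  rewrite -/(green_at L (im t)) Ep size_map => /(_ pL) [-> /andP[-> ->]] //.
have [t0 Ht0 /and3P[Hp0 _ _]] := Gr T.
have pL : p < L by exact: leq_trans Hp0 (size_le t0).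
have rp t : T <= t -> p < removed_at L (im t).
  move=> Ht; rewrite ltnNge; apply/negP => H.
  have [] := @first_index_lt L (fun j => ~~ keep (im t) j) (size (im t)).
    exact: leq_ltn_trans H pL.
  by rewrite -/(removed_at L (im t)) size_map => H1; rewrite (St t Ht).
have HX : infinitely_often (fun t => 2 * (L - p) <= slots_color L (im t)).
  move=> i; have [t Ht /and3P[H1 H2 H3]] := Gr (maxn i T); exists t; first by lia.
  have Hg : green_at L (im t) <= p by apply: first_index_le; rewrite ?size_map ?H2.
  have := rp t; rewrite /slots_color.
  by case: (leqP (removed_at L (im t)) (green_at L (im t))); lia.
(* The largest recurring color may come from an older position than [p]. It is at least
   [2 * (L - p)], and an odd color of that size would mean a removal at or before [p]. *)
have [|c [H1 H2 H3]] := @infinitely_often_max (fun t => slots_color L (im t))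
  (2 * L + 2) (2 * (L - p)) _ HX.
  by move=> t; exact: ltnW (slots_color_lt _ _).
exists c; split=> //; apply/negP => Oc.
have [t Ht /eqP Et] := H2 T; have := rp t Ht; move: Et H1 Oc; rewrite /slots_color.
case: (leqP (removed_at L (im t)) (green_at L (im t))) => [_|_ <-]; last by rewrite oddM.
by lia.
Qed.
End Colors.

(** * Slots as words *)

Section Encoding.
Variables (m L : nat).

Definition slots_word (c : nat) (st : seq (seq nat)) : seq nat :=
  c :: flatten st ++ nseq (L * m - size (flatten st)) 0.

(** A live tracker is not a block of zeros, so liveness separates the trackers from the padding. *)
Definition word_slots (x : seq nat) : seq (seq nat) :=
  [seq v <- [seq take m (drop (j * m) (behead x)) | j <- iota 0 L] | live v].

Lemma size_flatten_slots (st : seq (seq nat)) :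
  (forall v, v \in st -> size v = m) -> size (flatten st) = size st * m.
Proof.
elim: st => //= v st IH H; rewrite size_cat IH => [|u Hu].
  by rewrite H ?mem_head // mulSn.
by rewrite H // inE Hu orbT.
Qed.

Lemma slots_wordK c st : size st <= L ->
  (forall v, v \in st -> size v = m /\ live v) ->
  word_slots (slots_word c st) = st.
Proof.
move=> Hs H; rewrite /word_slots /slots_word [behead _]/= size_flatten_slots; last first.
  by move=> v /H [].
elim: st L Hs H => [|v st IH] [|K] // Hs H.
  rewrite -[flatten _ ++ _]/(nseq _ 0).
  rewrite (eq_in_filter (a2 := pred0)) ?filter_pred0 // => _ /mapP [j _ ->].
  by apply/negbTE/hasP => -[x /mem_take /mem_drop]; rewrite mem_nseq => /andP[_ /eqP ->].
have [sv lv] := H v (mem_head _ _).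
rewrite [iota _ _]/= [map _ _]/= mul0n drop0 -catA take_size_cat // [filter _ _]/= lv.
congr (_ :: _); rewrite -[1]addn0 iotaDl -map_comp.
rewrite -[RHS](IH K) //; last by move=> u Hu; apply: H; rewrite inE Hu orbT.
congr filter; apply: eq_map => j /=.
by rewrite mulnDl mul1n addnC -drop_drop drop_size_cat // !mulSn subnDl.
Qed.

Lemma slots_word_mem c st B : c < B -> 2 < B -> size st <= L ->
  (forall v, v \in st -> size v = m /\ bounded v) ->
  slots_word c st \in words B (1 + L * m).
Proof.
move=> Hc HB Hs H; have E : size (flatten st) = size st * m.
  by apply: size_flatten_slots => v /H [].
rewrite mem_words /= size_cat size_nseq subnKC; last by rewrite E leq_mul2r Hs orbT.
rewrite add1n eqxx /= Hc all_cat all_nseq (ltn_trans _ HB) // orbT andbT.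
apply/allP => x /flattenP [v /H [_ /allP Bv] /Bv Hx].
exact: leq_ltn_trans Hx HB.
Qed.
End Encoding.

(** * Size estimates *)

(** The [n - b] factors of the factorial above [b] are all at least [b]. *)
Lemma expn_fact b n : 0 < b -> b <= n -> b ^ (n - b) <= n`!.
Proof.
move=> Hb; elim: n => [|n IH]; first by rewrite leqn0 => /eqP ->.
rewrite leq_eqVlt => /orP[/eqP <-|]; first by rewrite subnn fact_gt0.
rewrite ltnS => H; rewrite factS subSn // expnS; apply: leq_mul; last exact: IH.
exact: leqW.
Qed.

(** The words number at most [m ^ (3 * (1 + m ^ 3))], since [2 * m ^ 2 + 2] is at most [m ^ 3],
    while the right-hand side is at least [m ^ (2 * (m ^ 4 - m))]. The summand [2 * n] reserves
    states for colors that the words do not show. *)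
Lemma slots_words_count m (n := m ^ 4) : 3 <= m ->
  (2 * (m * m) + 2) ^ (1 + m * m * m) + 2 * n <= n`! ^ 2.
Proof.
move=> Hm.
have mn : m <= n by rewrite -{1}(expn1 m) leq_exp2l //; lia.
have F : m ^ (2 * (n - m)) <= n`! ^ 2.
  by rewrite mulnC expnM leq_exp2r // expn_fact //; lia.
apply: leq_trans F.
have B3 : 2 * (m * m) + 2 <= m ^ 3.
  by rewrite !expnS expn0 muln1; nia.
have P1 : (2 * (m * m) + 2) ^ (1 + m * m * m) <= m ^ (3 * (1 + m * m * m)).
  by rewrite expnM leq_exp2r.
set e := 3 * (1 + m * m * m) in P1.
have e4 : 4 <= e by rewrite /e; nia.
have nE : n = m * (m * m * m) by rewrite /n !expnS expn0; lia.
have Le : e.+1 <= 2 * (n - m).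
  rewrite nE /e; set c := m * m * m.
  have Hc : 9 * m <= c by rewrite /c; nia.
  have : 3 * c <= m * c by rewrite leq_mul2r Hm orbT.
  lia.
apply: leq_trans (_ : m ^ e.+1 <= _); last by rewrite leq_exp2l //; lia.
have H2 : n <= m ^ e by rewrite leq_exp2l //; lia.
have H3 : 3 * m ^ e <= m * m ^ e by rewrite leq_mul2r Hm orbT.
by rewrite expnS; lia.
Qed.

Lemma uniq_words b l : uniq (words b l).
Proof.
elim: l => // l IH; rewrite [words _ _]/=; apply: allpairs_uniq => //.
  exact: iota_uniq.
by move=> [c x] [d y] _ _ /= [-> ->].
Qed.

(** * Automata given by tables *)

Section TableAutomata.
Variables (S : finType) (mat : S -> seq (seq bool)) (F : seq bool).

Definition table_nba n (q0 : 'I_n) : nba S :=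
  @NBA S 'I_n q0 (fun q a => [set r : 'I_n | edge (mat a) q r])
    [set q : 'I_n | nth false F q].

Definition table_dpa n (q0 : 'I_n) (step : seq (seq bool) -> nat -> nat)
    (col : nat -> nat) : dpa S :=
  @DPA S 'I_n q0 (fun q a => insubd q0 (step (mat a) q)) (fun q => col q).

Lemma map_enum_ord T n (f : nat -> T) :
  [seq f (nat_of_ord q) | q <- enum 'I_n] = [seq f i | i <- iota 0 n].
Proof. by rewrite -val_enum_ord -map_comp. Qed.

Lemma dord_ord n (q : 'I_n) : dord q = dnum q.
Proof. by rewrite /dord enum_rank_ord. Qed.

Lemma dset_ord n (B : pred nat) :
  dset [set r : 'I_n | B r] = enc [seq B i | i <- iota 0 n].
Proof.
rewrite /dset /enc /code_seq -map_comp -map_enum_ord; congr dlist.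
by apply: eq_map => r; rewrite inE.
Qed.

Definition nba_code n i0 (mats : seq (seq (seq bool))) : data :=
  dlist [:: dnum i0;
    enc [seq [seq [seq edge M i j | j <- iota 0 n] | M <- mats] | i <- iota 0 n];
    enc [seq nth false F i | i <- iota 0 n]].

Lemma dnba_table n (q0 : 'I_n) :
  dnba (table_nba q0) = nba_code n q0 [seq mat a | a <- enum S].
Proof.
rewrite /dnba /nba_code /= dord_ord; congr (DCons _ (DCons _ (DCons _ _))).
  rewrite /enc /code_seq -map_comp -map_enum_ord; congr dlist.
  apply: eq_map => q /=; congr dlist; rewrite -!map_comp.
  by apply: eq_map => a /=; rewrite dset_ord.
by rewrite dset_ord.
Qed.

Definition dpa_code n i0 (step : seq (seq bool) -> nat -> nat) (col : nat -> nat)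
    (mats : seq (seq (seq bool))) : data :=
  dlist [:: dnum i0;
    enc [seq [seq step M i | M <- mats] | i <- iota 0 n];
    enc [seq col i | i <- iota 0 n]].

Lemma ddpa_table n (q0 : 'I_n) step col : (forall M i, step M i < n) ->
  ddpa (table_dpa q0 step col) = dpa_code n q0 step col [seq mat a | a <- enum S].
Proof.
move=> H; rewrite /ddpa /dpa_code /= dord_ord; congr (DCons _ (DCons _ (DCons _ _))).
  rewrite /enc /code_seq -map_comp -map_enum_ord; congr dlist.
  apply: eq_map => q /=; congr dlist; rewrite -!map_comp.
  by apply: eq_map => a /=; rewrite dord_ord val_insubd H.
by rewrite /enc /code_seq -map_comp -map_enum_ord.
Qed.

Definition table_run (i0 m : nat) (w : nat -> S) (y : nat -> nat) :=
  [/\ y 0 = i0, forall i, y i < m, forall i, edge (mat (w i)) (y i) (y i.+1)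
    & infinitely_often (fun i => nth false F (y i))].

(** The padding states from [m] on have no outgoing edges, so no infinite run visits them. *)
Lemma table_nba_accepts m n (q0 : 'I_n) (w : nat -> S) : m <= n ->
  (forall a p q, edge (mat a) p q -> p < m) ->
  nba_accepts (table_nba q0) w <-> exists y, table_run q0 m w y.
Proof.
move=> mn em; split=> [[rho [r0 rt rf]]|[y [y0 ym ye yf]]].
  have ed i : edge (mat (w i)) (rho i) (rho i.+1) by have := rt i; rewrite /= inE.
  exists (fun i => nat_of_ord (rho i)); split=> // [||i]; first by rewrite r0.
    by move=> i; exact: em (ed i).
  by have [j Hj Fj] := rf i; exists j => //; move: Fj; rewrite /= inE.
have E i : val (insubd q0 (y i)) = y i by rewrite val_insubd (leq_trans (ym i)).
exists (fun i => insubd q0 (y i)); split=> [|i|i].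
- by apply: val_inj; rewrite /= E.
- by rewrite /= inE /= !E.
- by have [j Hj Fj] := yf i; exists j => //; rewrite /= inE /= E.
Qed.
End TableAutomata.

Section SlotsAutomaton.
Variables (m n : nat) (F : seq bool).

Definition dpa_words : seq (seq nat) := words (2 * (m * m) + 2) (1 + m * m * m).

Definition dpa_start (i0 : nat) : nat :=
  index (slots_word m (m * m) 1 [:: single m i0]) dpa_words.

Definition dpa_next (M : seq (seq bool)) (st : seq (seq nat)) : nat :=
  index (slots_word m (m * m) (slots_color (m * m) (images m M F st))
           (slots_step m M F st)) dpa_words.

(* The states that encode no word, beyond the size of [dpa_words], are
   unreachable; they only supply the missing states and colors. *)
Definition dpa_step (M : seq (seq bool)) (i : nat) : nat :=
  if i < size dpa_words then
    dpa_next M (word_slots m (m * m) (nth [::] dpa_words i))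
  else 0.

Definition dpa_col (i : nat) : nat :=
  if i < size dpa_words then head 0 (nth [::] dpa_words i)
  else minn (i - size dpa_words) (2 * n).-1.

Lemma size_dpa_words : size dpa_words = (2 * (m * m) + 2) ^ (1 + m * m * m).
Proof. exact: size_words. Qed.

Lemma dpa_step_lt N M i : size dpa_words < N -> dpa_step M i < N.
Proof.
rewrite /dpa_step; case: ifP => _ H; last exact: leq_ltn_trans H.
by apply: leq_ltn_trans H; exact: index_size.
Qed.

(** The spare states alone show every color below [2 * n]; the colors of words are at most
    [2 * (m * m) + 1], which [m * m < n] keeps in that range. *)
Lemma dpa_colors (S : finType) (mat : S -> seq (seq bool)) N (q0 : 'I_N) :
  0 < n -> m * m < n -> size dpa_words + 2 * n <= N ->
  dpa_num_colors (table_dpa mat q0 dpa_step dpa_col) = 2 * n.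
Proof.
move=> n0 mn HN; rewrite /dpa_num_colors -[RHS](size_iota 0).
apply/perm_size/uniq_perm; rewrite ?undup_uniq ?iota_uniq // => c.
rewrite mem_undup mem_iota /= add0n; apply/codomP/idP => [[q ->]|Hc] /=.
  rewrite /dpa_col; case: ifP => Hq; last by lia.
  have := mem_nth [::] Hq; rewrite {2}/dpa_words mem_words.
  case: (nth _ _ _) => [|b x] /=; first by lia.
  by case/andP=> _ /andP[Hb _]; lia.
have Hi : size dpa_words + c < N by lia.
exists (Ordinal Hi); rewrite /= /dpa_col ltnNge leq_addr /=.
by rewrite addKn; lia.
Qed.

Section Accept.
Variables (S : finType) (mat : S -> seq (seq bool)) (w : nat -> S) (i0 : nat).
Hypotheses (i0m : i0 < m)
  (em : forall a p q, edge (mat a) p q -> p < m /\ q < m).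
Let Mt i := mat (w i).
Hypothesis reach_inj : forall t p p' q, reach m i0 Mt t p -> reach m i0 Mt t p' ->
    edge (Mt t) p q -> edge (Mt t) p' q -> p = p'.

Lemma table_dpa_accepts N (q0 : 'I_N) : val q0 = dpa_start i0 ->
  size dpa_words < N ->
  dpa_accepts (table_dpa mat q0 dpa_step dpa_col) w <->
  exists y, table_run mat F i0 m w y.
Proof.
move=> Eq0 HN; pose sl t := slots m i0 Mt F t.
pose col t := if t is t'.+1 then slots_color (m * m) (images m (Mt t') F (sl t'))
  else 1.
pose wd t := slots_word m (m * m) (col t) (sl t).
have inv t := slots_inv F i0m reach_inj t.
have sz t : size (sl t) <= m * m by exact: size_slots.
have wdW t : wd t \in dpa_words.
  have [I1 _ _ _ _] := inv t; apply: slots_word_mem => //; last by move=> v /I1 [].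
    by rewrite /col; case: t {inv sz I1} => [|t]; [lia | exact: slots_color_lt].
  by case: (m) i0m => //; lia.
have wdK t : word_slots m (m * m) (wd t) = sl t.
  by have [I1 _ _ _ _] := inv t; apply: slots_wordK => // v /I1 [].
have runE t : val (dpa_run (table_dpa mat q0 dpa_step dpa_col) w t) =
    index (wd t) dpa_words.
  elim: t => [|t IH]; first by rewrite /= Eq0.
  rewrite [dpa_run _ _ _]/= val_insubd dpa_step_lt //.
  rewrite -[nat_of_ord _]/(val _) IH /dpa_step index_mem wdW nth_index //.
  by rewrite /dpa_next wdK.
have colE t : dpa_color (dpa_run (table_dpa mat q0 dpa_step dpa_col) w t) = col t.
  rewrite /= -[nat_of_ord _]/(val _) runE /dpa_col index_mem wdW nth_index //.
have -> : dpa_accepts (table_dpa mat q0 dpa_step dpa_col) w <-> parity_accepts col.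
  have IE c : infinitely_often (fun i =>
      dpa_color (dpa_run (table_dpa mat q0 dpa_step dpa_col) w i) == c) <->
      infinitely_often (fun i => col i == c).
    by split=> H i; have [j Hj Ej] := H i; exists j => //; move: Ej; rewrite colE.
  split=> -[c [H1 H2 H3]]; exists c; split=> //; try exact/IE.
    by move=> d /IE; exact: H3.
  by move=> d /IE; exact: H3.
rewrite parity_accepts_shift (parity_green sz).
split=> [[p [T [St Gr]]]|[y [y0 ym ye yf]]].
  have [y [H1 H2 H3 H4]] := det_sound i0m reach_inj St Gr.
  by exists y; split.
exact: (det_complete i0m reach_inj y0 ym ye yf).
Qed.
End Accept.
End SlotsAutomaton.

(** * The construction *)

Definition codes (t : data) : seq data := undup (code_subs t).1.

Definition nba_words k t := words (cap k).+1 (2 * width (codes t) + 1).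

Definition nba_matrix u k t (a : seq bool) : seq (seq bool) :=
  [seq [seq nba_step u k t (codes t) (width (codes t)) a x y
          | y <- nba_words k t] | x <- nba_words k t].

Definition nba_finals k t : seq bool :=
  [seq nba_fin (width (codes t)) x | x <- nba_words k t].

Definition nba_start k t : nat :=
  index (nseq (2 * width (codes t) + 1) 2) (nba_words k t).

(** The rank [u] of p and the list of letters depend on [P] only, so they can be constants of the
    program; the formula and the bound are its input. *)
Definition construct_code u (letters : seq (seq bool)) k t : data :=
  let: m := size (nba_words k t) in
  DCons (nba_code (nba_finals k t) (m ^ 4) (nba_start k t)
           [seq nba_matrix u k t a | a <- letters])
        (dpa_code ((m ^ 4)`! ^ 2) (dpa_start m (nba_start k t))
           (dpa_step m (nba_finals k t)) (dpa_col m (m ^ 4))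
           [seq nba_matrix u k t a | a <- letters]).

(** * Computability of the whole construction *)

Section ComputabilityConstruction.
Context {X : Type} {x0 : code X}.
Implicit Types (k m n i : X -> nat) (t : X -> data).

Lemma computable_codes t : computable t -> computable (fun x => codes (t x)).
Proof. by move=> *; rewrite /codes; computability. Qed.

Lemma computable_edge (M : X -> seq (seq bool)) m n :
  computable M -> computable m -> computable n ->
  computable (fun x => edge (M x) (m x) (n x)).
Proof. by move=> *; rewrite /edge; computability. Qed.

Lemma computable_live (v : X -> seq nat) :
  computable v -> computable (fun x => live (v x)).
Proof. by move=> *; rewrite /live; computability. Qed.

Lemma computable_full (v : X -> seq nat) :
  computable v -> computable (fun x => full (v x)).
Proof. by move=> *; rewrite /full; computability. Qed.

Lemma computable_supp (v : X -> seq nat) :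
  computable v -> computable (fun x => supp (v x)).
Proof. by move=> *; rewrite /supp; computability. Qed.

Lemma computable_single m n :
  computable m -> computable n -> computable (fun x => single (m x) (n x)).
Proof. by move=> *; rewrite /single; computability. Qed.
End ComputabilityConstruction.

Ltac computable_det0 :=
  first [ simple apply computable_codes | simple apply computable_edge
        | simple apply computable_live | simple apply computable_full
        | simple apply computable_supp | simple apply computable_single
        | simple apply computable_nba_step ].
Ltac computable_nba := first [ computable_base | computable_local
  | computable_gl0 | computable_gl1 | computable_node0 | computable_node1
  | computable_node2 | computable_node3 ].
Ltac computable_user ::= first [ computable_nba | computable_det0 ].

Section ComputabilityConstruction1.
Context {X : Type} {x0 : code X}.
Implicit Types (k m n u i : X -> nat) (t : X -> data) (F : X -> seq bool).
Implicit Types (M st : X -> seq (seq bool)).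

Lemma computable_nba_words k t :
  computable k -> computable t -> computable (fun x => nba_words (k x) (t x)).
Proof. by move=> *; rewrite /nba_words; computability. Qed.

Lemma computable_relax (v : X -> seq nat) :
  computable v -> computable (fun x => relax (v x)).
Proof. by move=> *; rewrite /relax; computability. Qed.

Lemma computable_track m M F (v : X -> seq nat) :
  computable m -> computable M -> computable F -> computable v ->
  computable (fun x => track (m x) (M x) (F x) (v x)).
Proof. by move=> *; rewrite /track; computability. Qed.

Lemma computable_keep (im : X -> seq (seq nat)) i :
  computable im -> computable i -> computable (fun x => keep (im x) (i x)).
Proof. by move=> *; rewrite /keep; computability. Qed.

Lemma computable_fresh m (ks : X -> seq (seq nat)) :
  computable m -> computable ks -> computable (fun x => fresh (m x) (ks x)).
Proof. by move=> *; rewrite /fresh; computability. Qed.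

Lemma computable_first_index n (B : X -> nat -> bool) k :
  computable n -> computable (fun y : X * nat => B y.1 y.2) -> computable k ->
  computable (fun x => first_index (n x) (B x) (k x)).
Proof. by move=> *; rewrite /first_index; computability. Qed.

Lemma computable_slots_word m n k (st : X -> seq (seq nat)) :
  computable m -> computable n -> computable k -> computable st ->
  computable (fun x => slots_word (m x) (n x) (k x) (st x)).
Proof. by move=> *; rewrite /slots_word; computability. Qed.

Lemma computable_word_slots m n (v : X -> seq nat) :
  computable m -> computable n -> computable v ->
  computable (fun x => word_slots (m x) (n x) (v x)).
Proof. by move=> *; rewrite /word_slots; computability. Qed.

Lemma computable_dpa_words m :
  computable m -> computable (fun x => dpa_words (m x)).
Proof. by move=> *; rewrite /dpa_words; computability. Qed.
End ComputabilityConstruction1.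

Ltac computable_det1 :=
  first [ simple apply computable_nba_words | simple apply computable_relax
        | simple apply computable_track | simple apply computable_keep
        | simple apply computable_fresh | simple apply computable_first_index
        | simple apply computable_slots_word
        | simple apply computable_word_slots
        | simple apply computable_dpa_words ].
Ltac computable_user ::= first [ computable_nba | computable_det0 | computable_det1 ].

Section ComputabilityConstruction2.
Context {X : Type} {x0 : code X}.
Implicit Types (k m n u i : X -> nat) (t : X -> data) (F : X -> seq bool).
Implicit Types (M : X -> seq (seq bool)) (st im : X -> seq (seq nat)).

Lemma computable_nba_matrix u k t F :
  computable u -> computable k -> computable t -> computable F ->
  computable (fun x => nba_matrix (u x) (k x) (t x) (F x)).
Proof. by move=> *; rewrite /nba_matrix; computability. Qed.

Lemma computable_nba_finals k t :
  computable k -> computable t -> computable (fun x => nba_finals (k x) (t x)).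
Proof. by move=> *; rewrite /nba_finals; computability. Qed.

Lemma computable_nba_start k t :
  computable k -> computable t -> computable (fun x => nba_start (k x) (t x)).
Proof.
move=> *; rewrite /nba_start; computability.
by apply: (computable_nseq (A := nat)); computability.
Qed.

Lemma computable_kept im : computable im -> computable (fun x => kept (im x)).
Proof. by move=> *; rewrite /kept; computability. Qed.

Lemma computable_images m M F st :
  computable m -> computable M -> computable F -> computable st ->
  computable (fun x => images (m x) (M x) (F x) (st x)).
Proof. by move=> *; rewrite /images; computability. Qed.

Lemma computable_slots_color n im :
  computable n -> computable im ->
  computable (fun x => slots_color (n x) (im x)).
Proof.
by move=> *; rewrite /slots_color /removed_at /green_at; computability.
Qed.

Lemma computable_dpa_start m i :
  computable m -> computable i -> computable (fun x => dpa_start (m x) (i x)).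
Proof. by move=> *; rewrite /dpa_start; computability. Qed.

Lemma computable_dpa_col m n i :
  computable m -> computable n -> computable i ->
  computable (fun x => dpa_col (m x) (n x) (i x)).
Proof. by move=> *; rewrite /dpa_col; computability. Qed.
End ComputabilityConstruction2.

Ltac computable_det2 :=
  first [ simple apply computable_nba_matrix | simple apply computable_nba_finals
        | simple apply computable_nba_start | simple apply computable_kept
        | simple apply computable_images | simple apply computable_slots_color
        | simple apply computable_dpa_start | simple apply computable_dpa_col ].
Ltac computable_user ::=
  first [ computable_nba | computable_det0 | computable_det1 | computable_det2 ].

Lemma computable_slots_step {X : Type} {x0 : code X} (m : X -> nat)
    (M : X -> seq (seq bool)) (F : X -> seq bool) (st : X -> seq (seq nat)) :
  computable m -> computable M -> computable F -> computable st ->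
  computable (fun x => slots_step (m x) (M x) (F x) (st x)).
Proof. by move=> *; rewrite /slots_step; computability. Qed.

Lemma computable_dpa_next {X : Type} {x0 : code X} (m : X -> nat)
    (F : X -> seq bool) (M : X -> seq (seq bool)) (st : X -> seq (seq nat)) :
  computable m -> computable F -> computable M -> computable st ->
  computable (fun x => dpa_next (m x) (F x) (M x) (st x)).
Proof.
move=> *; rewrite /dpa_next; computability.
by simple apply computable_slots_step; computability.
Qed.

Lemma computable_dpa_step {X : Type} {x0 : code X} (m : X -> nat)
    (F : X -> seq bool) (M : X -> seq (seq bool)) (i : X -> nat) :
  computable m -> computable F -> computable M -> computable i ->
  computable (fun x => dpa_step (m x) (F x) (M x) (i x)).
Proof.
move=> *; rewrite /dpa_step; computability.
by simple apply computable_dpa_next; computability.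
Qed.

Lemma computable_construct u letters : computable (fun x : data * nat =>
  construct_code u letters x.2 x.1).
Proof.
rewrite /construct_code /nba_code /dpa_code /dlist /=; computability;
  apply: computable_enc; computability;
  by simple apply computable_dpa_step; computability.
Qed.

Theorem theorem7 :
  exists c : nat,
  forall (P : finType) (V : eqType),
  exists construct : prog,
  forall (phi : form P V) (z : V) (alpha : V -> nat),
    well_formed phi ->
    vars phi =i [:: z] ->
    exists (n : nat) (A : nba {set option P}) (D : dpa {set option P}),
      [/\ n <= (3 * (alpha z + 1)) ^ (c * fsize phi),
          #|nba_state A| = n
            /\ (forall w, nba_accepts A w <-> sat w alpha phi 0),
          [/\ #|dpa_state D| = (n`!) ^ 2,
              dpa_num_colors D = 2 * n
            & forall w, dpa_accepts D w <-> sat w alpha phi 0]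
        & eval construct (DCons (dform [:: z] phi) (dnum (alpha z)))
                         (DCons (dnba A) (ddpa D))].
Proof.
(* The number of states is the fourth power of [(3 * (alpha z + 1)) ^ (2 * l + 1)], and [2 * l + 1]
   is at most [2 * fsize phi]. *)
exists 8 => P V.
pose u := dnat (dord (None : option P)).
have letter_p (A : {set option P}) : nth false (letter A) u = (None \in A).
  exact: nth_letter.
pose letters := [seq letter A | A <- enum [the finType of {set option P}]].
have [g [prg Hprg] Hg] := computable_construct u letters.
exists prg => phi z alpha _ vars_phi.
pose k := alpha z; pose t := dform [:: z] phi.
pose s := codes t; pose l := width s; pose Qs := nba_words k t.
pose m := size Qs; pose n := m ^ 4; pose N := n`! ^ 2.
pose F := nba_finals k t; pose mat (A : {set option P}) := nba_matrix u k t (letter A).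
have mE : m = (3 * (k + 1)) ^ (2 * l + 1).
  by rewrite /m /Qs size_words; congr (_ ^ _); rewrite /cap; lia.
have m3 : 3 <= m.
  rewrite mE (addnC (2 * l)) expnS.
  by apply: leq_trans (_ : 3 * (k + 1) * 1 <= _); [lia|];
    rewrite leq_mul2l expn_gt0; lia.
have mn : m <= n by rewrite -{1}(expn1 m) leq_exp2l //; lia.
have HN : size (dpa_words m) + 2 * n <= N.
  by rewrite size_dpa_words; exact: slots_words_count.
pose i0 := nba_start k t.
have startQ : nseq (2 * l + 1) 2 \in Qs := start_word_ok phi z alpha.
have i0m : i0 < m by rewrite /i0 /nba_start index_mem.
have i0n : i0 < n by exact: leq_trans i0m mn.
have n0 : 0 < n by exact: leq_ltn_trans i0n.
have sN : size (dpa_words m) < N.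
  by apply: leq_trans HN; rewrite -[X in X < _]addn0 ltn_add2l muln_gt0.
have iD : dpa_start m i0 < N by exact: leq_ltn_trans (index_size _ _) sN.
have matE A p q : edge (mat A) p q =
    [&& p < m, q < m & nba_step u k t s l (letter A) (nth [::] Qs p) (nth [::] Qs q)].
  rewrite /edge /mat /nba_matrix; have [Hp|Hp] := ltnP p m; last first.
    by rewrite (nth_default [::]) ?size_map // nth_nil.
  rewrite (nth_map [::]) //; have [Hq|Hq] := ltnP q m; last first.
    by rewrite nth_default ?size_map.
  by rewrite (nth_map [::]).
have em A p q : edge (mat A) p q -> p < m /\ q < m.
  by rewrite matE => /and3P[].
have FE q : q < m -> nth false F q = nba_fin l (nth [::] Qs q).
  by move=> Hq; rewrite (nth_map [::]).
have Qok p : p < m -> word_ok phi z alpha (nth [::] Qs p) by move=> Hp; exact: mem_nth.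
have runs w : (exists y, table_run mat F i0 m w y) <-> sat w alpha phi 0.
  split=> [[y [y0 ym ye yf]]|Hs].
    apply: (@run_sound P V phi z alpha vars_phi u letter_p w (fun i => nth [::] Qs (y i))).
    split=> [|i|i|i].
    - by rewrite y0 nth_index.
    - exact: Qok.
    - by have := ye i; rewrite matE => /and3P[].
    - by have [j Hj Fj] := yf i; exists j => //; rewrite -FE.
  have [x [x0 wx sx fx]] := @run_complete P V phi z alpha vars_phi u letter_p w Hs.
  have ym i : index (x i) Qs < m by rewrite index_mem; exact: wx.
  have xE i : nth [::] Qs (index (x i) Qs) = x i by apply: nth_index; exact: wx.
  exists (fun i => index (x i) Qs); split=> // [|i|i].
  - by rewrite x0.
  - by rewrite matE !ym !xE; exact: sx.
  - by have [j Hj Fj] := fx i; exists j => //; rewrite FE ?xE.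
(* At time 0 only the initial state is reachable. Later both sources have been entered by the same
   letter, so their flags agree and differ from the initial mark, and [nba_step_inj] applies. *)
have inj w tm p p' q : reach m i0 (fun i => mat (w i)) tm p ->
    reach m i0 (fun i => mat (w i)) tm p' ->
    edge (mat (w tm)) p q -> edge (mat (w tm)) p' q -> p = p'.
  case: tm => [|tm]; first by rewrite /reach /= => /eqP -> /eqP ->.
  move=> /descS [r [_ Hp _ Er]] /descS [r' [_ Hp' _ Er']].
  rewrite add0n in Er Er'; rewrite !matE => /and3P[_ _ Ep] /and3P[_ _ Ep'].
  have hd x x' : edge (mat (w tm)) x x' -> head 0 (nth [::] Qs x') = nth false (letter (w tm)) u.
    by rewrite matE => /and3P[_ _ /nba_step_head].
  have E := @nba_step_inj P V phi z alpha u _ _ _ _ (Qok p Hp) (Qok p' Hp') _ _ Ep Ep'.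
  apply/eqP; rewrite -(nth_uniq [::] Hp Hp' (uniq_words _ _)); apply/eqP; apply: E.
    by rewrite (hd _ _ Er); case: (nth _ _ _).
  by rewrite (hd _ _ Er) (hd _ _ Er').
exists n, (table_nba mat F (Ordinal i0n)),
  (table_dpa mat (Ordinal iD) (dpa_step m F) (dpa_col m n)); split.
- rewrite /n mE -expnM leq_exp2l; last by lia.
  have := width_le alpha vars_phi; rewrite -/t -/(codes t) -/s -/l; lia.
- split; first by rewrite card_ord.
  move=> w; rewrite -runs; apply: table_nba_accepts => //.
  by move=> a p q /em [].
- split; first by rewrite card_ord.
    apply: dpa_colors => //.
    by rewrite /n !expnS expn0 muln1; nia.
  move=> w; rewrite -runs; apply: table_dpa_accepts => //; exact: inj.
- have E : g (DCons t (dnum k)) = construct_code u letters k t by exact: Hg (t, k).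
  have := Hprg (DCons t (dnum k)); rewrite E.
  rewrite dnba_table ddpa_table; last by move=> M i; exact: dpa_step_lt.
  suff -> : [seq mat A | A <- enum [the finType of {set option P}]] =
      [seq nba_matrix u k t a | a <- letters] by [].
  by rewrite /letters -map_comp.
Qed.
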